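(* Let $\delta>0$. Then, for every positive sequence $\{\beta_n\}$ with $\lim_{n\to\infty}\beta_n=0$, there is an absolutely continuous measure $\psi$, $d\psi=\psi'dx$, supported on $[-1,1]$, such that $\psi'(x)\ge\delta$ for a.e. $x\in[-1,1]$, and there are a constant $c>0$ and a strictly increasing sequence $\{k_n\}\subset\mathbb N$ such that $$|P_{k_n}(0,\psi)|\ge c\,\beta_{k_n}\sqrt{k_n}\qquad\text{for all } n .$$
   Context: For a finite positive measure $\psi$ on $[-1,1]$ with infinitely many points of growth, $\{P_k(x,\psi)\}_{k\ge0}$ are the polynomials orthonormal with respect to $\psi$: $\deg P_k=k$, positive leading coefficient, $\int_{-1}^1P_k(x,\psi)P_m(x,\psi)\,d\psi(x)=\delta_{k,m}$ (Kronecker delta). *)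

(* Defs.v *)
From HB Require Import structures.
From mathcomp Require Import all_boot all_order all_algebra.
From mathcomp Require Import all_classical all_reals all_analysis.

Set Implicit Arguments.
Unset Strict Implicit.
Unset Printing Implicit Defensive.

Import Order.TTheory GRing.Theory Num.Theory.
Import numFieldNormedType.Exports.

Local Open Scope classical_set_scope.
Local Open Scope ring_scope.

(* [P k] is P_k(., psi).  Such a family is unique when it exists, and it exists
   exactly when psi, restricted to [-1, 1], has infinitely many points of
   growth.  [size p] is the degree of [p] plus one. *)
Definition orthonormal_polynomials (R : realType)
    (psi : {finite_measure set (measurableTypeR R) -> \bar R})
    (P : nat -> {poly R}) : Prop :=
  [/\ forall k, size (P k) = k.+1,
      forall k, 0 < lead_coef (P k) &
      forall k m, (\int[psi]_(x in `[(-1)%R, 1%R]) ((P k).[x] * (P m).[x])%:E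
                   = ((k == m)%:R)%:E)%E].

(* Main.v *)
Require Import Defs.
From HB Require Import structures.
From mathcomp Require Import all_boot all_order all_algebra.
From mathcomp Require Import ring lra.
From mathcomp Require Import all_classical all_reals all_analysis.
From mathcomp Require Import measurable_realfun.

Set Implicit Arguments.
Unset Strict Implicit.
Unset Printing Implicit Defensive.

Import Order.TTheory GRing.Theory Num.Theory.
Import numFieldNormedType.Exports.

Local Open Scope classical_set_scope.
Local Open Scope charge_scope.
Local Open Scope ring_scope.

(** The measure psi is the arcsine measure delta / sqrt (1 - x^2) dx, whose
    density is at least delta, plus a series of humps: even measures of small
    mass with bounded densities, each carried by a set at a positive distance
    from the origin. The i-th hump is responsible for the size of the
    orthonormal polynomial of one even degree n_i at 0.

    The whole difficulty is to find, for every even degree n = 2 m, a hump of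
    small mass after whose addition to the arcsine measure the squared value at
    0 of the orthonormal polynomial of degree n is at least c m, with c
    depending on the mass only (hump_exists). In the variable x^2 = sin^2 t,
    Gauss-Chebyshev quadrature is exact at the zeros v_k of the polynomial T
    with T(sin^2 t) = cos (2 m t). Let
      W(x) = T(x) (9 - sum_k c_k / (x - v_k)),   c_k > 0,
    and P = W + kappa T. The zeros s_j of W interlace the v_k, and P becomes
    orthogonal to all polynomials of lower degree once suitable masses are
    placed at the s_j: it is enough to test P against the quotients
    W / (X - s_j), each of which determines one mass. The masses are
    nonnegative when c_k E_k(v_k)^2, with E_k = T / (X - v_k), decreases in k
    (hforceE). The first of these values is made much larger than the others,
    so that P(0) is of order sqrt m (humpP_0), while the norm of P stays bounded
    (hump_norm). The sum of the masses is bounded by a constant over kappa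
    (sum_hmass), because the values decay like a power of k for which a double
    sum over pairs of nodes can be estimated (sum_interaction).

    Two stability properties allow such humps to be superposed. Humps already
    present, being away from 0 and dominated by the arcsine measure, change the
    value at 0 by a factor that does not depend on the degree
    (large_at0_localize). The orthonormal polynomial of a fixed degree depends
    continuously on finitely many moments, uniformly over all functionals above
    that of the arcsine measure (large_at0_near), so the point masses can be
    smoothed (smooth_pairs) and humps of sufficiently small mass can be added
    later. Since beta_n tends to 0, the factors lost at a step are recovered by
    choosing the degree large enough (next_hump), and the sequence of humps is
    obtained by dependent choice (stages_exist). All of this is phrased in terms
    of moment sequences; the measures enter through their moments only. *)

(** * Moment functionals and orthogonal polynomials *)

(** A measure enters the algebra only through the linear functional that it
    induces on polynomials, so that functional is presented by an arbitrary
    sequence of moments. *)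
Definition mom (R : nzRingType) (a : nat -> R) (p : {poly R}) : R :=
  \sum_(i < size p) p`_i * a i.

Lemma momE (R : nzRingType) (a : nat -> R) (p : {poly R}) N :
  (size p <= N)%N -> mom a p = \sum_(i < N) p`_i * a i.
Proof.
move=> pN; rewrite /mom (big_ord_widen _ (fun i => p`_i * a i) pN) big_mkcond /=.
apply: eq_bigr => i _; case: ltnP => // ip.
by rewrite nth_default // mul0r.
Qed.

Lemma mom_is_linear (R : comNzRingType) (a : nat -> R) : scalar (mom a).
Proof.
move=> c p q /=; pose N := maxn (size p) (size q).
have pN : (size p <= N)%N by rewrite leq_maxl.
have qN : (size q <= N)%N by rewrite leq_maxr.
have sN : (size (c *: p + q)%R <= N)%N.
  apply: leq_trans (size_polyD _ _) _; rewrite geq_max qN andbT.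
  exact: leq_trans (size_scale_leq _ _) pN.
rewrite (momE _ pN) (momE _ qN) (momE _ sN) mulr_sumr -big_split /=.
by apply: eq_bigr => i _; rewrite coefD coefZ mulrDl mulrA.
Qed.

HB.instance Definition _ (R : comNzRingType) (a : nat -> R) :=
  GRing.isLinear.Build R {poly R} R *%R (mom a) (mom_is_linear a).

Lemma momXn (R : comNzRingType) (a : nat -> R) k : mom a 'X^k = a k.
Proof.
rewrite (@momE _ _ _ k.+1) ?size_polyXn // big_ord_recr /= coefXn eqxx mul1r.
by rewrite big1 ?add0r // => i _; rewrite coefXn ltn_eqF ?mul0r.
Qed.

Lemma momD (R : comNzRingType) (a b : nat -> R) p :
  mom (fun k => a k + b k) p = mom a p + mom b p.
Proof. by rewrite /mom -big_split; apply: eq_bigr => i _; rewrite mulrDr. Qed.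

Section OrthogonalPolynomials.
Context {R : rcfType}.
Implicit Types (a b F : nat -> R) (p q r Q : {poly R}).

Definition psd a := forall p, 0 <= mom a (p ^+ 2).
Definition pd a := forall p, p != 0 -> 0 < mom a (p ^+ 2).
Definition moments_even a := forall k, odd k -> a k = 0.
Definition dominates a b := forall p, mom b (p ^+ 2) <= mom a (p ^+ 2).

Lemma momZ a c p : mom a (c *: p) = c * mom a p.
Proof. exact: linearZ. Qed.

Lemma mom_CS a p q : psd a ->
  mom a (p * q) ^+ 2 <= mom a (p ^+ 2) * mom a (q ^+ 2).
Proof.
move=> pa; set A := mom a (p ^+ 2); set B := mom a (p * q).
set C := mom a (q ^+ 2).
have key x y : 0 <= x ^+ 2 * A + 2 * x * y * B + y ^+ 2 * C.
  have := pa (x *: p + y *: q).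
  have -> : (x *: p + y *: q) ^+ 2 =
    (x ^+ 2) *: p ^+ 2 + (2 * x * y) *: (p * q) + (y ^+ 2) *: q ^+ 2.
    by rewrite -!mul_polyC !rmorphM /= ?rmorphXn /=; rewrite polyC_natr; ring.
  by rewrite !linearD /= !momZ.
have C0 : 0 <= C := pa q.
have [C1|C1] := eqVneq C 0.
  rewrite C1 mulr0.
  have [->|B0] := eqVneq B 0; first by rewrite expr0n.
  have := key 1 (- (A + 1) / (2 * B)).
  rewrite C1 mulr0 addr0 expr1n !mul1r mulr1.
  have -> : 2 * (- (A + 1) / (2 * B)) * B = - (A + 1) by field.
  by rewrite opprD addrA subrr sub0r oppr_ge0 ler10.
have C2 : 0 < C by rewrite lt_def C1 C0.
have := key C (- B).
have -> : C ^+ 2 * A + 2 * C * - B * B + (- B) ^+ 2 * C = C * (A * C - B ^+ 2).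
  by ring.
by rewrite pmulr_rge0 // subr_ge0.
Qed.

(** Gram-Schmidt: the residue of 'X^n is orthogonal to all lower degrees, and
    subtracting its Fourier component extends a projection by one degree. *)
Lemma mom_proj a n p : pd a ->
  exists2 r : {poly R}, (size r <= n)%N &
    forall q, (size q <= n)%N -> mom a ((p - r) * q) = 0.
Proof.
move=> pda; elim: n p => [|n IHn] p.
  exists 0; rewrite ?size_poly0 // => q.
  by rewrite size_poly_leq0 => /eqP ->; rewrite mulr0 raddf0.
have [s ss os] := IHn 'X^n; have [r sr orr] := IHn p.
set q0 := 'X^n - s.
have sq0 : size q0 = n.+1.
  by rewrite size_polyDl ?size_polyXn // size_polyN ltnS.
have q0n : q0 != 0 by rewrite -size_poly_eq0 sq0.
have N0 := pda _ q0n.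
exists (r + (mom a ((p - r) * q0) / mom a (q0 ^+ 2)) *: q0).
  apply: leq_trans (size_polyD _ _) _.
  rewrite geq_max (leq_trans sr) //=.
  by apply: leq_trans (size_scale_leq _ _) _; rewrite sq0.
move=> q sq; set c := _ / _.
have [t [d [st ->]]] : exists (t : {poly R}) (d : R), (size t <= n)%N /\ q = t + d *: q0.
  exists (q - q`_n *: q0), q`_n.
  split; last by rewrite subrK.
  apply/leq_sizeP => j nj; rewrite coefB coefZ.
  have [->|jn] := eqVneq j n.
    by rewrite /q0 coefB coefXn eqxx (nth_default 0 ss) subr0 mulr1 subrr.
  have jn1 : (n < j)%N by rewrite ltn_neqAle eq_sym jn.
  by rewrite (nth_default 0 (leq_trans sq jn1)) [q0`_j]nth_default ?sq0 // mulr0 subr0.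
have -> : (p - (r + c *: q0)) * (t + d *: q0) =
   (p - r) * t + d *: ((p - r) * q0) - c *: (q0 * t) - (c * d) *: (q0 ^+ 2).
  by rewrite -!mul_polyC !rmorphM /=; ring.
rewrite !(linearB, linearD) /= !momZ (orr _ st) (os _ st : mom a (q0 * t) = 0) /c.
by field; rewrite gt_eqF.
Qed.

Definition is_op a n Q := Q \is monic /\ size Q = n.+1 /\
  forall r, (size r <= n)%N -> mom a (Q * r) = 0.

Lemma op_exists a n : pd a -> exists Q, is_op a n Q.
Proof.
move=> pda; have [r sr orr] := mom_proj n 'X^n pda.
exists ('X^n - r); split; last split => //.
  rewrite monicE lead_coefDl ?lead_coefXn // size_polyXn size_polyN ltnS //.
by rewrite size_polyDl ?size_polyXn // size_polyN ltnS.
Qed.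

Lemma monic_sub_size n p q : p \is monic -> q \is monic -> size p = n.+1 ->
  size q = n.+1 -> (size (p - q)%R <= n)%N.
Proof.
move=> mp mq sp sq; apply/leq_sizeP => j nj; rewrite coefB.
have [->|jn] := eqVneq j n.
  have := monicP mp; have := monicP mq.
  by rewrite /lead_coef sp sq /= => -> ->; rewrite subrr.
have jn1 : (n < j)%N by rewrite ltn_neqAle eq_sym jn.
by rewrite !nth_default ?sp ?sq ?subr0.
Qed.

Lemma op_unique a n Q Q' : pd a -> is_op a n Q -> is_op a n Q' -> Q = Q'.
Proof.
move=> pda [mQ [sQ oQ]] [mQ' [sQ' oQ']]; apply/eqP; rewrite -subr_eq0.
apply: contraT => /pda.
have s := monic_sub_size mQ mQ' sQ sQ'.
by rewrite expr2 {1}mulrBl linearB /= oQ // oQ' // subrr ltxx.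
Qed.

(** Pythagoras: p - Q has lower degree than Q, so it is orthogonal to Q. *)
Lemma op_minimal a n Q p : psd a -> is_op a n Q -> p \is monic ->
  size p = n.+1 -> mom a (Q ^+ 2) <= mom a (p ^+ 2).
Proof.
move=> pa [mQ [sQ oQ]] mp sp; have s := monic_sub_size mp mQ sp sQ.
have -> : p ^+ 2 = Q ^+ 2 + 2 *: (Q * (p - Q)) + (p - Q) ^+ 2.
  by rewrite -mul_polyC polyC_natr; ring.
by rewrite !linearD /= momZ oQ // mulr0 addr0 lerDl.
Qed.

Lemma psdD a F : psd a -> psd F -> psd (fun k => a k + F k).
Proof. by move=> pa pF p; rewrite momD addr_ge0. Qed.

Lemma dominates_pd a b : pd b -> dominates a b -> pd a.
Proof. by move=> pb ab p /pb; move/lt_le_trans; apply. Qed.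

Lemma pd_psd a : pd a -> psd a.
Proof.
move=> pa p; have [->|/pa/ltW//] := eqVneq p 0.
by rewrite expr0n /= raddf0.
Qed.

Definition norm1 p : R := \sum_(i < size p) `|p`_i|.

Lemma norm1E p N : (size p <= N)%N -> norm1 p = \sum_(i < N) `|p`_i|.
Proof.
move=> pN; rewrite /norm1 (big_ord_widen _ (fun i => `|p`_i|) pN) big_mkcond /=.
apply: eq_bigr => i _; case: ltnP => // ip.
by rewrite nth_default // normr0.
Qed.

Lemma norm1_ge0 p : 0 <= norm1 p.
Proof. by apply: sumr_ge0 => i _. Qed.

Lemma norm1D p q : norm1 (p + q) <= norm1 p + norm1 q.
Proof.
pose N := maxn (size p) (size q).
have pN : (size p <= N)%N by rewrite leq_maxl.
have qN : (size q <= N)%N by rewrite leq_maxr.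
have sN : (size (p + q)%R <= N)%N.
  by apply: leq_trans (size_polyD _ _) _; rewrite geq_max qN andbT.
rewrite (norm1E pN) (norm1E qN) (norm1E sN) -big_split /=.
by apply: ler_sum => i _; rewrite coefD ler_normD.
Qed.

Lemma norm1Z c p : norm1 (c *: p) = `|c| * norm1 p.
Proof.
rewrite (norm1E (size_scale_leq c p)) /norm1 mulr_sumr.
by apply: eq_bigr => i _; rewrite coefZ normrM.
Qed.

Lemma norm1_sum I (s : seq I) (f : I -> {poly R}) :
  norm1 (\sum_(i <- s) f i) <= \sum_(i <- s) norm1 (f i).
Proof.
elim: s => [|i s IH]; first by rewrite !big_nil /norm1 size_poly0 big_ord0.
by rewrite !big_cons (le_trans (norm1D _ _)) // lerD2l.
Qed.

Lemma norm1XnM k p : norm1 ('X^k * p) = norm1 p.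
Proof.
have [->|p0] := eqVneq p 0; first by rewrite mulr0.
rewrite /norm1 mulrC size_mulXn // big_split_ord /= big1 ?add0r.
  by apply: eq_bigr => i _; rewrite coefMXn ltnNge leq_addr /= addKn.
by move=> i _; rewrite coefMXn ltn_ord normr0.
Qed.

Lemma norm1M p q : norm1 (p * q) <= norm1 p * norm1 q.
Proof.
rewrite -{1}[p]coefK poly_def mulr_suml.
apply: le_trans (norm1_sum _ _) _; rewrite [X in _ <= X * _]/norm1 mulr_suml.
by apply: ler_sum => i _; rewrite -scalerAl norm1Z norm1XnM.
Qed.

Lemma horner0_norm1 p : `|p.[0]| <= norm1 p.
Proof.
have [->|p0] := eqVneq p 0; first by rewrite horner0 normr0 norm1_ge0.
have := p0; rewrite -size_poly_gt0 => sp.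
rewrite horner_coef0 /norm1 -(prednK sp) big_ord_recl /= lerDl.
by apply: sumr_ge0.
Qed.

(** Any two norms on polynomials of bounded degree are equivalent; the
    induction splits off the component along the orthogonal polynomial of the
    top degree. *)
Lemma norm1_le_mom b n : pd b ->
  exists2 C, 0 < C & forall p, (size p <= n)%N -> norm1 p ^+ 2 <= C * mom b (p ^+ 2).
Proof.
move=> pb; elim: n => [|n [C C0 HC]].
  exists 1 => // p; rewrite size_poly_leq0 => /eqP ->.
  by rewrite /norm1 size_poly0 big_ord0 [X in mom b X]expr0n /= raddf0 mulr0 expr0n.
have [Q [mQ [sQ oQ]]] := op_exists n pb.
have Q0 : 0 < mom b (Q ^+ 2) by apply: pb; rewrite -size_poly_eq0 sQ.
set D := norm1 Q ^+ 2 / mom b (Q ^+ 2).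
have D0 : 0 <= D by rewrite divr_ge0 ?sqr_ge0 // ltW.
exists (2 * C + 2 * D) => [|p sp]; first lra.
set c := p`_n; set r := p - c *: Q.
have sr : (size r <= n)%N.
  apply/leq_sizeP => j nj; rewrite coefB coefZ.
  have [->|jn] := eqVneq j n.
    by have := monicP mQ; rewrite /lead_coef sQ /= => ->; rewrite mulr1 subrr.
  have jn1 : (n < j)%N by rewrite ltn_neqAle eq_sym jn.
  by rewrite !nth_default ?sQ ?mulr0 ?subr0 // (leq_trans sp).
have pE : p = r + c *: Q by rewrite subrK.
have HP : mom b (p ^+ 2) = mom b (r ^+ 2) + c ^+ 2 * mom b (Q ^+ 2).
  have -> : p ^+ 2 = r ^+ 2 + (2 * c) *: (Q * r) + (c ^+ 2) *: Q ^+ 2.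
    rewrite {1}pE -!mul_polyC !rmorphM /= ?rmorphXn /= polyC_natr; ring.
  by rewrite !linearD /= !momZ oQ // mulr0 addr0.
have H1 : norm1 p <= norm1 r + `|c| * norm1 Q.
  by rewrite {1}pE (le_trans (norm1D _ _)) // norm1Z.
have H2 := HC _ sr.
have H3 : norm1 Q ^+ 2 = D * mom b (Q ^+ 2) by rewrite /D; field; rewrite gt_eqF.
have r0 : 0 <= mom b (r ^+ 2) := pd_psd pb r.
have H4 : (`|c| * norm1 Q) ^+ 2 = D * (c ^+ 2 * mom b (Q ^+ 2)).
  by rewrite exprMn H3 real_normK ?num_real //; ring.
have H5 : norm1 p ^+ 2 <= (norm1 r + `|c| * norm1 Q) ^+ 2.
  by rewrite ler_sqr ?nnegrE ?norm1_ge0 // (le_trans (norm1_ge0 p)).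
apply: le_trans H5 _; rewrite HP.
set y := c ^+ 2 * _ in H4 *; have y0 : 0 <= y by rewrite mulr_ge0 ?sqr_ge0 // ltW.
set u := norm1 r in H2 *; set v := `|c| * _ in H4 *.
have H6 : (u + v) ^+ 2 <= 2 * u ^+ 2 + 2 * v ^+ 2 by have := sqr_ge0 (u - v); nra.
apply: le_trans H6 _; rewrite H4.
have : 0 <= C * y by rewrite mulr_ge0 // ltW.
have : 0 <= D * mom b (r ^+ 2) by rewrite mulr_ge0.
nra.
Qed.

Lemma mom_near a a' e n p : (size p <= n)%N ->
  (forall k, (k < n)%N -> `|a' k - a k| <= e) ->
  `|mom a' p - mom a p| <= e * norm1 p.
Proof.
move=> sp H; rewrite (momE _ sp) (momE a sp) (norm1E sp) -sumrB mulr_sumr.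
apply: le_trans (ler_norm_sum _ _ _) _; apply: ler_sum => i _.
by rewrite -mulrBr normrM mulrC ler_wpM2r // H.
Qed.

(** Lower bound B for the square at 0 of the orthonormal polynomial of degree
    n. Leaving the polynomial unnormalized avoids square roots, and makes it
    possible to exhibit a multiple that is convenient to compute with. *)
Definition large_at0 a n B := exists Q, size Q = n.+1 /\
  (forall r, (size r <= n)%N -> mom a (Q * r) = 0) /\
  B * mom a (Q ^+ 2) < Q.[0] ^+ 2.

Lemma large_at0_monic a n B : large_at0 a n B ->
  exists2 Q, is_op a n Q & B * mom a (Q ^+ 2) < Q.[0] ^+ 2.
Proof.
case=> Q [sQ [oQ BQ]].
have Q0 : Q != 0 by rewrite -size_poly_eq0 sQ.
have l0 : lead_coef Q != 0 by rewrite lead_coef_eq0.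
exists ((lead_coef Q)^-1 *: Q).
  split; first by rewrite monicE lead_coefZ mulVf.
  split; first by rewrite size_scale ?invr_eq0.
  by move=> r sr; rewrite -scalerAl momZ oQ // mulr0.
rewrite hornerZ exprZn momZ exprMn mulrCA ltr_pM2l //.
by rewrite exprn_even_gt0 //= invr_eq0.
Qed.

Lemma large_at0_op a n B Q : pd a -> large_at0 a n B -> is_op a n Q ->
  B * mom a (Q ^+ 2) < Q.[0] ^+ 2.
Proof. by move=> pa /large_at0_monic[Q' oQ' H] /(op_unique pa oQ') <-. Qed.

Lemma is_op_large a n B Q : is_op a n Q -> B * mom a (Q ^+ 2) < Q.[0] ^+ 2 ->
  large_at0 a n B.
Proof. by case=> _ [sQ oQ] H; exists Q. Qed.

Lemma large_at0_weaken a n B B' : psd a -> B' <= B -> large_at0 a n B ->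
  large_at0 a n B'.
Proof.
move=> pa BB [Q [sQ [oQ BQ]]]; exists Q; split=> //; split=> //.
by apply: le_lt_trans BQ; rewrite ler_wpM2r.
Qed.

(** The orthogonal polynomial depends continuously on finitely many moments,
    uniformly over the functionals that dominate a fixed definite one: with r
    the difference of the two orthogonal polynomials, orthogonality gives
    a' (r^2) = - a' (Q r), whose right-hand side is of the order of the
    perturbation times the size of r. *)
Lemma large_at0_near a b n B : pd b -> dominates a b -> 0 <= B ->
  large_at0 a n B -> exists2 e, 0 < e & forall a', dominates a' b ->
  (forall k, (k < n.*2.+1)%N -> `|a' k - a k| <= e) -> large_at0 a' n B.
Proof.
move=> pb ab B0 /large_at0_monic[Q [mQ [sQ oQ]] BQ].
have [C C0 HC] := norm1_le_mom n pb.
set N := norm1 Q; have N0 : 0 <= N := norm1_ge0 Q.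
set v := mom a (Q ^+ 2) in BQ *; set q := `|Q.[0]|.
have q0 : 0 <= q by exact: normr_ge0.
have BQ' : B * v < q ^+ 2 by rewrite real_normK ?num_real.
(* With e = (q^2 - B v) / W the inequality B (v + e N^2) < q^2 - 2 q C e N,
   which is linear in e, holds with the margin e. *)
set W := B * N ^+ 2 + 2 * q * C * N + 1.
have W0 : 0 < W.
  have : 0 <= B * N ^+ 2 by rewrite mulr_ge0 ?sqr_ge0.
  have : 0 <= 2 * q * C * N by rewrite !mulr_ge0 // ltW.
  rewrite /W; lra.
exists ((q ^+ 2 - B * v) / W); first by rewrite divr_gt0 // subr_gt0.
set e := _ / _ => a' ab' H.
have e0 : 0 < e by rewrite divr_gt0 // subr_gt0.
have pa' := dominates_pd pb ab'.
have [Q' oQ'] := op_exists n pa'; have [mQ' [sQ' oQ'']] := oQ'.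
apply: (is_op_large oQ').
set r := Q' - Q; have sr : (size r <= n)%N by exact: monic_sub_size.
have near p : (size p <= n.*2.+1)%N -> `|mom a' p - mom a p| <= e * norm1 p.
  by move=> sp; apply: mom_near sp H.
have E1 : mom a' (r ^+ 2) = - mom a' (Q * r).
  have : mom a' (Q' * r) = 0 by exact: oQ''.
  have -> : Q' * r = r ^+ 2 + Q * r by rewrite /r; ring.
  by rewrite linearD => /eqP; rewrite addr_eq0 => /eqP.
have E2 : `|mom a' (Q * r)| <= e * (N * norm1 r).
  have := near (Q * r); rewrite oQ // subr0 => H2.
  apply: le_trans (H2 _) _.
    apply: leq_trans (size_polyMleq _ _) _.
    by rewrite sQ addSn /= -addnn -addnS leq_add2l leqW.
  by rewrite ler_wpM2l ?norm1M // ltW.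
have E3 : norm1 r <= C * e * N.
  have H1 := HC _ sr; have H2 := ab' r.
  have H3 : norm1 r ^+ 2 <= C * (e * (N * norm1 r)).
    apply: le_trans H1 _; rewrite ler_pM2l //; apply: le_trans H2 _.
    by rewrite E1 (le_trans (ler_norm _)) // normrN.
  have [r0|r0] := eqVneq (norm1 r) 0.
    by rewrite r0 (mulr_ge0 (mulr_ge0 (ltW C0) (ltW e0))).
  have r1 : 0 < norm1 r by rewrite lt_def r0 norm1_ge0.
  rewrite -(ler_pM2r r1) -expr2; apply: le_trans H3 _.
  by rewrite le_eqVlt; apply/orP; left; apply/eqP; ring.
have E4 : mom a' (Q' ^+ 2) <= v + e * N ^+ 2.
  apply: le_trans (op_minimal (pd_psd pa') oQ' mQ sQ) _.
  rewrite -lerBlDl; apply: le_trans (ler_norm _) _.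
  apply: le_trans (near _ _) _.
    apply: leq_trans (size_polyMleq _ _) _.
    by rewrite sQ addnS /= addSn addnn.
  rewrite ler_wpM2l //; first exact: ltW.
  by rewrite expr2 (le_trans (norm1M _ _)).
have E5 : q - C * e * N <= `|Q'.[0]|.
  have -> : Q' = Q + r by rewrite /r addrC subrK.
  rewrite hornerD; apply: le_trans (lerB_normD _ _).
  by rewrite lerB // (le_trans (horner0_norm1 r)).
have E6 : e * W = q ^+ 2 - B * v by rewrite /e divfK // gt_eqF.
have E7 : q ^+ 2 - 2 * q * (C * e * N) <= Q'.[0] ^+ 2.
  have -> : Q'.[0] ^+ 2 = `|Q'.[0]| ^+ 2 by rewrite real_normK ?num_real.
  have z0 : 0 <= C * e * N by rewrite (mulr_ge0 (mulr_ge0 (ltW C0) (ltW e0))).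
  have w0 : 0 <= `|Q'.[0]| by exact: normr_ge0.
  set z := C * e * N in E5 z0 *; set w := `|Q'.[0]| in E5 w0 *.
  have [qz|qz] := leP q z; nra.
apply: lt_le_trans E7.
apply: le_lt_trans (ler_wpM2l B0 E4) _.
have : e * W = e * (B * N ^+ 2) + e * (2 * q * C * N) + e by rewrite /W; ring.
rewrite E6; have -> : B * (v + e * N ^+ 2) = B * v + e * (B * N ^+ 2) by ring.
have -> : 2 * q * (C * e * N) = e * (2 * q * C * N) by ring.
lra.
Qed.

Definition support_in_unit a := forall p, mom a (('X * p) ^+ 2) <= mom a (p ^+ 2).

Lemma comp_opp_size p : size (p \Po (- 'X)) = size p.
Proof. by rewrite size_comp_poly2 // size_polyN size_polyX. Qed.

Lemma mom_reflect a p : moments_even a -> mom a (p \Po (- 'X)) = mom a p.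
Proof.
move=> ea; rewrite -{1}[p]coefK poly_def raddf_sum /= raddf_sum /=.
apply: eq_bigr => i _; rewrite comp_polyZ momZ comp_Xn_poly exprNn.
rewrite -polyC1 -polyCN -rmorphXn /= mul_polyC momZ momXn.
have [oi|oi] := boolP (odd i); first by rewrite ea // !mulr0.
by rewrite -signr_odd (negbTE oi) expr0 mul1r.
Qed.

(** Reflection maps the orthogonal polynomial of odd degree to its opposite. *)
Lemma op_odd0 a n Q : pd a -> moments_even a -> odd n -> is_op a n Q -> Q.[0] = 0.
Proof.
move=> pa ea on oQ; have [mQ [sQ oQ1]] := oQ.
suff E : Q = - (Q \Po (- 'X)).
  have : Q.[0] = - Q.[0].
    by rewrite {1}E hornerN horner_comp hornerN hornerX oppr0.
  by move/eqP; rewrite -addr_eq0 -mulr2n mulrn_eq0 /= => /eqP.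
apply: (op_unique pa oQ); split; last split.
- rewrite monicE lead_coefN lead_coef_comp ?size_polyN ?size_polyX //.
  rewrite lead_coefN lead_coefX sQ /= (monicP mQ) mul1r -signr_odd on expr1.
  by rewrite opprK.
- by rewrite size_polyN comp_opp_size.
- move=> r sr; rewrite -mom_reflect // comp_polyM !rmorphN /=.
  rewrite -comp_polyA !rmorphN /= comp_polyX opprK comp_polyXr mulNr linearN /=.
  by rewrite oQ1 ?oppr0 // comp_opp_size.
Qed.

(** Adding mass F away from the origin costs only a constant factor, which does
    not depend on the degree. Write S = X G for the orthogonal polynomial of
    degree n - 1 of L = a + F, and h = L(S^2). On polynomials p of degree less
    than n the functional p |-> L(p G) is a multiple of evaluation at 0, since
    p G differs from p(0) G by a multiple of S. Applied to the difference of
    the orthogonal polynomials Q of a and Q' of L, this yields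
      (Q(0) - Q'(0)) h = - Q'(0) F(Q G).
    Minimality of Q gives a(Q^2) <= h, and the gap of F around the origin
    bounds F(G^2) by h / eta^2; by the inequality of Cauchy and Schwarz
    |F(Q G)| <= sqrt H h / eta, hence Q(0) and Q'(0) are comparable. *)
Lemma large_at0_localize a F H eta n B : pd a -> psd F ->
  moments_even a -> moments_even F -> support_in_unit a -> support_in_unit F ->
  0 <= H -> 0 < eta -> 0 <= B ->
  (forall p, mom F (p ^+ 2) <= H * mom a (p ^+ 2)) ->
  (forall p, eta ^+ 2 * mom F (p ^+ 2) <= mom F (('X * p) ^+ 2)) ->
  ~~ odd n -> (0 < n)%N -> large_at0 a n B ->
  large_at0 (fun k => a k + F k) n
    (B / ((1 + Num.sqrt H / eta) ^+ 2 * (1 + H))).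
Proof.
move=> pa pF ea eF ua uF H0 eta0 B0 FH Fgap on n0 /large_at0_monic[Q oQ BQ].
have [mQ [sQ oQ1]] := oQ.
set L := fun k => a k + F k.
have psa := pd_psd pa.
have aL p : mom a (p ^+ 2) <= mom L (p ^+ 2) by rewrite momD lerDl.
have FL p : mom F (p ^+ 2) <= mom L (p ^+ 2) by rewrite momD lerDr.
have pL : pd L by exact: (dominates_pd pa).
have eL : moments_even L by move=> k ok; rewrite /L ea // eF // addr0.
have uL : support_in_unit L by move=> p; rewrite !momD lerD.
have [Q' oQ'] := op_exists n pL; have [mQ' [sQ' oQ1']] := oQ'.
have [S oS] := op_exists n.-1 pL; have [mS [sS oS1]] := oS.
rewrite prednK // in sS.
have S0 : root S 0.
  apply/rootP/(op_odd0 pL eL _ oS).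
  by move: on; rewrite -{1}(prednK n0) /= negbK.
have [G SG] : exists G, S = 'X * G.
  by have /factor_theorem[G ->] := S0; exists G; rewrite polyC0 subr0 mulrC.
set h := mom L (S ^+ 2).
have h0 : 0 < h by apply: pL; rewrite -size_poly_eq0 sS -lt0n.
have S_ne0 : S != 0 by rewrite -size_poly_eq0 sS -lt0n.
have G_ne0 : G != 0 by apply: contra_neq S_ne0 => G0; rewrite SG G0 mulr0.
have sG : size G = n.-1.
  by move: sS; rewrite SG size_mul ?polyX_eq0 // size_polyX /= => <-.
set g := mom L G.
have split0 p : exists2 t, p = 'X * t + p.[0]%:P & size t = (size p).-1.
  have : root (p - p.[0]%:P) 0 by rewrite /root hornerD hornerN hornerC subrr.
  move=> /factor_theorem[t]; rewrite polyC0 subr0 => E; exists t.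
    by rewrite mulrC -E subrK.
  have pE : p = t * 'X + p.[0]%:P by rewrite -E subrK.
  by rewrite [in RHS]pE size_MXaddC; case: ifP => // /andP[/eqP-> _]; rewrite size_poly0.
have repr p : (size p <= n)%N -> mom L (p * G) = p.[0] * g.
  move=> sp; have [t tE st] := split0 p.
  have -> : p * G = S * t + p.[0] *: G.
    by rewrite {1}tE SG -mul_polyC; ring.
  by rewrite linearD /= momZ oS1 ?add0r // st; case: (size p) sp => // k; case: n n0 {sQ sQ' on sS sG oQ oQ' oS oS1 oQ1 oQ1'}.
have hE : h = - (Q'.[0] * g).
  have [t tE st] := split0 Q'.
  have : mom L (Q' * G) = 0 by apply: oQ1'; rewrite sG leq_pred.
  have -> : Q' * G = S * t + Q'.[0] *: G by rewrite {1}tE SG -mul_polyC; ring.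
  rewrite linearD /= momZ.
  have -> : mom L (S * t) = h.
    have st' : size t = size S by rewrite st sQ' sS.
    have mt : t \is monic.
      move: (monicP mQ'); rewrite monicE /lead_coef st sQ' /= {1}tE.
      rewrite coefD coefXM coefC; case: (n) n0 => // k _ /=.
      by rewrite addr0 => ->.
    have -> : S * t = S ^+ 2 + S * (t - S) by ring.
    rewrite linearD /=; have -> : mom L (S * (t - S)) = 0.
      by apply: oS1; apply: (monic_sub_size mt mS); rewrite ?st' sS prednK.
    by rewrite addr0.
  by move/eqP; rewrite addr_eq0 => /eqP.
have Q'0 : Q'.[0] != 0.
  by apply: contraTneq h0 => E; rewrite hE E mul0r oppr0 ltxx.
set k := 1 + Num.sqrt H / eta.
have k0 : 0 < k by rewrite ltr_pwDl // divr_ge0 ?sqrtr_ge0 // ltW.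
have E1 : (Q.[0] - Q'.[0]) * h = - (Q'.[0] * mom F (Q * G)).
  have := repr (Q - Q') (monic_sub_size mQ mQ' sQ sQ').
  rewrite hornerD hornerN mulrBl linearB /= oQ1' ?sG ?leq_pred // subr0.
  rewrite momD oQ1 ?sG ?leq_pred // add0r => ->.
  by rewrite hE; ring.
have ah : mom a (Q ^+ 2) <= h.
  apply: le_trans (uL S); apply: le_trans (aL _).
  apply: (op_minimal psa oQ); first by rewrite monicMl // monicX.
  by rewrite mulrC size_mulX // sS.
have E2 : mom F (Q * G) ^+ 2 <= (Num.sqrt H / eta * h) ^+ 2.
  apply: le_trans (mom_CS _ _ pF) _.
  have -> : (Num.sqrt H / eta * h) ^+ 2 = (H * h) * (h / eta ^+ 2).
    by rewrite !exprMn exprVn sqr_sqrtr //; ring.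
  have F1 : mom F (Q ^+ 2) <= H * h.
    by apply: le_trans (FH _) _; rewrite ler_wpM2l.
  have F2 : mom F (G ^+ 2) <= h / eta ^+ 2.
    rewrite ler_pdivlMr ?exprn_gt0 // mulrC; apply: le_trans (Fgap _) _.
    by rewrite -SG.
  by apply: ler_pM.
have E3 : `|Q.[0]| <= `|Q'.[0]| * k.
  have E4 : `|mom F (Q * G)| <= Num.sqrt H / eta * h.
    rewrite -ler_sqr ?nnegrE ?real_normK ?num_real //.
    by rewrite !mulr_ge0 ?sqrtr_ge0 ?invr_ge0 // ltW.
  have E5 : `|Q.[0] - Q'.[0]| * h <= `|Q'.[0]| * (Num.sqrt H / eta) * h.
    rewrite -{1}(gtr0_norm h0) -normrM E1 normrN normrM -mulrA.
    by rewrite ler_wpM2l.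
  rewrite ler_pM2r // in E5.
  have -> : Q.[0] = (Q.[0] - Q'.[0]) + Q'.[0] by rewrite subrK.
  apply: le_trans (ler_normD _ _) _.
  by rewrite /k mulrDr mulr1 addrC lerD2l.
have E6 : mom L (Q' ^+ 2) <= (1 + H) * mom a (Q ^+ 2).
  apply: le_trans (op_minimal (pd_psd pL) oQ' mQ sQ) _.
  by rewrite momD mulrDl mul1r lerD2l.
apply: (is_op_large oQ').
have H1 : 0 < 1 + H by rewrite ltr_pwDl.
have E7 : Q.[0] ^+ 2 <= Q'.[0] ^+ 2 * k ^+ 2.
  rewrite -exprMn -[X in X <= _]real_normK ?num_real //.
  rewrite -[X in _ <= X]real_normK ?num_real // normrM (gtr0_norm k0).
  by rewrite ler_sqr ?nnegrE // mulr_ge0 // ltW.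
rewrite mulrAC ltr_pdivrMr ?mulr_gt0 ?exprn_gt0 //.
apply: le_lt_trans (ler_wpM2l B0 E6) _.
have -> : B * ((1 + H) * mom a (Q ^+ 2)) = (B * mom a (Q ^+ 2)) * (1 + H) by ring.
by rewrite mulrA ltr_pM2r // (lt_le_trans BQ).
Qed.

End OrthogonalPolynomials.

(** * Chebyshev polynomials and Gauss-Chebyshev quadrature *)

Section Chebyshev.
Context {R : realType}.
Implicit Types (f g p : {poly R}) (u phi x : R).

(** The pair (T, V) with T(sin^2 t) = cos (2 j t) and
    sin (2 t) V(sin^2 t) = sin (2 j t), built from the addition formulas. The
    variable sin^2 t is the one in which even polynomials of x = sin t are
    arbitrary polynomials. *)
Fixpoint chebTV (j : nat) : {poly R} * {poly R} :=
  if j is i.+1 then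
    let: (T, V) := chebTV i in
    ((1 - 'X *+ 2) * T - ('X * (1 - 'X) * V) *+ 4, (1 - 'X *+ 2) * V + T)
  else (1, 0).
Definition chebT j := (chebTV j).1.
Definition chebV j := (chebTV j).2.

Lemma chebTS j :
  chebT j.+1 = (1 - 'X *+ 2) * chebT j - ('X * (1 - 'X) * chebV j) *+ 4.
Proof. by rewrite /chebT /chebV /=; case: (chebTV j). Qed.

Lemma chebVS j : chebV j.+1 = (1 - 'X *+ 2) * chebV j + chebT j.
Proof. by rewrite /chebT /chebV /=; case: (chebTV j). Qed.

Lemma chebTV_sin j phi :
  (chebT j).[sin phi ^+ 2] = cos (j%:R * (2 * phi)) /\
  2 * sin phi * cos phi * (chebV j).[sin phi ^+ 2] = sin (j%:R * (2 * phi)).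
Proof.
elim: j => [|j [IHT IHV]].
  by rewrite mul0r cos0 sin0 /chebT /chebV /= hornerC horner0 mulr0.
have E : j.+1%:R * (2 * phi) = j%:R * (2 * phi) + 2 * phi by rewrite -natr1; ring.
have s2 : sin (2 * phi) = 2 * sin phi * cos phi.
  by rewrite mulr_natl mulr2n sinD; ring.
have c2 : cos (2 * phi) = 1 - 2 * sin phi ^+ 2.
  by rewrite mulr_natl mulr2n cosD -!expr2 cos2sin2; ring.
have cs : 1 - sin phi ^+ 2 = cos phi ^+ 2 by rewrite -cos2sin2.
rewrite E cosD sinD s2 c2 -IHT -IHV chebTS chebVS.
rewrite !(hornerD, hornerN, hornerM, hornerMn, hornerX, hornerC) cs.
by split; ring.
Qed.

Lemma chebT_sin j phi : (chebT j).[sin phi ^+ 2] = cos (j%:R * (2 * phi)).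
Proof. by have [] := chebTV_sin j phi. Qed.

Lemma size_chebTV j : (size (chebT j) <= j.+1)%N /\ (size (chebV j) <= j)%N.
Proof.
have sMn (p : {poly R}) n : (size (p *+ n)%R <= size p)%N.
  by rewrite -mulr_natl -polyC_natr mul_polyC size_scale_leq.
have sM (p q : {poly R}) i n : (size p <= i.+1)%N -> (size q <= n)%N -> (size (p * q)%R <= i + n)%N.
  move=> sp sq; apply: leq_trans (size_polyMleq _ _) _.
  by rewrite -subn1 leq_subLR addnA add1n leq_add.
have sD (p q : {poly R}) n : (size p <= n)%N -> (size q <= n)%N -> (size (p + q)%R <= n)%N.
  by move=> sp sq; apply: leq_trans (size_polyD _ _) _; rewrite geq_max sp.
have s1 : (size (1 - 'X *+ 2 : {poly R})%R <= 2)%N.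
  by rewrite sD ?size_poly1 // size_polyN (leq_trans (sMn _ _)) // size_polyX.
have s2 : (size ('X * (1 - 'X) : {poly R})%R <= 3)%N.
  apply: (@sM _ _ 1 2); rewrite ?size_polyX //.
  by rewrite sD ?size_poly1 // size_polyN size_polyX.
elim: j => [|j [IHT IHV]]; first by rewrite /chebT /chebV /= size_poly1 size_poly0.
rewrite chebTS chebVS; split.
  apply: sD; first exact: (@sM _ _ 1 j.+1).
  by rewrite size_polyN (leq_trans (sMn _ _)) // (@sM _ _ 2 j).
by apply: sD => //; exact: (@sM _ _ 1 j).
Qed.

Lemma chebTV_deriv j : (chebT j)^`() = - (2 * j%:R * chebV j) /\
  (1 - 'X *+ 2) * chebV j + ('X * (1 - 'X) * (chebV j)^`()) *+ 2 =
  j%:R * chebT j.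
Proof.
elim: j => [|j [IHT IHV]].
  rewrite /chebT /chebV /= -polyC1 derivC deriv0 !mulr0 !mul0r oppr0; split => //.
  by rewrite mul0rn addr0.
have d1 : (1 : {poly R})^`() = 0 by rewrite -polyC1 derivC.
rewrite chebTS chebVS !(derivB, derivD, derivM, derivMn, derivX) d1 IHT -[j.+1%:R]natr1.
move: (chebT j) (chebV j) (chebV j)^`() ('X : {poly R}) (j%:R : {poly R}) IHV.
move=> T V V' x J IHV; split; apply/eqP; rewrite -subr_eq0; apply/eqP.
  transitivity (- 2 * ((1 - x *+ 2) * V + (x * (1 - x) * V') *+ 2 - J * T)).
    by ring.
  by rewrite IHV subrr mulr0.
transitivity ((1 - x *+ 2) * ((1 - x *+ 2) * V + (x * (1 - x) * V') *+ 2 - J * T)).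
  by ring.
by rewrite IHV subrr mulr0.
Qed.

(** T_j(x^2) is, up to sign, the Chebyshev polynomial of degree 2 j in x, an
    eigenfunction of (1 - x^2) D^2 - x D; the identity exhibits it as the image
    of a first order operator, all of whose values have arcsine integral 0. *)
Lemma chebT_ode j :
  let g := 'X * (chebV j \Po 'X^2) in
  (1 - 'X^2) * g^`() - 'X * g = j%:R%:P * (chebT j \Po 'X^2).
Proof.
move=> g; have [_] := chebTV_deriv j; rewrite -polyC_natr => H.
have cMn f n : (f *+ n) \Po 'X^2 = (f \Po 'X^2) *+ n by exact: raddfMn.
have cN f : (- f) \Po 'X^2 = - (f \Po 'X^2) by exact: raddfN.
have := congr1 (fun p => p \Po 'X^2) H.
rewrite /= !(comp_polyD, cN, comp_polyM, cMn, comp_polyX).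
rewrite -polyC1 !comp_polyC polyC1 => <-.
rewrite /g derivM derivX deriv_comp derivXn /=.
by ring.
Qed.

(** The angles of the Gauss-Chebyshev nodes: the zeros of T_m are the squares of
    their sines. *)
Definition node (m k : nat) : R := k.*2.+1%:R * (pi / (4 * m%:R)).

Lemma sum_cos_node m j : (0 < m)%N -> (0 < j < m.*2)%N ->
  \sum_(k < m) cos (j%:R * (2 * node m k)) = 0.
Proof.
move=> m0 /andP[j0 jm].
set al : R := j%:R * (pi / (2 * m%:R)).
have m1 : 0 < m%:R :> R by rewrite ltr0n.
have al0 : 0 < al by rewrite mulr_gt0 ?ltr0n // divr_gt0 ?pi_gt0 // mulr_gt0.
have alpi : al < pi.
  rewrite /al mulrA ltr_pdivrMr ?mulr_gt0 // mulrC ltr_pM2l ?pi_gt0 //.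
  by rewrite -natrM ltr_nat mul2n.
have s0 : sin al != 0 by rewrite gt_eqF // sin_gt0_pi // al0.
have t0 : 2 != 0 :> R by rewrite pnatr_eq0.
apply: (mulfI s0); apply: (mulfI t0); rewrite !mulr0 mulrA mulr_sumr.
have E k : 2 * sin al * cos (j%:R * (2 * node m k)) =
    sin (k.+1%:R * (2 * al)) - sin (k%:R * (2 * al)).
  have -> : k.+1%:R * (2 * al) = j%:R * (2 * node m k) + al.
    by rewrite /node /al -!natr1 -mul2n natrM; field; rewrite gt_eqF.
  have -> : k%:R * (2 * al) = j%:R * (2 * node m k) - al.
    by rewrite /node /al -!natr1 -mul2n natrM; field; rewrite gt_eqF.
  by rewrite sinD sinB; ring.
under eq_bigr do rewrite E.
rewrite -(big_mkord xpredT (fun k => sin (k.+1%:R * (2 * al)) - sin (k%:R * (2 * al)))).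
rewrite telescope_sumr // mul0r sin0 subr0.
have -> : m%:R * (2 * al) = pi *+ j.
  by rewrite -mulr_natl /al; field; rewrite gt_eqF.
elim: j {j0 jm al al0 alpi s0 E} => [|j IH]; first by rewrite mulr0n sin0.
by rewrite mulrS addrC sinDpi IH oppr0.
Qed.

Lemma node_bounds m k : (k < m)%N -> 0 < node m k < pi / 2.
Proof.
move=> km; have m1 : 0 < m%:R :> R by rewrite ltr0n (leq_ltn_trans _ km).
have := pi_gt0 R => p0.
rewrite /node mulr_gt0 ?ltr0n //= ?divr_gt0 // ?mulr_gt0 //.
have -> : k.*2.+1%:R * (pi / (4 * m%:R)) = (pi / 2) * (k.*2.+1%:R / (2 * m%:R)) :> R.
  by field; rewrite gt_eqF.
rewrite gtr_pMr ?divr_gt0 // ltr_pdivrMr ?mulr_gt0 // mul1r -natrM ltr_nat mul2n.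
by rewrite ltn_Sdouble.
Qed.

Lemma ltr_node m i k : (0 < m)%N -> (node m i < node m k) = (i < k)%N.
Proof.
move=> m0; rewrite /node ltr_pM2r; last first.
  by rewrite divr_gt0 ?pi_gt0 // mulr_gt0 ?ltr0n.
by rewrite ltr_nat ltnS ltn_double.
Qed.

Lemma ltr_sin_half x y : 0 <= x -> y <= pi / 2 -> x < y -> sin x ^+ 2 < sin y ^+ 2.
Proof.
move=> x0 yp xy; have p0 := pi_gt0 R.
have sx : 0 <= sin x by rewrite sin_ge0_pi //; apply/andP; split; lra.
rewrite ltr_pXn2r ?nnegrE //.
  by rewrite ltr_sin // in_itv /=; apply/andP; split; lra.
by rewrite sin_ge0_pi //; apply/andP; split; lra.
Qed.

Lemma chebT_node m k : (0 < m)%N -> (chebT m).[sin (node m k) ^+ 2] = 0.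
Proof.
move=> m0; rewrite chebT_sin /node.
have -> : m%:R * (2 * (k.*2.+1%:R * (pi / (4 * m%:R)))) = pi / 2 + pi *+ k :> R.
  rewrite -mulr_natl -[k.*2.+1%:R]natr1 -muln2 natrM; field.
  by rewrite pnatr_eq0 -lt0n.
elim: k => [|k IH]; first by rewrite mulr0n addr0 cos_pihalf.
by rewrite [pi *+ _]mulrSr addrA cosDpi IH oppr0.
Qed.

(** The j distinct zeros force the degree. *)
Lemma size_chebT j : size (chebT j) = j.+1.
Proof.
apply/eqP; rewrite eqn_leq (size_chebTV j).1 /=.
have [->|j0] := posnP j; first by rewrite /chebT /= size_poly1.
have T0 : chebT j != 0.
  apply/eqP => T0; have := chebT_sin j 0.
  by rewrite T0 horner0 !mulr0 cos0 => /eqP; rewrite eq_sym oner_eq0.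
pose s := [seq sin (node j k) ^+ 2 | k <- iota 0 j].
have ss : size s = j by rewrite size_map size_iota.
rewrite -[X in (X < _)%N]ss.
apply: (max_poly_roots T0).
  by apply/allP => _ /mapP[k _ ->]; rewrite /root chebT_node.
rewrite map_inj_in_uniq ?iota_uniq // => i k; rewrite !mem_iota /= !add0n => ij kj E.
have [] := ltngtP i k => // ik; exfalso.
- have := ltr_sin_half (ltW (andP (node_bounds ij)).1) (ltW (andP (node_bounds kj)).2).
  by rewrite ltr_node // ik E ltxx => /(_ isT).
- have := ltr_sin_half (ltW (andP (node_bounds kj)).1) (ltW (andP (node_bounds ij)).2).
  by rewrite ltr_node // ik E ltxx => /(_ isT).
Qed.

(** The moments of a multiple of dx / sqrt (1 - x^2) on [-1, 1] satisfy this
    equation because the derivative of sqrt (1 - x^2) g(x) is the polynomial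
    inside divided by sqrt (1 - x^2), and that primitive vanishes at both ends.
    The equation determines the sequence from b 0. *)
Definition arcsine_moments (b : nat -> R) :=
  forall g, mom b ((1 - 'X^2) * g^`() - 'X * g) = 0.

(** It suffices to compare the two sides on T_0, ..., T_(2 m - 1): apart from
    T_0 both vanish, by the differential equation and by summing cosines over an
    arithmetic progression of angles. *)
Lemma arcsine_quadrature b m f : arcsine_moments b -> (0 < m)%N ->
  (size f <= m.*2)%N ->
  mom b (f \Po 'X^2) = b 0%N / m%:R * \sum_(k < m) f.[sin (node m k) ^+ 2].
Proof.
move=> hb m0.
elim: {1 3}(m.*2) (leqnn m.*2) f => [|N IH] Nm f sf.
  move: sf; rewrite size_poly_leq0 => /eqP ->.
  rewrite comp_poly0 raddf0 big1 ?mulr0 // => i _; exact: horner0.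
set c := f`_N / lead_coef (chebT N).
have l0 : lead_coef (chebT N) != 0 by rewrite lead_coef_eq0 -size_poly_eq0 size_chebT.
have sr : (size (f - c *: chebT N)%R <= N)%N.
  apply/leq_sizeP => j nj; rewrite coefB coefZ.
  have [->|jn] := eqVneq j N.
    have -> : (chebT N)`_N = lead_coef (chebT N) by rewrite lead_coefE size_chebT.
    by rewrite divfK ?subrr.
  have jn1 : (N < j)%N by rewrite ltn_neqAle eq_sym jn.
  by rewrite (nth_default 0 (leq_trans sf jn1)) nth_default ?size_chebT // mulr0 subr0.
have := IH (ltnW Nm) _ sr.
rewrite comp_polyB comp_polyZ linearB /= momZ.
have T0 : mom b (chebT N \Po 'X^2) = b 0%N / m%:R * \sum_(k < m) (chebT N).[sin (node m k) ^+ 2].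
  have [->|N0] := posnP N.
    rewrite /chebT /= comp_polyC -[1%:P]/('X^0) momXn.
    under eq_bigr do rewrite hornerC.
    by rewrite sumr_const card_ord mulfVK // pnatr_eq0 -lt0n.
  under eq_bigr do rewrite chebT_sin.
  rewrite sum_cos_node ?N0 //= mulr0.
  have := hb ('X * (chebV N \Po 'X^2)); rewrite chebT_ode mul_polyC momZ.
  by move/eqP; rewrite mulf_eq0 pnatr_eq0 -leqn0 leqNgt N0 /= => /eqP.
rewrite T0.
have -> : \sum_(k < m) (f - c *: chebT N).[sin (node m k) ^+ 2] =
  \sum_(k < m) f.[sin (node m k) ^+ 2] - c * \sum_(k < m) (chebT N).[sin (node m k) ^+ 2].
  by rewrite mulr_sumr -sumrB; apply: eq_bigr => i _; rewrite !hornerE.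
move=> H; apply/eqP; rewrite -subr_eq0; apply/eqP.
move: H; set x := mom b _; set S1 := \sum_(k < m) _ => H.
have -> : x = (x - c * (b 0%N / m%:R * S1)) + c * (b 0%N / m%:R * S1) by ring.
rewrite H; ring.
Qed.

End Chebyshev.

(** * Sums of a slowly decaying profile *)

Section Profile.
Context {R : rcfType}.

(** Every exponent that occurs is a multiple of 1/4. *)
Definition root4 (n : nat) : R := Num.sqrt (Num.sqrt n%:R).

Lemma root4_ge0 n : 0 <= root4 n. Proof. exact: sqrtr_ge0. Qed.

Lemma root4_gt0 n : (0 < n)%N -> 0 < root4 n.
Proof. by move=> n0; rewrite !sqrtr_gt0 ltr0n. Qed.

Lemma root4X4 n : root4 n ^+ 4 = n%:R.
Proof. by rewrite -[4%N]/(2 * 2)%N exprM !sqr_sqrtr ?sqrtr_ge0. Qed.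

Lemma root4S n : root4 n.+1 ^+ 4 = root4 n ^+ 4 + 1.
Proof. by rewrite !root4X4 natr1. Qed.

Lemma ler_root4 m n : (m <= n)%N -> root4 m <= root4 n.
Proof. by move=> mn; rewrite !ler_wsqrtr // ler_nat. Qed.

Lemma root4_ge1 n : (0 < n)%N -> 1 <= root4 n.
Proof. by move=> n0; rewrite -[leLHS]sqrtr1 ler_wsqrtr // -[leLHS]sqrtr1 ler_wsqrtr // ler1n. Qed.

(** Since (root4 k.+1)^4 - (root4 k)^4 = 1, each term is at most the increment
    of the right-hand side; the same holds in the two sums that follow. *)
Lemma sum_root4_3 n : \sum_(k < n) (root4 k.+1 ^+ 3)^-1 <= 4 * root4 n.
Proof.
elim: n => [|n IH]; first by rewrite big_ord0 mulr_ge0 // root4_ge0.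
rewrite big_ord_recr /=; have := root4S n.
have a0 := root4_gt0 (ltn0Sn n); have b0 := root4_ge0 n.
have := ler_root4 (leqnSn n).
move: a0 b0 IH; move: (root4 n) (root4 n.+1) (\sum_(i < n) _) => b a S a0 b0 IH ba E.
have a3 : 0 < a ^+ 3 by rewrite exprn_gt0.
suff : (a ^+ 3)^-1 <= 4 * (a - b) by lra.
rewrite -[leLHS]mul1r ler_pdivrMr //.
apply: (@le_trans _ _ ((a - b) * (a ^+ 3 + a ^+ 2 * b + a * b ^+ 2 + b ^+ 3))).
  have -> : (a - b) * (a ^+ 3 + a ^+ 2 * b + a * b ^+ 2 + b ^+ 3) = a ^+ 4 - b ^+ 4.
    by ring.
  by rewrite E addrAC subrr add0r.
have d0 : 0 <= a - b by lra.
have -> : 4 * (a - b) * a ^+ 3 = (a - b) * (4 * a ^+ 3) by ring.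
rewrite ler_wpM2l //.
have h1 : a ^+ 2 * b <= a ^+ 3 by rewrite [a ^+ 3]exprSr ler_wpM2l ?sqr_ge0.
have h2 : b ^+ 2 <= a ^+ 2 by rewrite ler_pXn2r // nnegrE ltW.
have h3 : a * b ^+ 2 <= a ^+ 3 by rewrite [a ^+ 3]exprS ler_pM2l.
have h4 : b ^+ 3 <= a ^+ 3 by rewrite ler_pXn2r // nnegrE ltW.
lra.
Qed.

Lemma sum_root4_1 n : \sum_(k < n) (root4 k.+1)^-1 <= 2 * root4 n ^+ 3.
Proof.
elim: n => [|n IH]; first by rewrite big_ord0 mulr_ge0 // exprn_ge0 // root4_ge0.
rewrite big_ord_recr /=; have := root4S n.
have a0 := root4_gt0 (ltn0Sn n); have b0 := root4_ge0 n.
have := ler_root4 (leqnSn n).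
move: a0 b0 IH; move: (root4 n) (root4 n.+1) (\sum_(i < n) _) => b a S a0 b0 IH ba E.
suff : a^-1 <= 2 * (a ^+ 3 - b ^+ 3) by lra.
rewrite -[leLHS]mul1r ler_pdivrMr //.
have E1 : a ^+ 4 - b ^+ 4 = 1 by rewrite E addrAC subrr add0r.
rewrite -subr_ge0 -[X in _ - X]E1.
have -> : 2 * (a ^+ 3 - b ^+ 3) * a - (a ^+ 4 - b ^+ 4) =
  (a - b) * (a ^+ 3 + a * b * (a - b) + b ^+ 2 * (a + a - b)) by ring.
have ab : 0 <= a - b by rewrite subr_ge0.
have ab2 : 0 <= a + a - b by lra.
have a0' := ltW a0.
apply: mulr_ge0 => //; apply: addr_ge0; first apply: addr_ge0.
- exact: exprn_ge0.
- by rewrite !mulr_ge0.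
- by rewrite mulr_ge0 // exprn_ge0.
Qed.

Lemma sum_root4_2 n : \sum_(k < n) (root4 k.+1 ^+ 2)^-1 <= 2 * root4 n ^+ 2.
Proof.
elim: n => [|n IH]; first by rewrite big_ord0 mulr_ge0 // exprn_ge0 // root4_ge0.
rewrite big_ord_recr /=; have := root4S n.
have a0 := root4_gt0 (ltn0Sn n); have b0 := root4_ge0 n.
move: a0 b0 IH; move: (root4 n) (root4 n.+1) (\sum_(i < n) _) => b a S a0 b0 IH E.
suff : (a ^+ 2)^-1 <= 2 * (a ^+ 2 - b ^+ 2) by lra.
rewrite -[leLHS]mul1r ler_pdivrMr ?exprn_gt0 //.
have E1 : a ^+ 4 - b ^+ 4 = 1 by rewrite E addrAC subrr add0r.
rewrite -subr_ge0 -[X in _ - X]E1.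
have -> : 2 * (a ^+ 2 - b ^+ 2) * a ^+ 2 - (a ^+ 4 - b ^+ 4) = (a ^+ 2 - b ^+ 2) ^+ 2 by ring.
exact: sqr_ge0.
Qed.

(** With K = k + 1 this is m^(3/2) for k = 0 and (m / K)^(5/4) otherwise. For
    any exponent in ]1, 3/2[ the sum of the squares weighted by K^2 is of order
    m^3 and the sum of the interactions defined below is of order m^2, and
    m^(3/2) is the largest order of the value at k = 0 for which this holds. It
    is this value that makes the polynomial large at the origin. *)
Definition profile (m k : nat) : R :=
  m%:R * (if k == 0%N then root4 m ^+ 2 else root4 m / root4 k.+1 ^+ 5).

Lemma profile0 m : profile m 0 = m%:R * root4 m ^+ 2.
Proof. by []. Qed.

Lemma profileS m k : (0 < k)%N -> profile m k = m%:R * (root4 m / root4 k.+1 ^+ 5).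
Proof. by rewrite /profile lt0n => /negbTE ->. Qed.

Lemma profile_gt0 m k : (0 < m)%N -> 0 < profile m k.
Proof.
move=> m0; rewrite /profile mulr_gt0 ?ltr0n //.
by case: eqP => _; rewrite ?divr_gt0 ?exprn_gt0 ?root4_gt0.
Qed.

Lemma profile_noninc m k l : (0 < m)%N -> (k <= l)%N -> profile m l <= profile m k.
Proof.
move=> m0 kl; have m1 : 0 < m%:R :> R by rewrite ltr0n.
have y1 := root4_ge1 m0; have y0 := root4_gt0 m0.
have [l0|l0] := posnP l; first by move: kl; rewrite l0 leqn0 => /eqP ->.
have p0 := root4_gt0 (ltn0Sn l).
rewrite (profileS _ l0); have [->|k0] := posnP k.
  rewrite profile0 ler_pM2l // ler_pdivrMr ?exprn_gt0 // expr2 -mulrA ler_pMr //.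
  by rewrite (le_trans y1) // ler_peMr // ?(ltW y0) // exprn_ege1 // root4_ge1.
rewrite (profileS _ k0) ler_pM2l // ler_pM2l // lef_pV2 ?posrE ?exprn_gt0 ?root4_gt0 //.
by rewrite ler_pXn2r ?nnegrE ?root4_ge0 // ler_root4.
Qed.

Lemma profile_moment1 m : (0 < m)%N ->
  \sum_(k < m) k.+1%:R ^+ 2 * profile m k <= 2 * m%:R ^+ 3.
Proof.
move=> m0; have y1 := root4_ge1 m0; have y0 := root4_gt0 m0.
have m1 : 1 <= m%:R :> R by rewrite ler1n.
have m2 : 0 <= m%:R :> R by rewrite ler0n.
have E : root4 m ^+ 2 <= m%:R.
  by rewrite -root4X4 -[4%N]/(2 + 2)%N exprD ler_peMr ?exprn_ge0 ?exprn_ege1 // ltW.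
have bound (k : 'I_m) : k.+1%:R ^+ 2 * profile m k <= m%:R ^+ 2.
  have [k0|k0] := posnP k.
    by rewrite k0 profile0 expr1n mul1r expr2 ler_wpM2l.
  have p0 := root4_gt0 (ltn0Sn k).
  rewrite (profileS _ k0) -[k.+1%:R]root4X4 -[m%:R]root4X4.
  have pm : root4 k.+1 <= root4 m by rewrite ler_root4.
  move: pm p0 y0; move: (root4 k.+1) (root4 m) => p y pm p0 y0.
  have -> : (p ^+ 4) ^+ 2 * (y ^+ 4 * (y / p ^+ 5)) = y ^+ 5 * p ^+ 3.
    by field; rewrite gt_eqF.
  rewrite -exprM [X in _ <= X](exprD _ 5 3).
  by rewrite ler_pM2l ?exprn_gt0 // ler_pXn2r ?nnegrE // ltW.
apply: le_trans (ler_sum _ (fun k _ => bound k)) _.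
rewrite sumr_const card_ord -[_ *+ m]mulr_natr -exprSr.
have : 0 <= m%:R ^+ 3 :> R by rewrite exprn_ge0.
lra.
Qed.

Lemma profile_moment2 m : (0 < m)%N ->
  \sum_(k < m) k.+1%:R ^+ 2 * profile m k ^+ 2 <= 3 * m%:R ^+ 3.
Proof.
move=> m0; have y0 := root4_gt0 m0.
have m1 : 0 < m%:R :> R by rewrite ltr0n.
have bound (k : 'I_m) : k.+1%:R ^+ 2 * profile m k ^+ 2 <=
    (k == 0%N :> nat)%:R * m%:R ^+ 3 + m%:R ^+ 2 * root4 m ^+ 2 / root4 k.+1 ^+ 2.
  have [k0|k0] := posnP k.
    rewrite k0 profile0 expr1n !mul1r exprMn -exprM root4X4 -exprSr.
    by rewrite lerDl divr_ge0 ?mulr_ge0 ?exprn_ge0 ?root4_ge0 // ltW.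
  have p0 := root4_gt0 (ltn0Sn k).
  rewrite mul0r add0r (profileS _ k0) -[k.+1%:R]root4X4.
  move: p0 y0; move: (root4 k.+1) (root4 _) => p y p0 y0.
  by rewrite le_eqVlt; apply/orP; left; apply/eqP; field; rewrite gt_eqF.
apply: le_trans (ler_sum _ (fun k _ => bound k)) _.
rewrite big_split /= -mulr_suml -mulr_sumr.
have -> : \sum_(k < m) (k == 0%N :> nat)%:R = 1 :> R.
  case: m m0 {y0 m1 bound} => // m _.
  by rewrite big_ord_recl /= big1 ?addr0.
have := sum_root4_2 m; set S := \sum_(k < m) _ => HS.
rewrite mul1r.
have : m%:R ^+ 2 * root4 m ^+ 2 * S <= m%:R ^+ 2 * root4 m ^+ 2 * (2 * root4 m ^+ 2).
  by rewrite ler_wpM2l // mulr_ge0 ?exprn_ge0 ?root4_ge0 // ltW.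
have -> : m%:R ^+ 2 * root4 m ^+ 2 * (2 * root4 m ^+ 2) = 2 * m%:R ^+ 3.
  by rewrite -[m%:R in RHS]root4X4 -[m%:R in LHS]root4X4; ring.
lra.
Qed.

(** Up to a constant over m, the contribution of the node k, relative to
    profile m l, to the mass that is placed next to the node l. *)
Definition interaction (m k l : nat) : R :=
  k.+1%:R ^+ 2 * profile m k * `|profile m k - profile m l| /
  (profile m l * `|k.+1%:R ^+ 2 - l.+1%:R ^+ 2|).

Lemma interaction_ge0 m k l : (0 < m)%N -> 0 <= interaction m k l.
Proof.
move=> m0.
have d0 i := ltW (profile_gt0 i m0).
apply: divr_ge0; last by rewrite mulr_ge0.
by rewrite mulr_ge0 // mulr_ge0 // exprn_ge0.
Qed.

Lemma sqr_gap (p : R) : 2 <= p -> p ^+ 2 <= 4 / 3 * (p ^+ 2 - 1).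
Proof. by move=> p2; nra. Qed.

Lemma interaction_lt m k l : (l < k < m)%N ->
  interaction m k l <= 4 / 3 * (m%:R * root4 m / root4 k.+1 ^+ 5).
Proof.
move=> /andP[lk km]; have m0 : (0 < m)%N := leq_ltn_trans (leq0n _) km.
have k0 : (0 < k)%N := leq_ltn_trans (leq0n _) lk.
have m1 : 0 < m%:R :> R by rewrite ltr0n.
have dk := profile_gt0 k m0; have dl := profile_gt0 l m0.
have := profile_noninc m0 (ltnW lk); move=> dkl.
have E : m%:R * root4 m / root4 k.+1 ^+ 5 = profile m k by rewrite profileS // mulrA.
rewrite E /interaction distrC ger0_norm ?subr_ge0 //.
have KL : l.+1%:R ^+ 2 < k.+1%:R ^+ 2 :> R.
  by rewrite ltr_pXn2r ?nnegrE ?ler0n // ltr_nat.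
rewrite ger0_norm ?subr_ge0 ?(ltW KL) // ler_pdivrMr; last first.
  by rewrite mulr_gt0 ?subr_gt0.
have [l0|l0] := posnP l.
  rewrite l0 expr1n.
  have := @sqr_gap k.+1%:R; rewrite ler_nat ltnS k0 => /(_ isT).
  rewrite l0 in dl dkl.
  move: dk dl dkl; move: (profile m k) (profile m 0) (k.+1%:R ^+ 2) => x y q x0 y0 xy H.
  have q0 : 0 <= q - 1 by lra.
  have -> : 4 / 3 * x * (y * (q - 1)) = x * (4 / 3 * (q - 1)) * y by ring.
  have x0' := ltW x0; have qq : 0 <= q by lra.
  apply: ler_pM; rewrite ?subr_ge0 ?mulr_ge0 //.
    by rewrite mulrC ler_pM2l.
  by rewrite lerBlDr lerDl.
have p0 := root4_gt0 (ltn0Sn k); have q0 := root4_gt0 (ltn0Sn l).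
have y0 := root4_gt0 m0.
move: KL; rewrite (profileS _ l0) (profileS _ k0) -[k.+1%:R]root4X4 -[l.+1%:R]root4X4.
have : root4 l.+1 <= root4 k.+1 by rewrite ler_root4 // ltnW.
move: p0 q0 y0 m1; move: (root4 k.+1) (root4 l.+1) (root4 m) (m%:R : R) => p q y n p0 q0 y0 n0 qp.
rewrite -!exprM -subr_gt0 => KL.
have -> : p ^+ 8 * (n * (y / p ^+ 5)) * (n * (y / q ^+ 5) - n * (y / p ^+ 5)) =
   (n * y) ^+ 2 / (p ^+ 5 * q ^+ 5) * (p ^+ 3 * (p ^+ 5 - q ^+ 5)).
  by field; rewrite !gt_eqF.
have -> : 4 / 3 * (n * (y / p ^+ 5)) * (n * (y / q ^+ 5) * (p ^+ 8 - q ^+ 8)) =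
   (n * y) ^+ 2 / (p ^+ 5 * q ^+ 5) * (4 / 3 * (p ^+ 8 - q ^+ 8)).
  by field; rewrite !gt_eqF.
rewrite ler_pM2l ?divr_gt0 ?mulr_gt0 ?exprn_gt0 //.
have h : q ^+ 3 <= p ^+ 3 by rewrite ler_pXn2r // nnegrE ltW.
have : q ^+ 3 * q ^+ 5 <= p ^+ 3 * q ^+ 5 by rewrite ler_pM2r // exprn_gt0.
rewrite mulrBr -!exprD; lra.
Qed.

Lemma interaction_gt m k l : (k < l < m)%N ->
  interaction m k l <= (k == 0%N :> nat)%:R * (4 / 3 * m%:R * root4 m ^+ 3 / root4 l.+1 ^+ 3)
    + m%:R * root4 m / (root4 k.+1 ^+ 2 * root4 l.+1 ^+ 3).
Proof.
move=> /andP[kl lm]; have m0 : (0 < m)%N := leq_ltn_trans (leq0n _) lm.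
have l0 : (0 < l)%N := leq_ltn_trans (leq0n _) kl.
have m1 : 0 < m%:R :> R by rewrite ltr0n.
have dk := profile_gt0 k m0; have dl := profile_gt0 l m0.
have := profile_noninc m0 (ltnW kl); move=> dkl.
have p0 := root4_gt0 (ltn0Sn k); have q0 := root4_gt0 (ltn0Sn l).
have y0 := root4_gt0 m0.
rewrite /interaction ger0_norm ?subr_ge0 //.
have KL : k.+1%:R ^+ 2 < l.+1%:R ^+ 2 :> R.
  by rewrite ltr_pXn2r ?nnegrE ?ler0n // ltr_nat.
rewrite distrC ger0_norm ?subr_ge0 ?(ltW KL) // ler_pdivrMr; last first.
  by rewrite mulr_gt0 ?subr_gt0.
have [k0|k0] := posnP k.
  apply: (@le_trans _ _ (4 / 3 * m%:R * root4 m ^+ 3 / root4 l.+1 ^+ 3 *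
     (profile m l * (l.+1%:R ^+ 2 - k.+1%:R ^+ 2)))); last first.
    apply: ler_wpM2r; first by rewrite mulr_ge0 ?subr_ge0 ?(ltW KL) ?(ltW dl).
    rewrite k0 mul1r lerDl; apply: divr_ge0; first by rewrite mulr_ge0 ?ler0n ?root4_ge0.
    by rewrite mulr_ge0 ?exprn_ge0 ?root4_ge0.
  rewrite k0 expr1n mul1r profile0.
  have := @sqr_gap l.+1%:R; rewrite ler_nat ltnS l0 => /(_ isT) H.
  apply: (@le_trans _ _ ((m%:R * root4 m ^+ 2) ^+ 2)).
    rewrite [leRHS]expr2; apply: ler_wpM2l; first by rewrite mulr_ge0 ?exprn_ge0 ?ltW.
    by rewrite lerBlDr lerDl ltW.
  move: H; rewrite (profileS _ l0) -[l.+1%:R]root4X4.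
  move: q0 y0 m1; move: (root4 l.+1) (root4 m) (m%:R : R) => q y n q0 y0 n0 H.
  have -> : 4 / 3 * n * y ^+ 3 / q ^+ 3 * (n * (y / q ^+ 5) * ((q ^+ 4) ^+ 2 - 1)) =
    (n * y ^+ 2) ^+ 2 * ((4 / 3 * ((q ^+ 4) ^+ 2 - 1)) / q ^+ 8).
    by field; rewrite gt_eqF.
  rewrite ler_pMr ?exprn_gt0 ?mulr_gt0 ?exprn_gt0 // ler_pdivlMr ?exprn_gt0 // mul1r.
  by rewrite [leLHS](exprM _ 4 2).
rewrite mul0r add0r.
move: KL; rewrite (profileS _ l0) (profileS _ k0) -[k.+1%:R]root4X4 -[l.+1%:R]root4X4.
have : root4 k.+1 <= root4 l.+1 by rewrite ler_root4 // ltnW.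
move: p0 q0 y0 m1; move: (root4 k.+1) (root4 l.+1) (root4 m) (m%:R : R) => p q y n p0 q0 y0 n0 pq.
rewrite -!exprM -subr_gt0 => KL.
have -> : p ^+ 8 * (n * (y / p ^+ 5)) * (n * (y / p ^+ 5) - n * (y / q ^+ 5)) =
   (n * y) ^+ 2 / (p ^+ 2 * q ^+ 8) * (q ^+ 3 * (q ^+ 5 - p ^+ 5)).
  by field; rewrite !gt_eqF.
have -> : n * y / (p ^+ 2 * q ^+ 3) * (n * (y / q ^+ 5) * (q ^+ 8 - p ^+ 8)) =
   (n * y) ^+ 2 / (p ^+ 2 * q ^+ 8) * (q ^+ 8 - p ^+ 8).
  by field; rewrite !gt_eqF.
rewrite ler_pM2l ?divr_gt0 ?mulr_gt0 ?exprn_gt0 //.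
have h : p ^+ 3 <= q ^+ 3 by rewrite ler_pXn2r // nnegrE ltW.
have : p ^+ 3 * p ^+ 5 <= q ^+ 3 * p ^+ 5 by rewrite ler_pM2r // exprn_gt0.
rewrite mulrBr -!exprD; lra.
Qed.

(** The total is of order m^2, which is what keeps the total mass of the humps
    bounded in m: each of the m humps carries a factor 1 / m and an interaction
    weighted by a further 1 / m. *)
Lemma sum_interaction m : (0 < m)%N ->
  \sum_(l < m) \sum_(k < m | k != l) interaction m k l <= 12 * m%:R ^+ 2.
Proof.
move=> m0; have y0 := root4_gt0 m0; have m1 : 0 < m%:R :> R by rewrite ltr0n.
set y := root4 m in y0 *.
pose f (k : nat) : R := 4 / 3 * (m%:R * y / root4 k.+1 ^+ 5).
pose X (l : nat) : R := 4 / 3 * m%:R * y ^+ 3 / root4 l.+1 ^+ 3.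
pose g (l k : nat) : R := (k == 0%N)%:R * X l
    + m%:R * y / (root4 k.+1 ^+ 2 * root4 l.+1 ^+ 3).
have step : \sum_(l < m) \sum_(k < m | k != l) interaction m k l <=
    \sum_(l < m) (\sum_(k < m | (l < k)%N) f k + \sum_(k < m | (k < l)%N) g l k).
  apply: ler_sum => l _.
  rewrite (bigID (fun k : 'I_m => (l < k)%N)) /=; apply: lerD.
    rewrite (eq_bigl (fun k : 'I_m => (l < k)%N)); last first.
      by move=> k /=; rewrite -val_eqE /= neq_ltn; case: ltngtP.
    by apply: ler_sum => k lk; apply: interaction_lt; rewrite lk /=.
  rewrite (eq_bigl (fun k : 'I_m => (k < l)%N)); last first.
    by move=> k /=; rewrite -val_eqE /= neq_ltn; case: ltngtP.
  by apply: ler_sum => k kl; apply: interaction_gt; rewrite kl /=.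
apply: le_trans step _; rewrite big_split /=.
have -> : m%:R ^+ 2 = m%:R * y ^+ 4 by rewrite root4X4 expr2.
have F : \sum_(l < m) \sum_(k < m | (l < k)%N) f k <= 8 / 3 * (m%:R * y ^+ 4).
  rewrite (exchange_big_dep xpredT) //=.
  apply: (@le_trans _ _ (\sum_(k < m) 4 / 3 * (m%:R * y / root4 k.+1))).
    apply: ler_sum => k _.
    rewrite -(big_ord_widen m (fun=> f k) (ltnW (ltn_ord k))) sumr_const card_ord.
    have p0 := root4_gt0 (ltn0Sn k).
    have -> : 4 / 3 * (m%:R * y / root4 k.+1) = f k *+ k.+1.
      by rewrite /f -[RHS]mulr_natr -[k.+1%:R]root4X4; field; rewrite gt_eqF.
    rewrite mulrS lerDr /f !mulr_ge0 ?invr_ge0 ?exprn_ge0 //; exact: ltW.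
  rewrite -mulr_sumr -mulr_sumr.
  have := sum_root4_1 m; rewrite -/y; set S := \sum_(k < m) _ => HS.
  have : m%:R * y * S <= m%:R * y * (2 * y ^+ 3) by rewrite ler_pM2l // mulr_gt0.
  have -> : m%:R * y * (2 * y ^+ 3) = 2 * (m%:R * y ^+ 4) by ring.
  lra.
have G : \sum_(l < m) \sum_(k < m | (k < l)%N) g l k <= 28 / 3 * (m%:R * y ^+ 4).
  apply: (@le_trans _ _ (\sum_(l < m) (X l + 2 * (m%:R * y / root4 l.+1)))).
    apply: ler_sum => l _.
    rewrite -(big_ord_widen m (g l) (ltnW (ltn_ord l))) big_split /= -mulr_suml.
    have q0 := root4_gt0 (ltn0Sn l).
    have X0 : 0 <= X l.
      by rewrite /X !mulr_ge0 ?invr_ge0 ?exprn_ge0 //; exact: ltW.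
    apply: lerD.
      rewrite -[leRHS]mul1r ler_wpM2r //.
      case: (l : nat) => [|l']; first by rewrite big_ord0.
      by rewrite big_ord_recl /= big1 ?addr0.
    have -> : \sum_(i < l) m%:R * y / (root4 i.+1 ^+ 2 * root4 l.+1 ^+ 3) =
       m%:R * y / root4 l.+1 ^+ 3 * \sum_(i < l) (root4 i.+1 ^+ 2)^-1.
      rewrite mulr_sumr; apply: eq_bigr => i _.
      by rewrite invfM mulrA mulrAC.
    apply: (@le_trans _ _ (m%:R * y / root4 l.+1 ^+ 3 * (2 * root4 l.+1 ^+ 2))).
      rewrite ler_wpM2l ?divr_ge0 ?mulr_ge0 ?exprn_ge0 ?(ltW q0) ?(ltW y0) //.
      apply: le_trans (sum_root4_2 l) _.
      by rewrite ler_pM2l // ler_pXn2r ?nnegrE ?root4_ge0 // ler_root4.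
    by rewrite le_eqVlt; apply/orP; left; apply/eqP; field; rewrite gt_eqF.
  rewrite big_split /= -mulr_sumr -!mulr_sumr.
  have := sum_root4_1 m; rewrite -/y; set S := \sum_(k < m) _ => HS.
  have := sum_root4_3 m; rewrite -/y; set S' := \sum_(k < m) _ => HS'.
  have : m%:R * y * S <= m%:R * y * (2 * y ^+ 3) by rewrite ler_pM2l // mulr_gt0.
  have : m%:R * y ^+ 3 * S' <= m%:R * y ^+ 3 * (4 * y).
    by rewrite ler_pM2l // mulr_gt0 // exprn_gt0.
  have -> : m%:R * y * (2 * y ^+ 3) = 2 * (m%:R * y ^+ 4) by ring.
  have -> : m%:R * y ^+ 3 * (4 * y) = 4 * (m%:R * y ^+ 4) by ring.
  have -> : 4 / 3 * m%:R * y ^+ 3 * S' = 4 / 3 * (m%:R * y ^+ 3 * S') by ring.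
  lra.
lra.
Qed.

End Profile.

(** * Trigonometric estimates at the nodes *)

Section TrigBounds.
Context {R : realType}.
Implicit Types (x phi a : R).

Lemma sin_le x : 0 <= x -> sin x <= x.
Proof.
rewrite le_eqVlt => /predU1P[<-|x0]; first by rewrite sin0.
have [c _] := @MVT R sin cos 0 x x0 (fun y _ => is_derive_sin y)
  (continuous_subspaceT (@continuous_sin R)).
rewrite sin0 !subr0 => ->.
by rewrite -[leRHS]mul1r ler_wpM2r ?cos_le1 // ltW.
Qed.

Lemma normr_sin_le x : `|sin x| <= `|x|.
Proof.
wlog x0 : x / 0 <= x => [H|].
  have [|/ltW x0] := leP 0 x; first exact: H.
  by have := H (- x); rewrite sinN !normrN oppr_ge0 x0; apply.
rewrite [leRHS]ger0_norm // ler_norml sin_le // andbT.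
have [xp|xp] := leP x pi.
  by rewrite (@le_trans _ _ 0) ?oppr_le0 // sin_ge0_pi // x0.
rewrite (@le_trans _ _ (- 1)) ?sin_geN1 // lerN2.
by have := pi_ge2 R; lra.
Qed.

(** Concavity of the sine, as two mean value estimates on either side of x. *)
Lemma jordan x : 0 <= x <= pi / 2 -> 2 / pi * x <= sin x.
Proof.
move=> /andP[]; rewrite le_eqVlt => /predU1P[<-|x0].
  by rewrite sin0 mulr0.
have p0 := pi_gt0 R.
rewrite le_eqVlt => /predU1P[->|xp].
  have aux (t : R) : t != 0 -> 2 / t * (t / 2) = 1 by move=> t0; field.
  rewrite aux ?lt0r_neq0 //.
  by rewrite sin_pihalf.
have cs := continuous_subspaceT (@continuous_sin R).
have [c] := @MVT R sin cos 0 x x0 (fun y _ => is_derive_sin y) (cs _).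
rewrite in_itv /= sin0 !subr0 => /andP[c0 cx] E1.
have [d] := @MVT R sin cos x (pi / 2) xp (fun y _ => is_derive_sin y) (cs _).
rewrite in_itv /= sin_pihalf => /andP[xd dp] E2.
have cd : cos d <= cos c.
  have cI : c \in `[0, pi] by rewrite in_itv /=; apply/andP; split; lra.
  have dI : d \in `[0, pi] by rewrite in_itv /=; apply/andP; split; lra.
  by rewrite ltW // ltr_cos //; lra.
have H1 : (1 - sin x) * x <= sin x * (pi / 2 - x).
  rewrite E2 E1.
  rewrite [leLHS](_ : _ = cos d * (x * (pi / 2 - x))); last ring.
  rewrite [leRHS](_ : _ = cos c * (x * (pi / 2 - x))); last ring.
  by rewrite ler_wpM2r // mulr_ge0 //; lra.
have H2 : x <= sin x * (pi / 2) by lra.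
rewrite mulrAC ler_pdivrMr //; lra.
Qed.

Lemma sinB_sqr phi a : sin a ^+ 2 - sin phi ^+ 2 = sin (a - phi) * sin (a + phi).
Proof.
rewrite sinB sinD.
have -> : (sin a * cos phi - cos a * sin phi) * (sin a * cos phi + cos a * sin phi) =
  sin a ^+ 2 * cos phi ^+ 2 - cos a ^+ 2 * sin phi ^+ 2 by ring.
by rewrite !cos2sin2; ring.
Qed.

(** In the product sin (a - phi) sin (a + phi) both factors are bounded below
    with Jordan's inequality; the second one may vanish as the angles approach
    pi / 2, but not faster than cos phi. *)
Lemma far_node_bound phi a : 0 < phi < pi / 2 -> 0 < a < pi / 2 -> phi != a ->
  sin phi ^+ 2 * cos phi ^+ 2 / `|sin a ^+ 2 - sin phi ^+ 2| <=
  pi ^+ 2 / 2 * (phi ^+ 2 / ((a + phi) * `|a - phi|)).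
Proof.
move=> /andP[f0 fp] /andP[a0 ap] fa; have p0 := pi_gt0 R.
have d0 : 0 < `|a - phi| by rewrite normr_gt0 subr_eq0 eq_sym.
have s0 : 0 < a + phi by rewrite addr_gt0.
have cf : 0 < cos phi by rewrite cos_gt0_pihalf //; apply/andP; split; lra.
have H1 : 2 / pi * `|a - phi| <= `|sin (a - phi)|.
  have [aphi|phia] := leP phi a.
    have h : 0 <= a - phi by lra.
    rewrite (ger0_norm h) ger0_norm ?sin_ge0_pi //; last by apply/andP; split; lra.
    by apply: jordan; apply/andP; split; lra.
  have h : 0 <= phi - a by lra.
  rewrite distrC (ger0_norm h) -[a - phi]opprB sinN normrN ger0_norm ?sin_ge0_pi //.
    by apply: jordan; apply/andP; split; lra.
  by apply/andP; split; lra.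
have H2 : (a + phi) * cos phi / pi <= sin (a + phi).
  have -> : a + phi = (a + phi) / 2 + (a + phi) / 2 by field.
  rewrite sinD -splitr.
  have h1 : 2 / pi * ((a + phi) / 2) <= sin ((a + phi) / 2).
    by apply: jordan; apply/andP; split; lra.
  have h2 : cos phi / 2 <= cos ((a + phi) / 2).
    have E : cos ((a + phi) / 2) * cos ((a - phi) / 2) * 2 = cos a + cos phi.
      have -> : cos a = cos ((a + phi) / 2 + (a - phi) / 2) by congr cos; field.
      have -> : cos phi = cos ((a + phi) / 2 - (a - phi) / 2) by congr cos; field.
      by rewrite cosD cosB; ring.
    have ca : 0 <= cos a by rewrite cos_ge0_pihalf //; apply/andP; split; lra.
    have c1 : 0 <= cos ((a + phi) / 2).
      by rewrite cos_ge0_pihalf //; apply/andP; split; lra.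
    have c2 := cos_le1 ((a - phi) / 2).
    have : cos ((a + phi) / 2) * cos ((a - phi) / 2) <= cos ((a + phi) / 2).
      by rewrite ler_piMr.
    lra.
  have h3 : 0 <= 2 / pi * ((a + phi) / 2) by rewrite mulr_ge0 ?divr_ge0 //; lra.
  have h4 : 0 <= cos phi / 2 by lra.
  have := ler_pM h3 h4 h1 h2.
  have -> : 2 / pi * ((a + phi) / 2) * (cos phi / 2) = (a + phi) * cos phi / pi / 2.
    have aux (t u v : R) : t != 0 -> 2 / t * (u / 2) * (v / 2) = u * v / t / 2.
      by move=> t0; field.
    by rewrite aux ?lt0r_neq0.
  lra.
rewrite sinB_sqr normrM.
have sp : 0 <= sin (a + phi) by rewrite sin_ge0_pi //; apply/andP; split; lra.
rewrite (ger0_norm sp).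
have H3 : 2 / pi * `|a - phi| * ((a + phi) * cos phi / pi) <=
    `|sin (a - phi)| * sin (a + phi).
  by apply: ler_pM => //; rewrite !mulr_ge0 ?invr_ge0 // ltW.
have pos : 0 < 2 / pi * `|a - phi| * ((a + phi) * cos phi / pi).
  by rewrite !mulr_gt0 ?invr_gt0.
have sf : sin phi ^+ 2 <= phi ^+ 2.
  rewrite ler_pXn2r ?nnegrE ?sin_le // ?ltW //.
  by rewrite sin_gt0_pi // f0; lra.
have cf2 : cos phi ^+ 2 <= cos phi.
  by rewrite expr2 ler_piMr ?cos_le1 // ltW.
apply: (@le_trans _ _ (phi ^+ 2 * cos phi / (2 / pi * `|a - phi| * ((a + phi) * cos phi / pi)))).
  apply: ler_pM.
  - by rewrite mulr_ge0 ?sqr_ge0.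
  - by rewrite invr_ge0 mulr_ge0.
  - by rewrite ler_pM ?sqr_ge0.
  - rewrite lef_pV2 ?posrE //; exact: (lt_le_trans pos H3).
have aux (t u c d s : R) : t != 0 -> c != 0 -> d != 0 -> s != 0 ->
  u * c / (2 / t * d * (s * c / t)) = t ^+ 2 / 2 * (u / (s * d)).
  by move=> t0 c0 d0' s0'; field; rewrite ?t0 ?c0 ?d0' ?s0'.
by rewrite aux ?lt0r_neq0.
Qed.

Lemma node_halfstep m k : (0 < m)%N ->
  m%:R * (2 * node m k) = pi / 2 + pi *+ k :> R.
Proof.
move=> m0; rewrite /node -mulr_natl -[k.*2.+1%:R]natr1 -muln2 natrM; field.
by rewrite pnatr_eq0 -lt0n.
Qed.

Lemma cos2_shift k x : cos (x + (pi / 2 + pi *+ k)) ^+ 2 = sin x ^+ 2.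
Proof.
elim: k => [|k IH]; first by rewrite mulr0n addr0 cosDpihalf sqrrN.
have -> : x + (pi / 2 + pi *+ k.+1) = x + (pi / 2 + pi *+ k) + pi :> R.
  by rewrite [pi *+ k.+1]mulrSr; ring.
by rewrite cosDpi sqrrN.
Qed.

Lemma cos2_node m k a : (0 < m)%N ->
  cos (m%:R * (2 * a)) ^+ 2 = sin (2 * m%:R * (a - node m k)) ^+ 2.
Proof.
move=> m0.
have -> : m%:R * (2 * a) = 2 * m%:R * (a - node m k) + m%:R * (2 * node m k) by ring.
by rewrite node_halfstep // cos2_shift.
Qed.

(** Within half a step of a node, cos (2 m a) vanishes at the node and grows
    linearly with slope of order m, by Jordan's inequality. *)
Lemma near_node_bound m k a : (k < m)%N -> `|a - node m k| <= pi / (4 * m%:R) ->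
  (m%:R / pi) ^+ 2 * (sin a ^+ 2 - sin (node m k) ^+ 2) ^+ 2 <=
  cos (m%:R * (2 * a)) ^+ 2 * (sin (node m k) ^+ 2 * cos (node m k) ^+ 2).
Proof.
move=> km; have m0 : (0 < m)%N := leq_ltn_trans (leq0n _) km.
have m1 : 0 < m%:R :> R by rewrite ltr0n.
have p0 := pi_gt0 R.
have /andP[f0 fp] := @node_bounds R m k km.
rewrite (cos2_node k a m0) sinB_sqr.
set f := node m k in f0 fp *; set d := a - f => dh.
have -> : a + f = 2 * f + d by rewrite /d; ring.
have h1 : 2 / pi * (2 * m%:R * `|d|) <= `|sin (2 * m%:R * d)|.
  have E : `|2 * m%:R * d| = 2 * m%:R * `|d| by rewrite normrM ger0_norm // mulr_ge0 // ltW.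
  have h : 2 * m%:R * `|d| <= pi / 2.
    apply: (@le_trans _ _ (2 * m%:R * (pi / (4 * m%:R)))).
      by rewrite ler_pM2l // mulr_gt0.
    by rewrite le_eqVlt; apply/orP; left; apply/eqP; field; rewrite gt_eqF.
  have -> : `|sin (2 * m%:R * d)| = sin (2 * m%:R * `|d|).
    rewrite -E; have [d0|d0] := leP 0 (2 * m%:R * d).
      rewrite (ger0_norm d0) ger0_norm // sin_ge0_pi // d0 /=.
      by rewrite -(ger0_norm d0) E; lra.
    rewrite (ltr0_norm d0) sinN -normrN ger0_norm // -sinN sin_ge0_pi //.
    by rewrite -(ltr0_norm d0) E; apply/andP; split; [rewrite mulr_ge0 ?mulr_ge0 // ltW|lra].
  by apply: jordan; rewrite h andbT mulr_ge0 // mulr_ge0 // ltW.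
have h2 : m%:R^-1 <= sin (2 * f).
  have lo : pi / (2 * m%:R) <= 2 * f.
    rewrite /f /node.
    have -> : 2 * (k.*2.+1%:R * (pi / (4 * m%:R))) = k.*2.+1%:R * (pi / (2 * m%:R)) :> R.
      by field; rewrite gt_eqF.
    by rewrite ler_peMl ?ler1n // divr_ge0 ?mulr_ge0 // ltW.
  have hi : 2 * f <= pi - pi / (2 * m%:R).
    rewrite /f /node.
    have -> : pi - pi / (2 * m%:R) = (2 * m%:R - 1) * (pi / (2 * m%:R)) :> R.
      by field; rewrite gt_eqF.
    have -> : 2 * (k.*2.+1%:R * (pi / (4 * m%:R))) = k.*2.+1%:R * (pi / (2 * m%:R)) :> R.
      by field; rewrite gt_eqF.
    rewrite ler_pM2r ?divr_gt0 ?mulr_gt0 // lerBrDr -natrM natr1 ler_nat mul2n.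
    by rewrite -doubleS leq_double.
  have aux (t n : R) : t != 0 -> n != 0 -> n^-1 = 2 / t * (t / (2 * n)).
    by move=> t0 n0; field; rewrite t0 n0.
  have J : m%:R^-1 = 2 / pi * (pi / (2 * m%:R)) :> R by rewrite -aux ?lt0r_neq0.
  have [c|c] := leP (2 * f) (pi / 2).
    apply: (@le_trans _ _ (2 / pi * (2 * f))).
      by rewrite J ler_pM2l // divr_gt0.
    by apply: jordan; rewrite c andbT; lra.
  have -> : sin (2 * f) = sin (pi - 2 * f).
    by rewrite sinB sinpi cospi; ring.
  apply: (@le_trans _ _ (2 / pi * (pi - 2 * f))).
    by rewrite J ler_pM2l ?divr_gt0 //; lra.
  by apply: jordan; apply/andP; split; lra.
have h3 : `|sin (2 * f + d)| <= 2 * sin (2 * f).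
  have s0 : 0 <= sin (2 * f) by apply: le_trans h2; rewrite invr_ge0 ltW.
  have : `|d| <= sin (2 * f).
    apply: le_trans h2; apply: le_trans dh _.
    rewrite invfM mulrA ler_piMl ?invr_ge0 ?(ltW m1) //.
    by have := pihalf_lt2 R; lra.
  move=> ds; rewrite sinD; apply: le_trans (ler_normD _ _) _.
  have -> : 2 * sin (2 * f) = sin (2 * f) + sin (2 * f) by ring.
  rewrite !normrM (ger0_norm s0) lerD //.
    by rewrite ler_piMr // cos_max.
  apply: le_trans ds; apply: le_trans (normr_sin_le d).
  by rewrite ler_piMl // cos_max.
have h4 : sin (2 * f) = 2 * sin f * cos f by rewrite mulr_natl mulr2n sinD; ring.
have E1 : (sin d * sin (2 * f + d)) ^+ 2 <= `|d| ^+ 2 * (2 * sin (2 * f)) ^+ 2.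
  rewrite -[leLHS]real_normK ?num_real // -exprMn.
  have s0 : 0 <= sin (2 * f) by apply: le_trans h2; rewrite invr_ge0 ltW.
  rewrite ler_pXn2r ?nnegrE ?normr_ge0 ?mulr_ge0 //.
  by rewrite normrM ler_pM // normr_sin_le.
have E2 : (2 / pi * (2 * m%:R * `|d|)) ^+ 2 <= sin (2 * m%:R * d) ^+ 2.
  rewrite -[leRHS]real_normK ?num_real // ler_pXn2r ?nnegrE ?normr_ge0 //.
  by rewrite !mulr_ge0 ?invr_ge0 // ltW.
apply: (@le_trans _ _ ((m%:R / pi) ^+ 2 * (`|d| ^+ 2 * (2 * sin (2 * f)) ^+ 2))).
  by rewrite ler_wpM2l // exprn_ge0 // divr_ge0 // ltW.
apply: (@le_trans _ _ ((2 / pi * (2 * m%:R * `|d|)) ^+ 2 * (sin f ^+ 2 * cos f ^+ 2))).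
  have aux (t n u s c : R) : t != 0 -> (n / t) ^+ 2 * (u ^+ 2 * (2 * (2 * s * c)) ^+ 2) =
      (2 / t * (2 * n * u)) ^+ 2 * (s ^+ 2 * c ^+ 2) by move=> t0; field.
  by rewrite h4 aux ?lt0r_neq0.
apply: ler_wpM2r => //; by rewrite mulr_ge0 ?sqr_ge0.
Qed.

End TrigBounds.

(** * Hump polynomials and their masses *)

Section Hump.
Context {R : realType} (m : nat) (m_gt0 : (0 < m)%N).
Let m1 : 0 < m%:R :> R. Proof. by rewrite ltr0n. Qed.
Local Notation phi := (@node R m).

Definition cnode (k : nat) : R := sin (phi k) ^+ 2.
Local Notation v := cnode.
Definition chebE k : {poly R} := chebT m %/ ('X - (v k)%:P).
(** The weights c_k of the nodes, chosen so that c_k E_k(v_k)^2 = m d_k for the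
    profile d; here E_k(v_k)^2 = m^2 / (v_k (1 - v_k)). *)
Definition residue (k : nat) : R := v k * (1 - v k) * profile m k / m%:R.
Local Notation c := residue.
Local Notation T := (@chebT R m).
Local Notation d := (@profile R m).

(** W = T (9 - sum_k c_k / (x - v_k)). The constant 9 exceeds the value at 1 of
    the sum, so that W changes sign between consecutive nodes and between the
    last node and 1. *)
Definition humpW : {poly R} := 9 *: T - \sum_(k < m) c k *: chebE k.

Lemma phi_itv k : (k < m)%N -> 0 < phi k < pi / 2.
Proof. exact: node_bounds. Qed.

Lemma sin_phi_gt0 k : (k < m)%N -> 0 < sin (phi k).
Proof. by move/phi_itv; exact: sin_gt0_pihalf. Qed.

Lemma cos_phi_gt0 k : (k < m)%N -> 0 < cos (phi k).
Proof.
move=> /phi_itv/andP[a0 ap]; apply: cos_gt0_pihalf; rewrite ap andbT.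
by have := pi_gt0 R; lra.
Qed.

Lemma cnode_gt0 k : (k < m)%N -> 0 < v k.
Proof. by move=> km; rewrite exprn_gt0 // sin_phi_gt0. Qed.

Lemma cnode1B k : 1 - v k = cos (phi k) ^+ 2.
Proof. by rewrite cos2sin2. Qed.

Lemma cnode_lt1 k : (k < m)%N -> 0 < 1 - v k.
Proof. by move=> km; rewrite cnode1B exprn_gt0 // cos_phi_gt0. Qed.

Lemma residue_gt0 k : (k < m)%N -> 0 < c k.
Proof.
move=> km; apply: divr_gt0 => //; apply: mulr_gt0; last exact: profile_gt0.
by apply: mulr_gt0; [exact: cnode_gt0|exact: cnode_lt1].
Qed.

Lemma ltr_cnode i k : (i < m)%N -> (k < m)%N -> (i < k)%N -> v i < v k.
Proof.
move=> im km ik; have /andP[i0 _] := phi_itv im; have /andP[_ kp] := phi_itv km.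
by apply: ltr_sin_half; rewrite ?ltr_node // ltW.
Qed.

Lemma cnode_inj i k : (i < m)%N -> (k < m)%N -> i != k -> v i != v k.
Proof.
move=> im km; rewrite neq_ltn => /orP[ik|ki]; first by rewrite lt_eqF ?ltr_cnode.
by rewrite gt_eqF ?ltr_cnode.
Qed.

Lemma chebE_mul k : chebE k * ('X - (v k)%:P) = T.
Proof.
by rewrite divpK // dvdp_XsubCl; apply/rootP; exact: chebT_node.
Qed.

Lemma horner_chebE k x : (chebE k).[x] * (x - v k) = T.[x].
Proof. by rewrite -(chebE_mul k) hornerM hornerXsubC. Qed.

Lemma size_chebE k : size (chebE k) = m.
Proof. by rewrite size_divp ?polyXsubC_eq0 // size_XsubC size_chebT subn1. Qed.

Lemma chebE_node i k : (i < m)%N -> (k < m)%N -> i != k -> (chebE k).[v i] = 0.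
Proof.
move=> im km ik; have := horner_chebE k (v i).
rewrite [T.[_]]chebT_node // => /eqP; rewrite mulf_eq0 subr_eq0.
by rewrite (negbTE (cnode_inj im km ik)) orbF => /eqP.
Qed.

Lemma chebE_diag k : (chebE k).[v k] * (sin (phi k) * cos (phi k)) = - (-1) ^+ k * m%:R.
Proof.
have E1 : (chebE k).[v k] = T^`().[v k].
  by rewrite -(chebE_mul k) derivM derivXsubC mulr1 hornerD hornerM hornerXsubC subrr mulr0 add0r.
rewrite E1 (chebTV_deriv m).1 hornerN !hornerM.
rewrite -polyC_natr hornerC -polyC_natr hornerC.
have [_ H] := chebTV_sin m (phi k).
have S : sin (m%:R * (2 * phi k)) = (-1) ^+ k :> R.
  rewrite node_halfstep //; elim: k {E1 H} => [|k IH].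
    by rewrite mulr0n addr0 sin_pihalf.
  have -> : pi / 2 + pi *+ k.+1 = (pi / 2 + pi *+ k) + pi :> R.
    by rewrite [pi *+ k.+1]mulrSr addrA.
  by rewrite sinDpi IH exprS mulN1r.
rewrite -S -H /v; ring.
Qed.

Lemma chebE_diag_sqr k : (k < m)%N ->
  (chebE k).[v k] ^+ 2 * (v k * (1 - v k)) = m%:R ^+ 2.
Proof.
move=> km; rewrite cnode1B /v -!exprMn chebE_diag exprMn sqrrN -exprM mulnC exprM.
by rewrite sqrrN expr1n expr1n mul1r.
Qed.

Lemma residueE k : (k < m)%N -> c k * (chebE k).[v k] ^+ 2 = m%:R * d k.
Proof.
move=> km; have := chebE_diag_sqr km; set e := _ ^+ 2 => H.
have -> : c k * e = (e * (v k * (1 - v k))) * d k / m%:R by rewrite /c; ring.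
by rewrite H; field; rewrite gt_eqF.
Qed.

Lemma humpW_node k : (k < m)%N -> humpW.[v k] = - (c k * (chebE k).[v k]).
Proof.
move=> km; rewrite /humpW hornerD hornerN hornerZ [T.[_]]chebT_node // mulr0 add0r.
rewrite horner_sum (bigD1 (Ordinal km)) //= hornerZ big1 ?addr0 // => i ik.
rewrite hornerZ chebE_node ?mulr0 //.
by rewrite eq_sym; move: ik; rewrite -val_eqE.
Qed.

Lemma phi_le k : phi k <= 2 * k.+1%:R / m%:R.
Proof.
rewrite /node invfM !mulrA ler_pM2r ?invr_gt0 //.
have p4 : pi <= 4 :> R by have := pihalf_lt2 R; lra.
apply: (@le_trans _ _ k.*2.+1%:R).
  by rewrite -mulrA ler_piMr ?ler0n // ler_pdivrMr // mul1r.
by rewrite -natrM mul2n ler_nat doubleS.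
Qed.

Lemma cnode_le k : (k < m)%N -> v k <= 4 * k.+1%:R ^+ 2 / m%:R ^+ 2.
Proof.
move=> km; have s0 := sin_phi_gt0 km; have /andP[f0 _] := phi_itv km.
apply: (@le_trans _ _ ((2 * k.+1%:R / m%:R) ^+ 2)).
  rewrite ler_pXn2r ?nnegrE ?(ltW s0) ?divr_ge0 ?mulr_ge0 ?ler0n //.
  by rewrite (le_trans (sin_le (ltW f0))) ?phi_le.
by rewrite le_eqVlt; apply/orP; left; apply/eqP; field; rewrite gt_eqF.
Qed.

Lemma sum_residue_end : \sum_(k < m) c k / (1 - v k) <= 8.
Proof.
apply: (@le_trans _ _ (\sum_(k < m) 4 / m%:R ^+ 3 * (k.+1%:R ^+ 2 * d k))).
  apply: ler_sum => k _; have := cnode_lt1 (ltn_ord k) => w0.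
  have -> : c k / (1 - v k) = v k * (d k / m%:R) by rewrite /c; field; rewrite !gt_eqF.
  have -> : 4 / m%:R ^+ 3 * (k.+1%:R ^+ 2 * d k) =
     (4 * k.+1%:R ^+ 2 / m%:R ^+ 2) * (d k / m%:R) by field; rewrite gt_eqF.
  by rewrite ler_pM2r ?cnode_le // divr_gt0 // profile_gt0.
rewrite -mulr_sumr mulrAC ler_pdivrMr ?exprn_gt0 //.
by have := @profile_moment1 R m m_gt0; lra.
Qed.

Lemma sum_residue_profile : \sum_(k < m) c k * d k <= 12.
Proof.
apply: (@le_trans _ _ (\sum_(k < m) 4 / m%:R ^+ 3 * (k.+1%:R ^+ 2 * d k ^+ 2))).
  apply: ler_sum => k _; have := cnode_lt1 (ltn_ord k) => w0.
  have v0 := cnode_gt0 (ltn_ord k).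
  have -> : c k * d k = v k * (1 - v k) * (d k ^+ 2 / m%:R) by rewrite /c; ring.
  have -> : 4 / m%:R ^+ 3 * (k.+1%:R ^+ 2 * d k ^+ 2) =
     (4 * k.+1%:R ^+ 2 / m%:R ^+ 2) * (d k ^+ 2 / m%:R) by field; rewrite gt_eqF.
  rewrite ler_pM2r ?divr_gt0 ?exprn_gt0 ?profile_gt0 //.
  apply: le_trans (cnode_le (ltn_ord k)).
  by rewrite ler_piMr ?(ltW v0) // gerBl ltW.
rewrite -mulr_sumr mulrAC ler_pdivrMr ?exprn_gt0 //.
by have := @profile_moment2 R m m_gt0; lra.
Qed.

Lemma horner_humpW x : (forall k, (k < m)%N -> x != v k) ->
  humpW.[x] = T.[x] * (9 - \sum_(k < m) c k / (x - v k)).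
Proof.
move=> H; rewrite /humpW hornerD hornerN hornerZ horner_sum mulrBr mulrC mulr_sumr.
congr (_ - _); apply: eq_bigr => k _; rewrite hornerZ -(horner_chebE k).
by field; rewrite subr_eq0 H.
Qed.

Lemma chebT_1 : T.[1] = (-1) ^+ m.
Proof.
have := chebT_sin m (pi / 2 : R); rewrite sin_pihalf expr1n => ->.
have -> : m%:R * (2 * (pi / 2)) = pi *+ m :> R.
  by rewrite -[pi *+ m]mulr_natl [2 * _]mulrC divfK ?pnatr_eq0.
elim: (m) => [|k IH]; first by rewrite mulr0n cos0.
by rewrite mulrS addrC cosDpi IH exprS mulN1r.
Qed.

Lemma chebT_0 : T.[0] = 1.
Proof. by have := chebT_sin m (0 : R); rewrite sin0 expr0n !mulr0 cos0. Qed.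

Lemma humpW_1 : 0 < (-1) ^+ m * humpW.[1].
Proof.
rewrite horner_humpW; last first.
  by move=> k km; rewrite gt_eqF // -subr_gt0 cnode_lt1.
rewrite chebT_1 mulrA -exprD addnn -mul2n exprM sqrrN !expr1n mul1r subr_gt0.
by apply: le_lt_trans sum_residue_end _; rewrite ltr_nat.
Qed.

Lemma humpW_node_sign k : (k < m)%N -> 0 < (-1) ^+ k * humpW.[v k].
Proof.
move=> km; rewrite humpW_node //.
have sc : 0 < sin (phi k) * cos (phi k) by rewrite mulr_gt0 ?sin_phi_gt0 ?cos_phi_gt0.
rewrite -(pmulr_lgt0 _ sc).
have -> : (-1) ^+ k * - (c k * (chebE k).[v k]) * (sin (phi k) * cos (phi k)) =
   (-1) ^+ k * - (c k * ((chebE k).[v k] * (sin (phi k) * cos (phi k)))) by ring.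
rewrite chebE_diag.
have -> : (-1) ^+ k * - (c k * (- (-1) ^+ k * m%:R)) = ((-1) ^+ k) ^+ 2 * (c k * m%:R) by ring.
by rewrite -exprM mulnC exprM sqrrN !expr1n mul1r mulr_gt0 // residue_gt0.
Qed.

(** The zeros of W are sought in the cells between consecutive node angles; the
    last cell ends at pi / 2, the angle of the end point 1. *)
Definition cell_end (k : nat) : R := if (k.+1 < m)%N then phi k.+1 else pi / 2.

Lemma cell_lt k : (k < m)%N -> phi k < cell_end k.
Proof.
move=> km; rewrite /cell_end; case: ifP => _; first by rewrite ltr_node.
by have /andP[] := phi_itv km.
Qed.

Lemma cell_end_le k : (k < m)%N -> cell_end k <= pi / 2.
Proof.
by move=> km; rewrite /cell_end; case: ifP => // /phi_itv/andP[_ /ltW].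
Qed.

Lemma humpW_root k : (k < m)%N ->
  exists a : R, phi k < a < cell_end k /\ humpW.[sin a ^+ 2] = 0.
Proof.
move=> km; have kl := cell_lt km.
pose f (a : R) := (-1) ^+ k * humpW.[sin a ^+ 2].
have f1 : 0 < f (phi k) by exact: humpW_node_sign.
have f2 : f (cell_end k) < 0.
  rewrite /f /cell_end; case: ltnP => k1m.
    by have := humpW_node_sign k1m; rewrite exprS mulN1r mulNr oppr_gt0.
  have -> : k = m.-1 by apply/eqP; rewrite eqn_leq -ltnS prednK // km /= -ltnS prednK.
  have := humpW_1; rewrite sin_pihalf expr1n -{1}(prednK m_gt0) exprS mulN1r mulNr.
  by rewrite oppr_gt0.
have cf : {within `[phi k, cell_end k], continuous f}.
  apply: continuous_subspaceT => a; rewrite /f.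
  apply: (@continuousM _ _ (fun=> (-1) ^+ k) (fun a => humpW.[sin a ^+ 2])).
    exact: cst_continuous.
  apply: (@continuous_comp _ _ _ (fun a => sin a ^+ 2) (horner humpW)); last exact: continuous_horner.
  apply: (@continuous_comp _ _ _ sin (fun x => x ^+ 2)); first exact: continuous_sin.
  exact: exprn_continuous.
have : Num.min (f (phi k)) (f (cell_end k)) <= 0 <= Num.max (f (phi k)) (f (cell_end k)).
  by rewrite ge_min le_max (ltW f1) (ltW f2) orbT.
move=> /(IVT (ltW kl) cf)[a].
rewrite in_itv /= => /andP[ka al] fa; exists a; split.
  rewrite !lt_neqAle ka al !andbT; apply/andP; split.
    by apply: contraTneq f1 => ->; rewrite fa ltxx.
  by apply: contraTneq f2 => <-; rewrite fa ltxx.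
by move/eqP: fa; rewrite mulf_eq0 signr_eq0 => /eqP.
Qed.

Lemma hump_angles : exists a : nat -> R, forall k, (k < m)%N ->
  phi k < a k < cell_end k /\ humpW.[sin (a k) ^+ 2] = 0.
Proof.
have H k : exists a : R, (k < m)%N -> phi k < a < cell_end k /\ humpW.[sin a ^+ 2] = 0.
  have [km|_] := boolP (k < m)%N; last by exists 0.
  by have [a Ha] := humpW_root km; exists a.
by have [a Ha] := choice H; exists a.
Qed.

Section HumpNodes.
Variables (a : nat -> R) (A kappa : R).
Hypothesis a_cell : forall k, (k < m)%N -> phi k < a k < cell_end k.
Hypothesis a_root : forall k, (k < m)%N -> humpW.[sin (a k) ^+ 2] = 0.
Hypotheses (A_gt0 : 0 < A) (kappa_gt0 : 0 < kappa).

Definition hnode k := sin (a k) ^+ 2.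
Local Notation s := hnode.

Lemma a_gt0 j : (j < m)%N -> 0 < a j.
Proof.
move=> jm; have /andP[h _] := a_cell jm; have /andP[h' _] := phi_itv jm.
exact: lt_trans h' h.
Qed.

Lemma a_lt j : (j < m)%N -> a j < pi / 2.
Proof.
by move=> jm; have /andP[_ h] := a_cell jm; exact: lt_le_trans h (cell_end_le jm).
Qed.

Lemma phi_lt_a k j : (j < m)%N -> (k <= j)%N -> phi k < a j.
Proof.
move=> jm kj; have /andP[h _] := a_cell jm; apply: le_lt_trans h.
by move: kj; rewrite leq_eqVlt => /predU1P[->//|kj]; rewrite ltW // ltr_node.
Qed.

Lemma a_lt_phi k j : (k < m)%N -> (j < k)%N -> a j < phi k.
Proof.
move=> km jk; have jm := ltn_trans jk km; have /andP[_ h] := a_cell jm.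
apply: lt_le_trans h _; rewrite /cell_end (leq_ltn_trans jk km).
by move: jk; rewrite leq_eqVlt => /predU1P[->//|kj]; rewrite ltW // ltr_node.
Qed.

Lemma cnode_lt_s k j : (j < m)%N -> (k <= j)%N -> v k < s j.
Proof.
move=> jm kj; have /andP[f0 _] := phi_itv (leq_ltn_trans kj jm).
by apply: ltr_sin_half; [exact: ltW|exact: ltW (a_lt jm)|exact: phi_lt_a].
Qed.

Lemma s_lt_cnode k j : (k < m)%N -> (j < k)%N -> s j < v k.
Proof.
move=> km jk; have /andP[_ fp] := phi_itv km.
apply: ltr_sin_half; [|exact: ltW|exact: a_lt_phi].
exact: ltW (a_gt0 (ltn_trans jk km)).
Qed.

Lemma s_neq_cnode k j : (j < m)%N -> (k < m)%N -> s j != v k.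
Proof.
move=> jm km; have [kj|jk] := leqP k j; first by rewrite gt_eqF ?cnode_lt_s.
by rewrite lt_eqF ?s_lt_cnode.
Qed.

Lemma s_inj i j : (i < m)%N -> (j < m)%N -> i != j -> s i != s j.
Proof.
move=> im jm; rewrite neq_ltn => /orP[ij|ji].
  by rewrite lt_eqF // (lt_trans (s_lt_cnode jm ij)) // cnode_lt_s.
by rewrite gt_eqF // (lt_trans (s_lt_cnode im ji)) // cnode_lt_s.
Qed.

(** Consecutive node angles are two half steps apart, and the last one is half a
    step away from pi / 2. *)
Lemma near_index j : (j < m)%N -> exists l, [/\ (l < m)%N, (j <= l <= j.+1)%N &
  `|a j - phi l| <= pi / (4 * m%:R)].
Proof.
move=> jm; set h := pi / (4 * m%:R).
have h0 : 0 < h by rewrite divr_gt0 ?pi_gt0 // mulr_gt0.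
have fj := phi_lt_a jm (leqnn j).
have fS : phi j.+1 = phi j + 2 * h.
  by rewrite /node -/h doubleS -!natr1; ring.
have [lo|hi] := leP (a j) (phi j + h).
  exists j; split=> //; first by rewrite leqnn leqnSn.
  by rewrite ger0_norm ?subr_ge0 ?(ltW fj) // lerBlDl.
have [j1m|mj1] := ltnP j.+1 m.
  exists j.+1; split=> //; first by rewrite leqnn leqnSn.
  have := a_lt_phi j1m (ltnSn j); rewrite fS => aj.
  by rewrite ltr0_norm ?subr_lt0 //; lra.
exfalso; have := a_lt jm.
have jE : j.+1 = m by apply/eqP; rewrite eqn_leq jm.
have : phi j + h = pi / 2.
  have aux (t : R) : j.*2.+1%:R * (t / (4 * m%:R)) + t / (4 * m%:R) = t / 2.
    have -> : j.*2.+1%:R = 2 * m%:R - 1 :> R.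
      by rewrite -[X in _ * X%:R]jE -[j.*2.+1%:R]natr1 -[j.+1%:R]natr1 -mul2n natrM; ring.
    by field; rewrite gt_eqF.
  exact: aux.
lra.
Qed.

(** With W_j = W / (X - s_j), one has W_j(s_j) = T(s_j) hgap j, while the values
    of P W_j at the nodes sum to - m hforce j; this determines the mass at s_j. *)
Definition hgap j := \sum_(k < m) c k / (s j - v k) ^+ 2.
Definition hforce j := \sum_(k < m) c k * d k / (s j - v k).

(** Only the term of the nearest node is kept: T is small there, but the
    square of the distance to that node is equally small. *)
Lemma near_cell j l : (j < m)%N -> (l < m)%N -> `|a j - phi l| <= pi / (4 * m%:R) ->
  m%:R / pi ^+ 2 * d l <= T.[s j] ^+ 2 * hgap j.
Proof.
move=> jm lm al; have v0 := cnode_gt0 lm; have w0 := cnode_lt1 lm.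
have D0 : 0 < (s j - v l) ^+ 2 by rewrite exprn_even_gt0 //= subr_eq0 s_neq_cnode.
have := near_node_bound lm al; rewrite -cnode1B -/(v l) -(chebT_sin m) -/(s j) => H.
apply: (@le_trans _ _ (T.[s j] ^+ 2 * (c l / (s j - v l) ^+ 2))); last first.
  rewrite ler_wpM2l ?sqr_ge0 // /hgap (bigD1 (Ordinal lm)) //= lerDl.
  by apply: sumr_ge0 => k _; rewrite divr_ge0 ?sqr_ge0 // ltW // residue_gt0.
rewrite [leRHS]mulrA ler_pdivlMr // /c.
have -> : T.[s j] ^+ 2 * (v l * (1 - v l) * d l / m%:R) =
  (T.[s j] ^+ 2 * (v l * (1 - v l))) * (d l / m%:R) by ring.
apply: le_trans (ler_wpM2r _ H); last by rewrite ltW // divr_gt0 // profile_gt0.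
have aux (t : R) : t != 0 -> m%:R / t ^+ 2 * d l * (s j - v l) ^+ 2 <=
    (m%:R / t) ^+ 2 * (s j - v l) ^+ 2 * (d l / m%:R).
  move=> t0; rewrite le_eqVlt; apply/orP; left; apply/eqP.
  by field; rewrite t0 gt_eqF.
by apply: aux; rewrite gt_eqF // pi_gt0.
Qed.

Lemma chebT_s_neq0 j : (j < m)%N -> T.[s j] != 0.
Proof.
move=> jm; have [l [lm _ al]] := near_index jm.
have := near_cell jm lm al; apply: contraTneq => ->.
rewrite expr0n mul0r -ltNge mulr_gt0 ?profile_gt0 // divr_gt0 // exprn_gt0 //.
exact: pi_gt0.
Qed.

Lemma sum_residue_s j : (j < m)%N -> \sum_(k < m) c k / (s j - v k) = 9.
Proof.
move=> jm; have := a_root jm; rewrite -/(s j) horner_humpW; last first.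
  by move=> k km; exact: s_neq_cnode.
by move/eqP; rewrite mulf_eq0 (negbTE (chebT_s_neq0 jm)) /= subr_eq0 => /eqP.
Qed.

Lemma hgap_gt0 j : (j < m)%N -> 0 < hgap j.
Proof.
move=> jm; rewrite /hgap (bigD1 (Ordinal m_gt0)) //= ltr_pwDl //.
  by rewrite divr_gt0 ?residue_gt0 // exprn_even_gt0 //= subr_eq0 s_neq_cnode.
by apply: sumr_ge0 => k _; rewrite divr_ge0 ?sqr_ge0 // ltW // residue_gt0.
Qed.

(** As W(s_j) = 0, the weights c_k / (s_j - v_k) sum to 9, so any constant d_l
    can be subtracted from the profile. For a monotone profile and l next to j,
    d_k - d_l and s_j - v_k have the same sign; hence all masses are
    nonnegative. *)
Lemma hforceE j l : (j < m)%N -> (l < m)%N -> (j <= l <= j.+1)%N ->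
  hforce j = 9 * d l + \sum_(k < m) c k * `|d k - d l| / `|s j - v k|.
Proof.
move=> jm lm /andP[jl lj]; rewrite -(sum_residue_s jm) mulr_suml -big_split /=.
apply: eq_bigr => k _; have km := ltn_ord k.
have [kj|jk] := leqP k j.
  have sv := cnode_lt_s jm kj.
  rewrite (gtr0_norm (_ : 0 < s j - v k)) ?subr_gt0 // ger0_norm; last first.
    by rewrite subr_ge0 profile_noninc // (leq_trans kj).
  have : s j - v k != 0 by rewrite subr_eq0 gt_eqF.
  by move: (c k) (d k) (d l) (s j - v k) => x y z w w0; field.
have sv := s_lt_cnode km jk.
rewrite (ltr0_norm (_ : s j - v k < 0)) ?subr_lt0 // ler0_norm; last first.
  by rewrite subr_le0 profile_noninc // (leq_trans lj).
have : s j - v k != 0 by rewrite subr_eq0 lt_eqF.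
by move: (c k) (d k) (d l) (s j - v k) => x y z w w0; field; rewrite ?oppr_eq0.
Qed.

Lemma far_residue j l k : (j < m)%N -> (l < m)%N -> (k < m)%N ->
  `|a j - phi l| <= pi / (4 * m%:R) -> k != l ->
  c k / `|s j - v k| <= 2 * pi ^+ 2 / m%:R * d k *
     (k.+1%:R ^+ 2 / `|k.+1%:R ^+ 2 - l.+1%:R ^+ 2|).
Proof.
move=> jm lm km al kl; have p0 := pi_gt0 R.
set h := pi / (4 * m%:R) in al.
have h0 : 0 < h by rewrite divr_gt0 // mulr_gt0.
have fa : phi k != a j.
  by have [kj|jk] := leqP k j; [rewrite lt_eqF ?phi_lt_a|rewrite gt_eqF ?a_lt_phi].
have H : 0 < a j < pi / 2 by rewrite a_gt0 // a_lt.
have := far_node_bound (phi_itv km) H fa.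
rewrite -cnode1B -/(v k) -/(s j).
have E1 : phi k = k.*2.+1%:R * h by [].
have E2 : phi l = l.*2.+1%:R * h by [].
have kl1 : 1 <= `|k%:R - l%:R| :> R.
  have [lk|lk] := leqP l k.
    by rewrite -natrB // normr_nat ler1n subn_gt0 ltn_neqAle eq_sym kl.
  by rewrite distrC -natrB ?normr_nat ?ler1n ?subn_gt0 // ltnW.
have H1 : `|k%:R - l%:R| * h <= `|a j - phi k|.
  have -> : a j - phi k = (a j - phi l) - 2 * (k%:R - l%:R) * h.
    by rewrite E1 E2 -!natr1 -!mul2n !natrM; ring.
  have E3 : `|2 * (k%:R - l%:R) * h| = 2 * `|k%:R - l%:R| * h.
    by rewrite (normrM _ h) (normrM 2) (gtr0_norm h0) normr_nat.
  have := ler_normB (a j - phi l) (a j - phi l - 2 * (k%:R - l%:R) * h).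
  rewrite subKr E3; move: kl1 al; move: `|_| => t; nra.
have H2 : (k.+1%:R + l.+1%:R) * h <= a j + phi k.
  have : phi l - h <= a j by move: al; rewrite ler_norml => /andP[]; lra.
  have : 1 <= k%:R + l%:R :> R.
    by rewrite -natrD ler1n; case: k l kl {km lm al fa E1 E2 kl1 H1} => [|?] [|?].
  by rewrite E1 E2 -!natr1 -!mul2n !natrM; nra.
have K0 : 0 < k.+1%:R + l.+1%:R :> R by rewrite addr_gt0 ?ltr0n.
have kl0 : 0 < `|k%:R - l%:R| :> R by exact: lt_le_trans kl1.
have H3 : phi k ^+ 2 / ((a j + phi k) * `|a j - phi k|) <=
    4 * (k.+1%:R ^+ 2 / `|k.+1%:R ^+ 2 - l.+1%:R ^+ 2|).
  have -> : `|k.+1%:R ^+ 2 - l.+1%:R ^+ 2| = `|k%:R - l%:R| * (k.+1%:R + l.+1%:R) :> R.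
    rewrite subr_sqr normrM (gtr0_norm K0).
    have -> : k.+1%:R - l.+1%:R = k%:R - l%:R :> R by rewrite -[k.+1%:R]natr1 -[l.+1%:R]natr1; ring.
    by [].
  apply: (@le_trans _ _ ((2 * k.+1%:R * h) ^+ 2 / (((k.+1%:R + l.+1%:R) * h) * (`|k%:R - l%:R| * h)))).
    have q1 : 0 < (k.+1%:R + l.+1%:R) * h by rewrite mulr_gt0.
    have q2 : 0 < `|k%:R - l%:R| * h by rewrite mulr_gt0.
    have f0 : 0 <= phi k by rewrite E1 mulr_ge0 ?ler0n // ltW.
    have g2 : phi k <= 2 * k.+1%:R * h.
      by rewrite E1 ler_pM2r // -natrM ler_nat mul2n doubleS.
    have g3 : phi k ^+ 2 <= (2 * k.+1%:R * h) ^+ 2.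
      by rewrite ler_pXn2r ?nnegrE // (le_trans f0).
    have q3 : (k.+1%:R + l.+1%:R) * h * (`|k%:R - l%:R| * h) <= (a j + phi k) * `|a j - phi k|.
      by rewrite ler_pM // ltW.
    have q4 := mulr_gt0 q1 q2.
    have q5 := lt_le_trans q4 q3.
    apply: ler_pM => //; first by rewrite sqr_ge0.
      by rewrite invr_ge0 ltW.
    by rewrite lef_pV2 ?posrE.
  have aux (x y z w : R) : w != 0 -> y != 0 -> z != 0 ->
    (2 * x * w) ^+ 2 / (y * w * (z * w)) = 4 * (x ^+ 2 / (z * y)).
    by move=> w0 y0 z0; field; rewrite ?w0 ?y0 ?z0.
  by rewrite aux ?lt0r_neq0.
move=> H4; have H5 := le_trans H4 (ler_wpM2l _ H3).
have -> : c k / `|s j - v k| = v k * (1 - v k) / `|s j - v k| * (d k / m%:R).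
  by rewrite /c; ring.
apply: (@le_trans _ _ (pi ^+ 2 / 2 * (4 * (k.+1%:R ^+ 2 / `|k.+1%:R ^+ 2 - l.+1%:R ^+ 2|)) * (d k / m%:R))).
  rewrite ler_wpM2r ?H5 //; first by rewrite ltW // divr_gt0 // profile_gt0.
  by rewrite divr_ge0 // sqr_ge0.
have aux (t q x y : R) : t / 2 * (4 * q) * (x / y) = 2 * t / y * x * q.
  by rewrite [2 * t / y]mulrAC; move: y^-1 => z; field.
by rewrite aux.
Qed.

(** The mass that makes P orthogonal to W / (X - s_j), by quadrature. *)
Definition hmass j := A * hforce j / (kappa * T.[s j] ^+ 2 * hgap j).

Definition total_interaction (l : nat) : R :=
  \sum_(k < m | (k != l :> nat)) interaction m k l.

Lemma total_interaction_ge0 l : 0 <= total_interaction l.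
Proof. by apply: sumr_ge0 => k _; exact: interaction_ge0. Qed.

Lemma hforce_ge0 j : (j < m)%N -> 0 <= hforce j.
Proof.
move=> jm; rewrite (hforceE jm jm) ?leqnn ?leqnSn // addr_ge0 //.
  by rewrite mulr_ge0 // ltW // profile_gt0.
apply: sumr_ge0 => k _; rewrite divr_ge0 // mulr_ge0 //.
by rewrite ltW // residue_gt0.
Qed.

Lemma hforce_le j l : (j < m)%N -> (l < m)%N -> (j <= l <= j.+1)%N ->
  `|a j - phi l| <= pi / (4 * m%:R) ->
  hforce j <= d l * (9 + 2 * pi ^+ 2 / m%:R * total_interaction l).
Proof.
move=> jm lm jl al; rewrite (hforceE jm lm jl) mulrDr mulrC lerD2l.
rewrite (bigID (fun k : 'I_m => k != l :> nat)) /= [X in _ + X]big1 ?addr0; last first.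
  by move=> k; rewrite negbK => /eqP ->; rewrite subrr normr0 mulr0 mul0r.
rewrite /total_interaction !mulr_sumr; apply: ler_sum => k kl.
have := far_residue jm lm (ltn_ord k) al kl; move=> H.
have := ler_wpM2r (normr_ge0 (d k - d l)) H.
have dl : d l != 0 by rewrite gt_eqF // profile_gt0.
set K := `|_ ^+ 2 - _|.
have aux (x y z : R) : x * y / z = x / z * y by rewrite mulrAC.
rewrite (aux (c k)); move/le_trans; apply.
rewrite /interaction -/K; set N := `|d k - d l|.
move: (2 * _ / _) (d k) (d l) (k.+1%:R ^+ 2) dl => t x y u y0.
rewrite invfM le_eqVlt; apply/orP; left; apply/eqP.
by move: K^-1 => z; field.
Qed.

Lemma hmass_ge0 j : (j < m)%N -> 0 <= hmass j.
Proof.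
move=> jm; apply: divr_ge0; first by rewrite mulr_ge0 ?hforce_ge0 // ltW.
have g0 := ltW (hgap_gt0 jm); have k0 := ltW kappa_gt0.
by rewrite mulr_ge0 // mulr_ge0 ?sqr_ge0.
Qed.

Lemma hmass_le j : (j < m)%N -> hmass j <= A / kappa * (pi ^+ 2 / m%:R) *
  (9 + 2 * pi ^+ 2 / m%:R * (total_interaction j +
      if (j.+1 < m)%N then total_interaction j.+1 else 0)).
Proof.
move=> jm; have [l [lm jl al]] := near_index jm.
have dl := profile_gt0 (R := R) l m_gt0.
have p2 : 0 < pi ^+ 2 :> R by rewrite exprn_gt0 // pi_gt0.
have Q0 : 0 <= 2 * pi ^+ 2 / m%:R :> R.
  by apply: divr_ge0; [rewrite mulr_ge0 // ltW|exact: ltW].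
have F := hforce_le jm lm jl al; have G := near_cell jm lm al.
have I0 : total_interaction l <= total_interaction j +
      (if (j.+1 < m)%N then total_interaction j.+1 else 0).
  move: jl; rewrite andbC leq_eqVlt => /andP[/orP[/eqP lj|lj] jl].
    by rewrite -lj lm lerDr total_interaction_ge0.
  have -> : l = j by apply/eqP; rewrite eqn_leq -ltnS lj.
  by rewrite lerDl; case: ifP => // _; exact: total_interaction_ge0.
have G0 : 0 < m%:R / pi ^+ 2 * d l by rewrite mulr_gt0 // divr_gt0.
apply: (@le_trans _ _ (A / kappa * (pi ^+ 2 / m%:R) * (9 + 2 * pi ^+ 2 / m%:R * total_interaction l))); last first.
  rewrite ler_wpM2l //.
    by rewrite mulr_ge0 // divr_ge0 // ltW.
  by rewrite lerD2l ler_wpM2l.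
rewrite /hmass ler_pdivrMr; last first.
  rewrite mulr_gt0 ?hgap_gt0 // mulr_gt0 // exprn_even_gt0 //=.
  exact: chebT_s_neq0.
set J := 9 + _ in F *; have J0 : 0 <= J.
  by rewrite addr_ge0 // mulr_ge0 ?total_interaction_ge0.
have -> : A / kappa * (pi ^+ 2 / m%:R) * J * (kappa * T.[s j] ^+ 2 * hgap j) =
   A * (pi ^+ 2 / m%:R * J * (T.[s j] ^+ 2 * hgap j)).
  move: (pi ^+ 2 / m%:R) (T.[s j]) (hgap j) => x y z.
  by field; rewrite gt_eqF.
rewrite ler_pM2l //; apply: le_trans F _.
have -> : d l * J = pi ^+ 2 / m%:R * J * (m%:R / pi ^+ 2 * d l).
  move: (pi ^+ 2) p2 (d l) => x x0 y; field.
  by rewrite !gt_eqF.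
by rewrite ler_wpM2l // mulr_ge0 // divr_ge0 // ltW.
Qed.

Lemma sum_shift_le n (f : nat -> R) : (forall i, 0 <= f i) ->
  \sum_(j < n) (if (j.+1 < n)%N then f j.+1 else 0) <= \sum_(j < n) f j.
Proof.
move=> f0; case: n => [|n]; first by rewrite !big_ord0.
rewrite big_ord_recr /= ltnn addr0 [leRHS]big_ord_recl ler_wpDl //.
by apply: ler_sum => j _; rewrite ltnS ltn_ord lift0.
Qed.

(** The bound is uniform in m and tends to 0 as kappa grows. *)
Lemma sum_hmass : \sum_(j < m) hmass j <=
  A / kappa * (pi ^+ 2 * (9 + 48 * pi ^+ 2)).
Proof.
apply: le_trans (ler_sum _ (fun j _ => hmass_le (ltn_ord j))) _.
rewrite -mulr_sumr big_split /= sumr_const card_ord -mulr_sumr big_split /=.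
have S1 : \sum_(j < m) total_interaction j <= 12 * m%:R ^+ 2.
  exact: sum_interaction.
have S2 : \sum_(j < m) (if (j.+1 < m)%N then total_interaction j.+1 else 0) <= 12 * m%:R ^+ 2.
  exact: le_trans (sum_shift_le _ total_interaction_ge0) S1.
set S := \sum_(j < m) _ + \sum_(j < m) _; have S0 : S <= 24 * m%:R ^+ 2.
  by rewrite /S; lra.
have p2 : 0 <= pi ^+ 2 :> R by rewrite exprn_ge0 // pi_ge0.
have Ak : 0 <= A / kappa by rewrite divr_ge0 // ltW.
rewrite -[leLHS]mulrA ler_wpM2l //.
rewrite -[leLHS]mulrA ler_wpM2l // mulrC ler_pdivrMr // [leRHS]mulrDl.
have -> : (9 : R) *+ m = 9 * m%:R by rewrite mulr_natr.
rewrite lerD2l.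
have H : 2 * pi ^+ 2 / m%:R * S <= 2 * pi ^+ 2 / m%:R * (24 * m%:R ^+ 2).
  by rewrite ler_wpM2l // divr_ge0 ?(ltW m1) // mulr_ge0.
apply: le_trans H _; rewrite le_eqVlt; apply/orP; left; apply/eqP.
by move: (pi ^+ 2) => x; field; rewrite gt_eqF.
Qed.

(** W / (X - s_j), by partial fractions. *)
Definition humpW_div j : {poly R} := \sum_(k < m) (c k / (s j - v k)) *: chebE k.

Lemma humpW_divE j : (j < m)%N -> humpW = ('X - (s j)%:P) * humpW_div j.
Proof.
move=> jm; rewrite /humpW -(sum_residue_s jm) scaler_suml -sumrB mulr_sumr.
apply: eq_bigr => k _; rewrite -scalerAr.
have -> : 'X - (s j)%:P = ('X - (v k)%:P) - (s j - v k)%:P.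
  by rewrite polyCB opprB addrA subrK.
rewrite mulrBl [('X - _) * _]mulrC chebE_mul mul_polyC scalerBr scalerA.
by rewrite divfK // subr_eq0 s_neq_cnode.
Qed.

Lemma size_humpW_div j : (size (humpW_div j) <= m)%N.
Proof.
apply: leq_trans (size_sum _ _ _) _; apply/bigmax_leqP => k _.
by rewrite (leq_trans (size_scale_leq _ _)) // size_chebE.
Qed.

Lemma humpW_div_off i j : (i < m)%N -> (j < m)%N -> i != j -> (humpW_div j).[s i] = 0.
Proof.
move=> im jm ij; have := a_root im; rewrite -/(s i) (humpW_divE jm) hornerM hornerXsubC.
by move/eqP; rewrite mulf_eq0 subr_eq0 (negbTE (s_inj im jm ij)) => /eqP.
Qed.

Lemma humpW_div_diag j : (j < m)%N -> (humpW_div j).[s j] = T.[s j] * hgap j.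
Proof.
move=> jm; rewrite /humpW_div horner_sum /hgap mulr_sumr; apply: eq_bigr => k _.
have h : s j - v k != 0 by rewrite subr_eq0 s_neq_cnode.
rewrite hornerZ -(horner_chebE k); move: h (c k) (chebE k).[s j].
by move: (s j - v k) => x x0 y z; field.
Qed.

Lemma humpW_div_node j k : (k < m)%N ->
  (humpW_div j).[v k] = c k / (s j - v k) * (chebE k).[v k].
Proof.
move=> km; rewrite /humpW_div horner_sum (bigD1 (Ordinal km)) //= hornerZ big1 ?addr0 // => i ik.
rewrite hornerZ chebE_node ?mulr0 //.
by rewrite eq_sym; move: ik; rewrite -val_eqE.
Qed.

(** P takes the values kappa T(s_j) at the zeros of W, and does not feel kappa at
    the nodes: the masses at the s_j are divided by kappa, while the quadrature
    sums stay the same. *)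
Definition humpP : {poly R} := humpW + kappa *: T.

Lemma humpP_s j : (j < m)%N -> humpP.[s j] = kappa * T.[s j].
Proof. by move=> jm; rewrite hornerD hornerZ -[s j]/(sin (a j) ^+ 2) a_root // add0r. Qed.

Lemma humpP_node k : (k < m)%N -> humpP.[v k] = - (c k * (chebE k).[v k]).
Proof. by move=> km; rewrite hornerD hornerZ humpW_node // [T.[_]]chebT_node // mulr0 addr0. Qed.

Lemma humpP_E : humpP = (9 + kappa) *: T - \sum_(k < m) c k *: chebE k.
Proof. by rewrite /humpP /humpW addrAC -scalerDl. Qed.

Lemma size_sum_chebE : (size (\sum_(k < m) c k *: chebE k)%R <= m)%N.
Proof.
apply: leq_trans (size_sum _ _ _) _; apply/bigmax_leqP => k _.
by rewrite (leq_trans (size_scale_leq _ _)) // size_chebE.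
Qed.

Lemma size_humpP : size humpP = m.+1.
Proof.
have k0 : 9 + kappa != 0 by rewrite gt_eqF // addr_gt0.
rewrite humpP_E size_polyDl size_scale ?size_chebT // size_polyN ltnS.
exact: size_sum_chebE.
Qed.

Section HumpMoments.
Variable b : nat -> R.
Hypotheses (b_arcsine : arcsine_moments b) (b0 : b 0%N = A).
Local Notation L f := (mom b (f \Po 'X^2)).

Lemma hump_quadrature (f : {poly R}) : (size f <= m.*2)%N ->
  L f = A / m%:R * \sum_(k < m) f.[v k].
Proof. by move=> sf; rewrite (arcsine_quadrature b_arcsine m_gt0 sf) b0. Qed.

Lemma hump_orthogonal_div j : (j < m)%N ->
  L (humpP * humpW_div j) + hmass j * (humpP * humpW_div j).[s j] = 0.
Proof.
move=> jm; rewrite hump_quadrature; last first.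
  apply: leq_trans (size_polyMleq _ _) _; rewrite size_humpP addSn /= -addnn leq_add2l.
  exact: size_humpW_div.
have E : \sum_(k < m) (humpP * humpW_div j).[v k] = - (m%:R * hforce j).
  rewrite /hforce [m%:R * _]mulr_sumr -sumrN; apply: eq_bigr => k _.
  rewrite hornerM humpP_node // humpW_div_node //.
  have := residueE (ltn_ord k); move: (c k) (chebE k).[v k] (d k) (s j - v k)^-1 => x y z w H.
  have -> : - (x * y) * (x * w * y) = - ((x * y ^+ 2) * x * w) by ring.
  by rewrite H; ring.
rewrite E hornerM humpP_s // humpW_div_diag // /hmass.
have := chebT_s_neq0 jm; have := hgap_gt0 jm.
move: (hforce j) (hgap j) T.[s j] => x y z y0 z0.
by field; rewrite z0 !gt_eqF.
Qed.

Lemma lagrange_humpW (r : {poly R}) : (size r <= m)%N ->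
  r = \sum_(j < m) (r.[s j] / (humpW_div j).[s j]) *: humpW_div j.
Proof.
move=> sr; set r' := \sum_(j < m) _; apply/eqP; rewrite -subr_eq0; apply: contraT => n0.
pose rs := [seq s j | j <- iota 0 m].
have : (size rs < size (r - r')%R)%N.
  apply: (max_poly_roots n0).
    apply/allP => _ /mapP[i + ->]; rewrite mem_iota add0n /= => im.
    rewrite /root hornerD hornerN horner_sum (bigD1 (Ordinal im)) //= big1 ?addr0.
      rewrite hornerZ divfK ?subrr // humpW_div_diag // mulf_neq0 ?chebT_s_neq0 //.
      by rewrite gt_eqF ?hgap_gt0.
    move=> j ji; have ij : i != j :> nat by rewrite eq_sym; move: ji; rewrite -val_eqE.
    by rewrite hornerZ (humpW_div_off im (ltn_ord j) ij) mulr0.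
  rewrite map_inj_in_uniq ?iota_uniq // => i j; rewrite !mem_iota !add0n /= => im jm E.
  by apply/eqP; apply: contraT => /(s_inj im jm); rewrite E eqxx.
rewrite size_map size_iota ltnNge; case/negP.
apply: leq_trans (size_polyD _ _) _; rewrite geq_max sr size_polyN.
apply: leq_trans (size_sum _ _ _) _; apply/bigmax_leqP => k _.
by rewrite (leq_trans (size_scale_leq _ _)) // size_humpW_div.
Qed.

(** The quotients W / (X - s_j) form, up to scaling, the Lagrange basis at the
    zeros of W. *)
Lemma hump_orthogonal (r : {poly R}) : (size r <= m)%N ->
  L (humpP * r) + \sum_(j < m) hmass j * (humpP * r).[s j] = 0.
Proof.
move=> sr; rewrite {1}(lagrange_humpW sr) mulr_sumr.
have -> : L (\sum_(j < m) humpP * ((r.[s j] / (humpW_div j).[s j]) *: humpW_div j)) =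
  \sum_(j < m) (r.[s j] / (humpW_div j).[s j]) * L (humpP * humpW_div j).
  rewrite raddf_sum /= raddf_sum /=; apply: eq_bigr => j _.
  by rewrite -scalerAr comp_polyZ momZ.
rewrite -big_split big1 // => j _ /=.
have w0 : (humpW_div j).[s j] != 0.
  by rewrite humpW_div_diag // mulf_neq0 ?chebT_s_neq0 // gt_eqF ?hgap_gt0.
have := hump_orthogonal_div (ltn_ord j); rewrite !hornerM.
move: (L _) (hmass j) humpP.[_] w0 r.[_] => x y z; move: (humpW_div j).[_] => w w0 t H.
have -> : t / w * x + y * (z * t) = t / w * (x + y * (z * w)) by field.
by rewrite H mulr0.
Qed.

Lemma chebT_s_sqr_le1 j : T.[s j] ^+ 2 <= 1.
Proof. by rewrite chebT_sin cos2sin2 gerBl sqr_ge0. Qed.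

(** T and the interpolating part of P are orthogonal because T vanishes at the
    nodes, and the norm of the latter is the quadrature sum of c_k d_k. *)
Lemma hump_norm : L (humpP ^+ 2) + \sum_(j < m) hmass j * (humpP ^+ 2).[s j] <=
  A * ((9 + kappa) ^+ 2 + 12) + kappa ^+ 2 * \sum_(j < m) hmass j.
Proof.
apply: lerD; last first.
  rewrite mulr_sumr; apply: ler_sum => j _.
  rewrite horner_exp humpP_s // exprMn mulrC ler_wpM2r ?hmass_ge0 //.
  by rewrite ler_piMr ?sqr_ge0 ?chebT_s_sqr_le1.
set A1 := \sum_(k < m) c k *: chebE k.
have A1v k : (k < m)%N -> A1.[v k] = c k * (chebE k).[v k].
  move=> km; rewrite /A1 horner_sum (bigD1 (Ordinal km)) //= hornerZ big1 ?addr0 // => i ik.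
  rewrite hornerZ chebE_node ?mulr0 //.
  by rewrite eq_sym; move: ik; rewrite -val_eqE.
have sA1 : (size A1 <= m)%N := size_sum_chebE.
have E1 : L (T * A1) = 0.
  rewrite hump_quadrature; last first.
    apply: leq_trans (size_polyMleq _ _) _.
    by rewrite size_chebT addSn /= -addnn leq_add2l.
  rewrite big1 ?mulr0 // => k _.
  by rewrite hornerM [T.[_]]chebT_node // mul0r.
have E2 : L (A1 ^+ 2) <= A * 12.
  rewrite hump_quadrature; last first.
    apply: leq_trans (size_polyMleq _ _) _; rewrite -addnn.
    by apply: leq_trans (leq_pred _) _; rewrite leq_add.
  rewrite -mulrA ler_wpM2l ?(ltW A_gt0) // mulrC ler_pdivrMr //.
  have -> : \sum_(k < m) (A1 ^+ 2).[v k] = (\sum_(k < m) c k * d k) * m%:R.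
    rewrite mulr_suml; apply: eq_bigr => k _; rewrite horner_exp A1v //.
    have := residueE (ltn_ord k); move: (c k) (chebE k).[_] (d k) => x y z H.
    have -> : (x * y) ^+ 2 = (x * y ^+ 2) * x by ring.
    by rewrite H; ring.
  by rewrite ler_wpM2r ?(ltW m1) ?sum_residue_profile.
have E3 : L (T ^+ 2) <= A.
  rewrite (@arcsine_quadrature _ _ m.+1) //; last first.
    apply: leq_trans (size_polyMleq _ _) _.
    by rewrite size_chebT /= addnS addnn doubleS leqnSn.
  rewrite b0 -mulrA ler_piMr ?(ltW A_gt0) // mulrC ler_pdivrMr ?ltr0n // mul1r.
  have -> : m.+1%:R = \sum_(k < m.+1) (1 : R) by rewrite sumr_const card_ord.
  apply: ler_sum => k _; rewrite horner_exp chebT_sin cos2sin2 gerBl; exact: sqr_ge0.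
rewrite humpP_E -/A1.
have -> : ((9 + kappa) *: T - A1) ^+ 2 = ((9 + kappa) ^+ 2) *: T ^+ 2 -
    (2 * (9 + kappa)) *: (T * A1) + A1 ^+ 2.
  by rewrite -!mul_polyC !rmorphM /= ?rmorphXn /= polyC_natr; ring.
rewrite comp_polyD comp_polyB !comp_polyZ linearD linearB /= !momZ E1 mulr0 subr0.
by rewrite mulrDr lerD // mulrC ler_wpM2r // sqr_ge0.
Qed.

End HumpMoments.

(** At the origin all terms - c_k / (x - v_k) are positive, and the one of the
    first node alone is of order sqrt m because d_0 = m^(3/2). *)
Lemma humpP_0 : m%:R / 4 <= humpP.[0] ^+ 2.
Proof.
have v0 k : (k < m)%N -> 0 != v k by move=> km; rewrite lt_eqF // cnode_gt0.
have p0 := pi_gt0 R.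
have H1 : root4 m ^+ 2 / 2 <= humpP.[0].
  rewrite hornerD hornerZ horner_humpW // chebT_0 mul1r mulr1.
  have -> : 9 - \sum_(k < m) c k / (0 - v k) = 9 + \sum_(k < m) c k / v k.
    by rewrite -sumrN; congr (_ + _); apply: eq_bigr => k _; rewrite sub0r invrN mulrN opprK.
  have H : root4 m ^+ 2 / 2 <= \sum_(k < m) c k / v k.
    rewrite (bigD1 (Ordinal m_gt0)) //= ler_wpDr //.
      apply: sumr_ge0 => k _; rewrite divr_ge0 // ltW ?cnode_gt0 //; exact: residue_gt0.
    have -> : c 0 / v 0 = (1 - v 0) * root4 m ^+ 2.
      rewrite /c profile0; have := cnode_gt0 m_gt0; move: (v 0) => x x0.
      by field; rewrite !gt_eqF.
    rewrite mulrC ler_wpM2r ?sqr_ge0 //.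
    have : 0 <= cos (phi 0 + phi 0).
      have -> : phi 0 + phi 0 = pi / 2 / m%:R :> R.
        rewrite /node mul1r invfM; move: (pi : R) => t.
        by field; rewrite gt_eqF.
      apply: cos_ge0_pihalf; apply/andP; split.
        by rewrite (@le_trans _ _ 0) ?oppr_le0 ?divr_ge0 // ?ltW.
      by rewrite ler_pdivrMr // ler_peMr ?ler1n // divr_ge0 // ltW.
    rewrite cosD -!expr2 cos2sin2 -/(v 0); lra.
  by apply: le_trans H _; rewrite addrAC lerDr addr_ge0 // ltW.
have -> : m%:R / 4 = (root4 m ^+ 2 / 2) ^+ 2 :> R.
  by rewrite -[m%:R]root4X4; field.
rewrite ler_pXn2r ?nnegrE ?divr_ge0 ?sqr_ge0 //.
by apply: le_trans H1; rewrite divr_ge0 ?sqr_ge0.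
Qed.

End HumpNodes.

End Hump.

(** * Point masses that make an orthogonal polynomial large at the origin *)

Section HumpTheorem.
Context {R : realType}.

Lemma mom_even_comp (a : nat -> R) (p : {poly R}) : moments_even a ->
  mom a ((p \Po 'X^2) * 'X) = 0.
Proof.
move=> ea; have := mom_reflect ((p \Po 'X^2) * 'X) ea.
rewrite comp_polyM comp_polyX -comp_polyA comp_Xn_poly sqrrN mulrN linearN /=.
by move/eqP; rewrite eq_sym -addr_eq0 -mulr2n mulrn_eq0 /= => /eqP.
Qed.

Lemma arcsine_moments_even (b : nat -> R) : arcsine_moments b -> moments_even b.
Proof.
move=> hb.
have step k : k%:R * b k.-1 = k.+1%:R * b k.+1.
  have := hb 'X^k.
  have -> : (1 - 'X^2) * deriv 'X^k - 'X * 'X^k =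
      k%:R *: 'X^(k.-1) - k%:R *: 'X^(k.+1) - 'X^(k.+1) :> {poly R}.
    rewrite derivXn -exprS -scaler_nat -scalerAr; congr (_ - _).
    case: k => [|k]; first by rewrite !scale0r subrr.
    by rewrite -scalerBr mulrBl mul1r -exprD add2n.
  rewrite !linearB /= !momZ !momXn -natr1 => H; apply/eqP; rewrite -subr_eq0 -H.
  by apply/eqP; ring.
have b1 : b 1%N = 0 by have := step 0%N; rewrite mul0r mul1r.
suff : forall n, b n.*2.+1 = 0.
  by move=> H k ok; rewrite -(odd_double_half k) ok.
elim=> [//|n IH]; have := step n.*2.+2; rewrite /= IH mulr0 => /esym/eqP.
by rewrite mulf_eq0 pnatr_eq0 /= => /eqP.
Qed.

Definition pair_moments m (x M : nat -> R) (k : nat) : R :=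
  \sum_(j < m) M j * ((x j ^+ k + (- x j) ^+ k) / 2).

Lemma mom_pair m x M (p : {poly R}) :
  mom (pair_moments m x M) p = \sum_(j < m) M j * ((p.[x j] + p.[- x j]) / 2).
Proof.
rewrite /mom; under eq_bigr do rewrite mulr_sumr; rewrite exchange_big /=.
apply: eq_bigr => j _; rewrite !horner_coef -big_split mulr_suml mulr_sumr.
apply: eq_bigr => i _ /=.
by move: (x j ^+ i) ((- x j) ^+ i) p`_i (M j) => u w t z; ring.
Qed.

Lemma pair_moments_even m x M : moments_even (pair_moments m x M).
Proof.
move=> k ok; rewrite /pair_moments big1 // => j _.
by rewrite exprNn -signr_odd ok expr1 mulN1r subrr mul0r mulr0.
Qed.

Lemma pair_moments_psd m x M : (forall j, (j < m)%N -> 0 <= M j) ->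
  psd (pair_moments m x M).
Proof.
move=> M0 p; rewrite mom_pair; apply: sumr_ge0 => j _.
by rewrite mulr_ge0 ?M0 // divr_ge0 // addr_ge0 // horner_exp sqr_ge0.
Qed.

Lemma momDeven (a : nat -> R) (p r : {poly R}) : moments_even a ->
  mom a ((p \Po 'X^2) * r) = mom a ((p * even_poly r) \Po 'X^2).
Proof.
move=> ea; rewrite -{1}(poly_even_odd r) mulrDr linearD /= -comp_polyM.
by rewrite mulrA -comp_polyM mom_even_comp // addr0.
Qed.

Lemma horner_pair_even (f : {poly R}) x :
  ((f \Po 'X^2).[x] + (f \Po 'X^2).[- x]) / 2 = f.[x ^+ 2].
Proof.
rewrite !horner_comp !hornerXn sqrrN; move: f.[_] => t.
by field.
Qed.

(** The variable x^2 turns the point masses at s_j into symmetric pairs at the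
    square roots of s_j, and P into an even polynomial of degree 2 m. Taking
    kappa large makes the total mass small; the constant c deteriorates, but it
    does not depend on m. *)
Lemma hump_exists (b : nat -> R) : arcsine_moments b -> 0 < b 0%N ->
  forall eps, 0 < eps -> exists2 c : R, 0 < c & forall m, (0 < m)%N ->
  exists x M : nat -> R, [/\ forall j, (j < m)%N -> 0 < x j < 1 /\ 0 <= M j,
    \sum_(j < m) M j <= eps &
    large_at0 (fun k => b k + pair_moments m x M k) m.*2 (c * m%:R)].
Proof.
move=> hb b0 eps eps0; have eb := arcsine_moments_even hb.
set C0 : R := pi ^+ 2 * (9 + 48 * pi ^+ 2).
have C00 : 0 < C0.
  by rewrite mulr_gt0 ?exprn_gt0 ?pi_gt0 // addr_gt0 // mulr_gt0 // exprn_gt0 // pi_gt0.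
(* The total mass, at most b 0 / kappa * C0, becomes at most eps. *)
set kappa := b 0%N * C0 / eps.
have k0 : 0 < kappa by rewrite divr_gt0 // mulr_gt0.
set N := b 0%N * ((9 + kappa) ^+ 2 + 12) + kappa ^+ 2 * eps.
have N0 : 0 < N.
  apply: ltr_pwDl; last by rewrite mulr_ge0 ?sqr_ge0 // ltW.
  by rewrite mulr_gt0 // ltr_wpDl // sqr_ge0.
exists (8 * N)^-1; first by rewrite invr_gt0 mulr_gt0.
move=> m m0; have m1 : 0 < m%:R :> R by rewrite ltr0n.
have [a Ha] := @hump_angles R m m0.
have cell k km := (Ha k km).1; have rt k km := (Ha k km).2.
exists (fun j => sin (a j)), (hmass m a (b 0%N) kappa).
have MS : \sum_(j < m) hmass m a (b 0%N) kappa j <= eps.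
  apply: le_trans (sum_hmass m0 cell rt b0 k0) _.
  have aux (x y e : R) : x != 0 -> y != 0 -> e != 0 -> y / (y * x / e) * x = e.
    by move=> x0 y0 e0; field; rewrite ?x0 ?y0 ?e0.
  by rewrite -/C0 /kappa aux ?lt0r_neq0.
split=> //.
  move=> j jm; split; last exact: hmass_ge0.
  have a0 := a_gt0 cell jm; have a1 := a_lt cell jm.
  rewrite sin_gt0_pihalf ?a0 //=.
  have <- : sin (pi / 2) = 1 :> R := sin_pihalf R.
  have p0 := pi_gt0 R.
  by rewrite ltr_sin // in_itv /=; apply/andP; split; lra.
exists (humpP m kappa \Po 'X^2); split; last split.
- have P0 : humpP m kappa != 0 by rewrite -size_poly_eq0 size_humpP.
  have := size_comp_poly (humpP m kappa) 'X^2; rewrite size_humpP // size_polyXn /= muln2 => <-.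
  by rewrite prednK // lt0n size_poly_eq0 comp_poly_eq0 ?size_polyXn.
- move=> r sr; rewrite momD !momDeven //; last exact: pair_moments_even.
  have se : (size (even_poly r) <= m)%N.
    apply: leq_trans (size_even_poly _) _.
    by rewrite -(uphalf_double m) uphalf_leq.
  rewrite -[RHS](hump_orthogonal m0 cell rt k0 hb erefl se); congr (_ + _).
  rewrite mom_pair; apply: eq_bigr => j _.
  by rewrite horner_pair_even.
have := hump_norm m0 cell rt b0 k0 hb erefl; set P := humpP m kappa => HN.
have E : mom (pair_moments m (fun j => sin (a j)) (hmass m a (b 0%N) kappa)) ((P \Po 'X^2) ^+ 2) =
   \sum_(j < m) hmass m a (b 0%N) kappa j * (P ^+ 2).[hnode a j].
  rewrite -rmorphXn /= mom_pair; apply: eq_bigr => j _.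
  by rewrite horner_pair_even.
rewrite momD E -rmorphXn /= horner_comp hornerXn expr0n /=.
apply: lt_le_trans (humpP_0 m0 k0).
have H : mom b ((P ^+ 2) \Po 'X^2) + \sum_(j < m) hmass m a (b 0%N) kappa j * (P ^+ 2).[hnode a j] <= N.
  by apply: le_trans HN _; rewrite lerD2l ler_wpM2l ?sqr_ge0.
apply: (@le_lt_trans _ _ ((8 * N)^-1 * m%:R * N)).
  by rewrite ler_wpM2l // mulr_ge0 ?invr_ge0 ?mulr_ge0 ?(ltW N0) // ltW.
have -> : (8 * N)^-1 * m%:R * N = m%:R / 8 by field; rewrite gt_eqF.
by lra.
Qed.

End HumpTheorem.

(** * Moments of measures and measures with a density *)

Section Moments.
Context {R : realType}.
Local Notation mT := (measurableTypeR R).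
Local Notation I := (`[-1, 1]%classic : set R).
Implicit Types (mu nu : {measure set mT -> \bar R}) (p : {poly R}).

Definition moments mu (k : nat) : R := fine (\int[mu]_(x in I) (x ^+ k)%:E)%E.

Lemma measurable_I : measurable (I : set mT).
Proof. exact: measurable_itv. Qed.
Hint Resolve measurable_I : core.

Lemma measurable_horner p : measurable_fun (setT : set mT) (horner p : mT -> R).
Proof. by apply: continuous_measurable_fun; exact: continuous_horner. Qed.

Lemma horner_bounded p : exists M : R, forall x, I x -> `|p.[x]| <= M.
Proof.
exists (norm1 p) => x; rewrite /= in_itv /= => x1.
rewrite horner_coef; apply: le_trans (ler_norm_sum _ _ _) _.
apply: ler_sum => i _; rewrite normrM normrX ler_piMr // exprn_ile1 //.
by rewrite ler_norml.
Qed.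

Lemma integrable_horner mu p : (mu I < +oo)%E -> mu.-integrable I (EFin \o horner p).
Proof.
move=> muI; apply: measurable_bounded_integrable => //.
  by apply: measurable_funTS; exact: measurable_horner.
have [M HM] := horner_bounded p.
exists M; split; first exact: num_real.
by move=> z Mz x Ix /=; apply: le_trans (HM _ Ix) (ltW Mz).
Qed.

Lemma fin_num_horner mu p : (mu I < +oo)%E -> (\int[mu]_(x in I) (p.[x])%:E \is a fin_num)%E.
Proof. by move=> muI; apply: integrable_fin_num => //; exact: integrable_horner. Qed.

Lemma momentsE mu p : (mu I < +oo)%E ->
  (\int[mu]_(x in I) (p.[x])%:E = (mom (moments mu) p)%:E)%E.
Proof.
move=> muI; rewrite -[LHS]fineK ?fin_num_horner //; congr EFin.
have int q : mu.-integrable I (EFin \o horner q) by exact: integrable_horner.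
have add q r : fine (\int[mu]_(x in I) ((q + r).[x])%:E)%E =
   fine (\int[mu]_(x in I) (q.[x])%:E)%E + fine (\int[mu]_(x in I) (r.[x])%:E)%E.
  rewrite -[RHS]RintegralD //.
  by congr fine; apply: eq_integral => x _; rewrite hornerD.
have scl c q : fine (\int[mu]_(x in I) ((c *: q).[x])%:E)%E =
   c * fine (\int[mu]_(x in I) (q.[x])%:E)%E.
  rewrite -[RHS]RintegralZl //.
  by congr fine; apply: eq_integral => x _; rewrite hornerZ.
rewrite -{1}[p]coefK poly_def /mom.
have z : fine (\int[mu]_(x in I) ((0 : {poly R}).[x])%:E)%E = 0.
  by have := scl 0 0; rewrite scale0r mul0r.
elim: (size p) => [|n IH]; first by rewrite !big_ord0.
rewrite !big_ord_recr /= add IH scl; congr (_ + _ * fine _).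
by apply: eq_integral => x _; rewrite hornerXn.
Qed.

Lemma moments_psd mu : (mu I < +oo)%E -> psd (moments mu).
Proof.
move=> muI p; rewrite -lee_fin -momentsE //.
by apply: integral_ge0 => x _; rewrite lee_fin horner_exp sqr_ge0.
Qed.

Lemma moments_support mu : (mu I < +oo)%E -> support_in_unit (moments mu).
Proof.
move=> muI p; rewrite -lee_fin -!momentsE //.
apply: ge0_le_integral => //.
- by move=> x _; rewrite lee_fin horner_exp sqr_ge0.
- by apply/measurable_EFinP; apply: measurable_funTS; exact: measurable_horner.
- by apply/measurable_EFinP; apply: measurable_funTS; exact: measurable_horner.
move=> x; rewrite /= in_itv /= => x1.
rewrite lee_fin !horner_exp hornerM hornerX exprMn ler_piMl ?sqr_ge0 //.
by rewrite -real_normK ?num_real // exprn_ile1 // ler_norml.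
Qed.

Lemma moments_le mu k : (mu I < +oo)%E -> (`|moments mu k|%:E <= mu I)%E.
Proof.
move=> muI; have int : mu.-integrable I (EFin \o (fun x => x ^+ k)).
  have := @integrable_horner mu 'X^k muI; apply: eq_integrable => // x _ /=.
  by rewrite hornerXn.
rewrite /moments EFin_normr_Rintegral //.
apply: le_trans (le_abse_integral _ _ _) _ => //.
  exact: (measurable_int _ int).
rewrite -[leRHS](mul1e (mu I)) -integral_cst //.
apply: ge0_le_integral => //.
- by apply: measurableT_comp => //; exact: (measurable_int _ int).
move=> x; rewrite /= in_itv /= => x1.
by rewrite lee_fin normrX exprn_ile1 // ler_norml.
Qed.

Lemma momentsD mu nu k : (mu I < +oo)%E -> (nu I < +oo)%E ->
  moments (measure_add mu nu) k = moments mu k + moments nu k.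
Proof.
move=> muI nuI; have H (m : {measure set mT -> \bar R}) : (m I < +oo)%E -> m.-integrable I (EFin \o (fun x => x ^+ k)).
  move=> mI; have := @integrable_horner m 'X^k mI; apply: eq_integrable => // x _ /=.
  by rewrite hornerXn.
rewrite /moments (integral_measure_add measurable_I (H mu muI) (H nu nuI)).
by rewrite fineD //; apply: integrable_fin_num => //; exact: H.
Qed.

Lemma eq_moments mu nu : (forall A, measurable A -> mu A = nu A) -> moments mu =1 moments nu.
Proof.
move=> H k; rewrite /moments; congr fine; apply: eq_measure_integral => A mA _; exact: H.
Qed.

Local Notation leb := (@lebesgue_measure R).

(** The proofs that the density is nonnegative and integrable are arguments, so
    that the structure of finite measure is attached to the name itself. *)
Definition weighted (f : R -> R) (f0 : forall x, 0 <= f x)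
  (intf : leb.-integrable setT (EFin \o f)) (A : set mT) : \bar R :=
  (\int[leb]_(x in A) (f x)%:E)%E.

Section Weighted.
Variables (f : R -> R) (f0 : forall x, 0 <= f x).
Variable intf : leb.-integrable setT (EFin \o f).
Local Notation wt := (weighted f0 intf).

Let weighted0 : wt set0 = 0%E.
Proof. by rewrite /weighted integral_set0. Qed.

Let weighted_ge0 A : (0 <= wt A)%E.
Proof. by apply: integral_ge0 => x _; rewrite lee_fin. Qed.

Let weighted_sigma_additive : semi_sigma_additive wt.
Proof.
move=> /= F mF tF mUF; rewrite /weighted; apply: cvg_toP.
  apply: ereal_nondecreasing_is_cvgn => m n mn.
  apply: lee_sum_nneg_natr => // k _ _.
  by apply: integral_ge0 => /= x Fkx; rewrite lee_fin.
rewrite ge0_integral_bigcup //=.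
- by exact: (measurable_funTS (measurable_int _ intf)).
- by move=> x _; rewrite lee_fin.
Qed.

HB.instance Definition _ := isMeasure.Build _ _ _ wt
  weighted0 weighted_ge0 weighted_sigma_additive.

Let weighted_fin : fin_num_fun wt.
Proof.
move=> A mA; rewrite /weighted; apply: integrable_fin_num => //.
exact: integrableS intf.
Qed.

HB.instance Definition _ := Measure_isFinite.Build _ _ _ wt weighted_fin.

Lemma weighted_dominates : wt `<< leb.
Proof.
apply/null_content_dominatesP => A mA A0; rewrite /weighted.
by apply: null_set_integral => //; exact: (measurable_funTS (measurable_int _ intf)).
Qed.

(** Both functions have the same integral over every measurable set. *)
Lemma ae_eq_weighted E : measurable E ->
  ae_eq leb E ('d (charge_of_finite_measure wt) '/d leb) (EFin \o f).
Proof.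
move=> mE; apply: integral_ae_eq => //.
- by apply: (integrableS measurableT) => //; apply: Radon_Nikodym_integrable; exact: weighted_dominates.
- by exact: (measurable_funTS (measurable_int _ intf)).
- move=> A AE mA.
  by have := @Radon_Nikodym_integral _ _ _ (charge_of_finite_measure wt) leb A weighted_dominates mA => <-.
Qed.

Lemma integral_weighted E (g : R -> \bar R) : measurable E -> wt.-integrable E g ->
  (\int[wt]_(x in E) g x = \int[leb]_(x in E) (g x * (f x)%:E))%E.
Proof.
move=> mE ig; rewrite -(Radon_Nikodym_change_of_variables weighted_dominates) //.
apply: ae_eq_integral => //.
- apply: emeasurable_funM; first exact: (measurable_int _ ig).
  apply: measurable_funTS; apply: (measurable_int leb); apply: Radon_Nikodym_integrable; exact: weighted_dominates.
- apply: emeasurable_funM; first exact: (measurable_int _ ig).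
  by exact: (measurable_funTS (measurable_int _ intf)).
- have := ae_eq_weighted mE; apply: filterS => x H Ex; by rewrite H.
Qed.

Lemma weighted_fin_I : (wt I < +oo)%E.
Proof. by have := weighted_fin measurable_I; rewrite ge0_fin_numE. Qed.

Lemma moments_weighted p :
  ((mom (moments wt) p)%:E = \int[leb]_(x in I) (p.[x] * f x)%:E)%E.
Proof.
rewrite -momentsE ?weighted_fin_I // integral_weighted //.
by apply: integrable_horner; exact: weighted_fin_I.
Qed.

End Weighted.

Lemma weighted_le (f g : R -> R) f0 g0 intf intg (H : R) (p q : {poly R}) : 
  (forall x, -1 <= x <= 1 -> p.[x] ^+ 2 * f x <= H * (q.[x] ^+ 2 * g x)) ->
  mom (moments (@weighted f f0 intf)) (p ^+ 2) <=
  H * mom (moments (@weighted g g0 intg)) (q ^+ 2).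
Proof.
move=> le; rewrite -lee_fin -momZ.
rewrite !moments_weighted; apply: ge0_le_integral => //.
- by move=> x _; rewrite lee_fin mulr_ge0 // horner_exp sqr_ge0.
- apply/measurable_EFinP; apply: measurable_funM.
    by apply: measurable_funTS; exact: measurable_horner.
  by apply/measurable_EFinP; exact: (measurable_funTS (measurable_int _ intf)).
- apply/measurable_EFinP; apply: measurable_funM.
    by apply: measurable_funTS; exact: measurable_horner.
  by apply/measurable_EFinP; exact: (measurable_funTS (measurable_int _ intg)).
- move=> x; rewrite /= in_itv /= => x1; rewrite lee_fin hornerZ !horner_exp -mulrA.
  exact: le.
Qed.

End Moments.

(** * The arcsine measure *)

Section ArcsineMeasure.
Context {R : realType}.
Local Notation leb := (@lebesgue_measure R).
Local Notation mT := (measurableTypeR R).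
Local Notation J := (`]-1, 1[%classic : set R).
Implicit Types (f F : R -> R) (a b x : R).

Lemma FTC_is_derive f F a b : a < b ->
  {within `[a, b], continuous f} ->
  (forall x, a <= x <= b -> is_derive x 1 F (f x)) ->
  (\int[leb]_(x in `[a, b]) (f x)%:E = (F b)%:E - (F a)%:E)%E.
Proof.
move=> ab cf dF; apply: continuous_FTC2 => //.
  have dc x : a <= x <= b -> {for x, continuous F}.
    move=> /dF [dx _]; apply/differentiable_continuous.
    exact/derivable1_diffP.
  split.
  - by move=> x; rewrite in_itv /= => /andP[ax xb]; have [] := dF x; rewrite ?(ltW ax) ?(ltW xb).
  - by apply: cvg_at_right_filter; apply: dc; rewrite lexx ltW.
  - by apply: cvg_at_left_filter; apply: dc; rewrite lexx ltW.
move=> x; rewrite in_itv /= => /andP[ax xb]; have := dF x.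
by rewrite (ltW ax) (ltW xb) => /(_ isT) [_ <-]; rewrite derive1E.
Qed.

(** The arcsine density is unbounded, so the fundamental theorem of calculus is
    applied on closed intervals that exhaust ]-1, 1[. *)
Definition shrink (n : nat) : R := 1 - n.+2%:R^-1.

Lemma shrink_itv n : 0 < shrink n < 1.
Proof.
rewrite /shrink subr_gt0 invf_lt1 ?ltr0n // ltr1n /= gtrBl invr_gt0.
by rewrite ltr0n.
Qed.

Lemma shrink_nondecr : {homo shrink : m n / (m <= n)%N >-> m <= n}.
Proof.
by move=> m n mn; rewrite lerD2l lerN2 lef_pV2 ?posrE ?ltr0n // ler_nat !ltnS.
Qed.

Lemma shrink_cvg : shrink n @[n --> \oo] --> (1 : R).
Proof.
rewrite -[X in _ --> X]subr0; apply: cvgB; first exact: cvg_cst.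
have := @cvg_harmonic R; rewrite -(cvg_shiftS) /=; exact.
Qed.

Definition shrunk n : set R := `[- shrink n, shrink n].

Lemma bigcup_shrunk : \bigcup_n shrunk n = `]-1, 1[%classic :> set R.
Proof.
apply/seteqP; split => x /=.
  move=> [n _]; rewrite /shrunk /= !in_itv /= => /andP[nx xn].
  by have /andP[n0 n1] := shrink_itv n; apply/andP; split; lra.
rewrite in_itv /= => /andP[x0 x1].
have xn : `|x| < 1 by rewrite ltr_norml x0 x1.
have : \forall n \near \oo, `|x| <= shrink n.
  by apply: (cvgr_ge (1 : R) shrink_cvg).
move=> [n _ /(_ n (leqnn n))]; rewrite /= ler_norml => H.
by exists n => //; rewrite /shrunk /= in_itv.
Qed.

Lemma cvg_shrunk_integral f : measurable_fun (`]-1, 1[ : set R) f ->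
  (forall x, -1 < x < 1 -> 0 <= f x) ->
  (\int[leb]_(x in shrunk n) (f x)%:E @[n --> \oo] -->
   \int[leb]_(x in J) (f x)%:E)%E.
Proof.
move=> mf f0.
have sub n x : shrunk n x -> -1 < x < 1.
  rewrite /shrunk /= in_itv /= => /andP[nx xn].
  by have /andP[n0 n1] := shrink_itv n; apply/andP; split; lra.
rewrite -bigcup_shrunk; apply: ge0_nondecreasing_set_cvg_integral.
- move=> m n mn; apply/subsetPset => x; rewrite /shrunk /= !in_itv /=.
  by have := shrink_nondecr mn => H /andP[h1 h2]; apply/andP; split; lra.
- by move=> i; exact: measurable_itv.
- move=> i; apply/measurable_EFinP; apply: measurable_funS mf => //.
  by move=> x /sub; rewrite /= in_itv.
- by move=> i x /sub /f0; rewrite lee_fin.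
Qed.

Variable delta : R.
Hypothesis delta_gt0 : 0 < delta.

(** Zero outside ]-1, 1[, because the square root of a nonpositive number and the
    inverse of 0 are 0. *)
Definition arcsine (x : R) : R := delta / Num.sqrt (1 - x ^+ 2).

Lemma arcsine_ge0 x : 0 <= arcsine x.
Proof. by rewrite divr_ge0 ?sqrtr_ge0 // ltW. Qed.

Lemma arcsine_ge x : -1 < x < 1 -> delta <= arcsine x.
Proof.
move=> /andP[x0 x1]; rewrite ler_pdivlMr ?sqrtr_gt0; last first.
  by rewrite subr_gt0 expr2; nra.
by rewrite ler_piMr ?(ltW delta_gt0) // -[leRHS]sqrtr1 ler_wsqrtr // gerBl sqr_ge0.
Qed.

Lemma arcsine_out x : ~~ (-1 < x < 1) -> arcsine x = 0.
Proof.
move=> H; rewrite /arcsine ler0_sqrtr ?invr0 ?mulr0 // subr_le0 -real_normK ?num_real //.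
by rewrite exprn_ege1 // leNgt ltr_norml.
Qed.

Lemma arcsine_continuous x : -1 < x < 1 -> {for x, continuous arcsine}.
Proof.
move=> /andP[x0 x1]; apply: continuousM; first exact: cst_continuous.
apply: continuousV.
  by rewrite gt_eqF // sqrtr_gt0 subr_gt0 expr2; nra.
apply: (@continuous_comp _ _ _ (fun x => 1 - x ^+ 2) Num.sqrt); last exact: sqrt_continuous.
apply: continuousB; first exact: cst_continuous.
exact: exprn_continuous.
Qed.

Lemma measurable_arcsine : measurable_fun (setT : set mT) (arcsine : mT -> R).
Proof.
have -> : arcsine = arcsine \_ `]-1, 1[.
  apply/funext => x; rewrite patchE; case: ifPn => //; rewrite notin_setE /= in_itv /=.
  by move=> /negP; exact: arcsine_out.
apply/(measurable_restrictT _ _).1 => //.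
apply: open_continuous_measurable_fun; first exact: interval_open.
by move=> x; rewrite inE /= in_itv /=; exact: arcsine_continuous.
Qed.

Lemma integral_shrunk n (h H : R -> R) :
  (forall x, -1 < x < 1 -> is_derive x 1 H (h x)) ->
  (forall x, -1 < x < 1 -> {for x, continuous h}) ->
  (\int[leb]_(x in shrunk n) (h x)%:E = (H (shrink n) - H (- shrink n))%:E)%E.
Proof.
move=> dH ch; have /andP[n0 n1] := shrink_itv n.
rewrite EFinB; apply: FTC_is_derive; first by lra.
  apply: continuous_in_subspaceT => x; rewrite inE /= in_itv /= => /andP[h1 h2].
  by apply: ch; apply/andP; split; lra.
by move=> x /andP[h1 h2]; apply: dH; apply/andP; split; lra.
Qed.

Lemma is_derive_arcsine x : -1 < x < 1 ->
  is_derive x 1 (fun x => delta * asin x) (arcsine x).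
Proof.
move=> x1; have := is_derive1_asin x1 => d.
exact: is_deriveZ.
Qed.

Lemma integral_arcsine_fin : (\int[leb]_(x in J) (arcsine x)%:E < +oo)%E.
Proof.
have := cvg_shrunk_integral (measurable_funTS measurable_arcsine) (fun x _ => arcsine_ge0 x).
move=> /cvg_lim <- //.
apply: (@le_lt_trans _ _ (delta * pi)%:E); last exact: ltry.
apply: lime_le.
  apply/cvg_ex; eexists.
  apply: cvg_shrunk_integral (fun x _ => arcsine_ge0 x).
  exact: (measurable_funTS measurable_arcsine).
near=> n.
have /andP[n0 n1] := shrink_itv n.
rewrite (integral_shrunk n is_derive_arcsine arcsine_continuous) lee_fin -mulrBr.
rewrite ler_pM2l //.
have h1 := @asin_lepi2 R (shrink n); have h2 := @asin_geNpi2 R (- shrink n).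
have : -1 <= shrink n <= 1 by apply/andP; split; lra.
move=> /h1; have : -1 <= - shrink n <= 1 by apply/andP; split; lra.
by move=> /h2; lra.
Unshelve. all: by end_near.
Qed.

Lemma arcsine_integrable : leb.-integrable setT (EFin \o arcsine).
Proof.
apply/integrableP; split; first by apply/measurable_EFinP; exact: measurable_arcsine.
apply: le_lt_trans integral_arcsine_fin.
rewrite [leRHS]integral_mkcond le_eqVlt; apply/orP; left; apply/eqP.
apply: eq_integral => x _; rewrite /= patchE ger0_norm ?arcsine_ge0 //.
case: ifPn => //; rewrite notin_setE /= in_itv /= => /negP H.
by rewrite arcsine_out.
Qed.

Definition arcsine_measure := weighted arcsine_ge0 arcsine_integrable.

Local Notation am := (arcsine_measure : {finite_measure set mT -> \bar R}).
Local Notation I := (`[-1, 1]%classic : set R).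

Lemma is_derive_semicircle (g : {poly R}) x : -1 < x < 1 ->
  is_derive x 1 (fun x => delta * (Num.sqrt (1 - x ^+ 2) * g.[x]))
    (((1 - 'X^2) * g^`() - 'X * g).[x] * arcsine x).
Proof.
move=> /andP[x0 x1]; have p0 : 0 < 1 - x ^+ 2 by rewrite subr_gt0 expr2; nra.
have s0 : 0 < Num.sqrt (1 - x ^+ 2) by rewrite sqrtr_gt0.
have d1 : is_derive x 1 (fun x : R => 1 - x ^+ 2) (- (2 * x)).
  by apply: is_derive_eq; rewrite /GRing.scale /=; ring.
have d2 : is_derive x 1 (fun x : R => Num.sqrt (1 - x ^+ 2)) (- x / Num.sqrt (1 - x ^+ 2)).
  have h := is_derive1_sqrt p0.
  have := @is_derive1_comp _ Num.sqrt (fun x : R => 1 - x ^+ 2) x _ _ h d1.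
  by move=> /is_derive_eq; apply; field; rewrite gt_eqF.
have d3 : is_derive x 1 (horner g) (g^`()).[x].
  have : derivable (horner g) x 1 by exact: derivable_horner.
  by move=> /derivableP /is_derive_eq; apply; rewrite derivE derive1E.
have d4 := is_deriveM d2 d3.
have := is_deriveZ delta d4 => /is_derive_eq; apply.
rewrite /GRing.scale /= /arcsine !hornerE /=.
have := sqr_sqrtr (ltW p0); move: (Num.sqrt _) s0 => s s0 E.
have -> : 1 - x ^+ 2 = s ^+ 2 by rewrite E.
by field; rewrite gt_eqF.
Qed.

(** The primitive sqrt (1 - x^2) g(x) tends to 0 at both ends. Monotone
    convergence requires a nonnegative integrand, whence the constant C that is
    added to the polynomial and subtracted in the limit. *)
Lemma arcsine_measure_moments : arcsine_moments (moments am).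
Proof.
move=> g; set h := (1 - 'X^2) * g^`() - 'X * g.
have [C HC] := horner_bounded h.
have C0 : 0 <= C by apply: le_trans (HC 0 _); rewrite //= in_itv /= lerN10 ler01.
have mh (p : {poly R}) : measurable_fun (setT : set mT) ((fun x => p.[x] * arcsine x) : mT -> R).
  by apply: measurable_funM; [exact: measurable_horner|exact: measurable_arcsine].
have pos x : -1 < x < 1 -> 0 <= (C%:P + h).[x] * arcsine x.
  move=> /andP[x0 x1]; rewrite mulr_ge0 ?arcsine_ge0 // hornerD hornerC.
  have := HC x; rewrite /= in_itv /= (ltW x0) (ltW x1) => /(_ isT).
  by rewrite ler_norml; lra.
have posC x : -1 < x < 1 -> 0 <= (C%:P).[x] * arcsine x.
  by move=> _; rewrite hornerC mulr_ge0 ?arcsine_ge0.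
have cX := cvg_shrunk_integral (measurable_funTS (mh _)) pos.
have cY := cvg_shrunk_integral (measurable_funTS (mh _)) posC.
have IJ p : (\int[leb]_(x in J) (p.[x] * arcsine x)%:E = (mom (moments am) p)%:E)%E.
  rewrite moments_weighted integral_mkcond [RHS]integral_mkcond.
  apply: eq_integral => x _; rewrite !patchE.
  case: ifPn => xJ; case: ifPn => xI //.
    move: xI; rewrite notin_setE; case; move: xJ; rewrite inE /= !in_itv /=.
    by move=> /andP[x0 x1]; rewrite !ltW.
  rewrite arcsine_out ?mulr0 //; move: xJ; rewrite notin_setE /= in_itv /=.
  by move/negP.
rewrite !IJ in cX cY.
have fin : ((mom (moments am) (C%:P + h))%:E +? - (mom (moments am) C%:P)%:E)%E by [].
have cD := cvgeB (FF := eventually_filter) fin cX cY.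
move: cD; rewrite -EFinB linearD /= addrAC subrr add0r => cD.
suff c0 : ((fun n => \int[leb]_(x in shrunk n) ((C%:P + h).[x] * arcsine x)%:E -
    \int[leb]_(x in shrunk n) ((C%:P).[x] * arcsine x)%:E) @ \oo --> 0)%E.
  by apply: EFin_inj; rewrite -(cvg_lim (@ereal_hausdorff R) cD) (cvg_lim (@ereal_hausdorff R) c0).
pose G (x : R) := delta * (Num.sqrt (1 - x ^+ 2) * g.[x]).
pose K (x : R) := C * (delta * asin x).
have dG x : -1 < x < 1 -> is_derive x 1 G (h.[x] * arcsine x) by exact: is_derive_semicircle.
have dK x : -1 < x < 1 -> is_derive x 1 K ((C%:P).[x] * arcsine x).
  by move=> x1; rewrite hornerC; have := is_deriveZ C (is_derive_arcsine x1).
have dGK x : -1 < x < 1 -> is_derive x 1 (K \+ G) ((C%:P + h).[x] * arcsine x).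
  by move=> x1; rewrite hornerD mulrDl; exact: (is_deriveD (dK _ x1) (dG _ x1)).
have cp (p : {poly R}) x : -1 < x < 1 -> {for x, continuous (fun x => p.[x] * arcsine x)}.
  move=> x1; apply: continuousM; first exact: continuous_horner.
  exact: arcsine_continuous.
have E n : (\int[leb]_(x in shrunk n) ((C%:P + h).[x] * arcsine x)%:E -
    \int[leb]_(x in shrunk n) ((C%:P).[x] * arcsine x)%:E)%E = (G (shrink n) - G (- shrink n))%:E.
  rewrite (integral_shrunk n dGK (cp _)) (integral_shrunk n dK (cp _)) -EFinB.
  by congr EFin; rewrite /=; ring.
rewrite (_ : (fun n => _) = EFin \o (fun n => G (shrink n) - G (- shrink n))); last first.
  by apply/funext => n; exact: E.
apply/cvg_EFin; first by near=> n.
have cG x : {for x, continuous G}.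
  apply: (@continuousM _ _ (fun=> delta)); first exact: cst_continuous.
  apply: (@continuousM _ _ (fun x => Num.sqrt (1 - x ^+ 2))); last exact: continuous_horner.
  apply: (@continuous_comp _ _ _ (fun x => 1 - x ^+ 2) Num.sqrt); last exact: sqrt_continuous.
  by apply: continuousB; [exact: cst_continuous|exact: exprn_continuous].
have -> : (0 : R) = G 1 - G (- 1).
  by rewrite /G sqrrN expr1n subrr sqrtr0 !mul0r !mulr0 subrr.
apply: cvgB.
  by apply: (continuous_cvg _ (cG 1)); exact: shrink_cvg.
apply: (continuous_cvg _ (cG (- 1))); apply: cvgN; exact: shrink_cvg.
Unshelve. all: by end_near.
Qed.

Lemma arcsine_measure_ge A : measurable (A : set mT) ->
  (delta%:E * leb (A `&` J) <= am A)%E.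
Proof.
move=> mA; have mAJ : measurable (A `&` J : set mT) by exact: measurableI.
rewrite -integral_cst //.
apply: (@le_trans _ _ (\int[leb]_(x in A `&` J) (arcsine x)%:E)%E).
  apply: ge0_le_integral => //.
  - by move=> x _; rewrite lee_fin ltW.
  - by apply/measurable_EFinP; apply: measurable_funTS; exact: measurable_arcsine.
  - by move=> x [_]; rewrite /= in_itv /= => x1; rewrite lee_fin arcsine_ge.
apply: ge0_subset_integral => //.
- by apply/measurable_EFinP; apply: measurable_funTS; exact: measurable_arcsine.
- by move=> x _; rewrite lee_fin arcsine_ge0.
Qed.

Lemma arcsine_measure_out : am (~` I) = 0%E.
Proof.
rewrite /arcsine_measure /= /weighted integral0_eq // => x /= xI.
rewrite arcsine_out //; apply/negP => /andP[x0 x1]; apply: xI.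
by rewrite /= in_itv /= !ltW.
Qed.

Lemma arcsine_measure0 : 0 < moments am 0.
Proof.
have am_fin : (am I < +oo)%E by exact: weighted_fin_I.
rewrite -lte_fin -momXn -momentsE //.
have -> : (\int[am]_(x in I) (('X^0 : {poly R}).[x])%:E = am I)%E.
  under eq_integral do rewrite expr0 hornerC.
  by rewrite integral_cst ?mul1e //; exact: measurable_I.
apply: lt_le_trans (arcsine_measure_ge measurable_I).
rewrite (_ : I `&` J = J); last first.
  apply/setIidPr => x; rewrite /= !in_itv /= => /andP[x0 x1].
  by rewrite !ltW.
rewrite lebesgue_measure_itv /= lte_fin gtrN // -EFinB -EFinM lte_fin.
by rewrite mulr_gt0 // opprK.
Qed.

End ArcsineMeasure.

(** If b(p^2) = 0, the quadrature formula with as many nodes as the size of p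
    makes p vanish at all of them. *)
Lemma arcsine_pd (R : realType) (b : nat -> R) :
  arcsine_moments b -> 0 < b 0%N -> pd b.
Proof.
move=> hb b0 p pn0.
have eb := arcsine_moments_even hb.
set f := even_poly (p ^+ 2); set m := size p.
have m0 : (0 < m)%N by rewrite size_poly_gt0.
have sf : (size f <= m.*2)%N.
  apply: leq_trans (size_even_poly _) _; rewrite leq_uphalf_double.
  rewrite expr2; apply: leq_trans (size_polyMleq _ _) _.
  by rewrite -addnn -!addnn; apply: leq_trans (leq_pred _) (leq_addr _ _).
have fE x : f.[x ^+ 2] = (p.[x] ^+ 2 + p.[- x] ^+ 2) / 2.
  rewrite -(horner_pair_even f) -!horner_exp.
  rewrite -(poly_even_odd (p ^+ 2)) -/f !hornerD !hornerM !hornerX.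
  rewrite !horner_comp !hornerXn sqrrN.
  move: (f.[_]) ((odd_poly _).[_]) => u v.
  by congr (_ / _); ring.
have E : mom b (p ^+ 2) = b 0%N / m%:R * \sum_(k < m) f.[sin (node m k) ^+ 2].
  rewrite -arcsine_quadrature //.
  by rewrite -{1}[p ^+ 2]poly_even_odd linearD /= mom_even_comp // addr0.
have f0 x : 0 <= f.[x ^+ 2] by rewrite fE divr_ge0 // addr_ge0 ?sqr_ge0.
have bm : 0 < b 0%N / m%:R by rewrite divr_gt0 // ltr0n.
rewrite E pmulr_rgt0 // lt0r sumr_ge0 ?andbT //.
apply/eqP => /eqP; rewrite psumr_eq0 // => /allP z.
suff : (m < size p)%N by rewrite ltnn.
have := @max_poly_roots _ p [seq sin (@node R m k) | k <- iota 0 m] pn0.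
rewrite size_map size_iota; apply.
  rewrite all_map; apply/allP => k; rewrite mem_iota add0n => /= km.
  have := z (Ordinal km) (mem_index_enum _); rewrite fE /= => /eqP zz.
  rewrite /root -sqrf_eq0; apply/eqP; move: zz.
  have := sqr_ge0 p.[sin (node m k)]; have := sqr_ge0 p.[- sin (node m k)].
  by lra.
rewrite map_inj_in_uniq ?iota_uniq // => i j.
rewrite !mem_iota !add0n /= => im jm ij.
have /andP[i0 i1] := @node_bounds R _ _ im; have /andP[j0 j1] := @node_bounds R _ _ jm.
case: (ltngtP i j) => // h; move: h; rewrite -(@ltr_node R m) // => h.
  by have := ltr_sin_half (ltW i0) (ltW j1) h; rewrite ij ltxx.
by have := ltr_sin_half (ltW j0) (ltW i1) h; rewrite ij ltxx.
Qed.

(** * Smoothing symmetric point masses *)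

Section Smoothing.
Context {R : realType}.
Local Notation leb := (@lebesgue_measure R).
Local Notation mT := (measurableTypeR R).
Local Notation I := (`[-1, 1]%classic : set R).
Implicit Types (x y r : R).

Lemma moments0 (mu : {measure set mT -> \bar R}) : (mu I < +oo)%E ->
  mu I = (moments mu 0)%:E.
Proof.
move=> muI; rewrite -momXn -momentsE //.
under eq_integral do rewrite expr0 hornerC.
by rewrite integral_cst ?mul1e //; exact: measurable_I.
Qed.

Lemma exprn_lipschitz k (a b : R) : `|a| <= 1 -> `|b| <= 1 ->
  `|a ^+ k - b ^+ k| <= k%:R * `|a - b|.
Proof.
move=> a1 b1; rewrite subrXX normrM mulrC ler_wpM2r //.
apply: le_trans (ler_norm_sum _ _ _) _.
apply: (@le_trans _ _ (\sum_(i < k) 1)); last by rewrite sumr_const card_ord.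
apply: ler_sum => i _; rewrite normrM !normrX.
by rewrite mulr_ile1 ?exprn_ile1 ?exprn_ge0.
Qed.

Definition box y r x : R := (y - r <= x <= y + r)%R%:R / (2 * r).

Definition box_moment y r k : R :=
  ((y + r) ^+ k.+1 - (y - r) ^+ k.+1) / (k.+1%:R * (2 * r)).

Lemma box_ge0 y r x : 0 < r -> 0 <= box y r x.
Proof. by move=> r0; rewrite divr_ge0 // mulr_ge0 // ltW. Qed.

Lemma box_le y r x : 0 < r -> box y r x <= (2 * r)^-1.
Proof.
move=> r0; rewrite /box ler_piMl ?lern1 ?leq_b1 // invr_ge0 mulr_ge0 // ltW //.
Qed.

Lemma boxE y r : box y r = (fun x => (2 * r)^-1 * \1_(`[y - r, y + r]%classic : set R) x).
Proof. by apply/funext => x; rewrite /box indicE mem_setE in_itv /= mulrC. Qed.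

Lemma box_integrable y r : leb.-integrable setT (EFin \o box y r).
Proof.
have i1 : leb.-integrable setT (fun x => ((2 * r)^-1)%:E *
    (\1_(`[y - r, y + r]%classic : set R) x)%:E)%E.
  by apply: integrableZl => //; exact: integrable_indic_itv.
by apply: eq_integrable i1 => // x _; rewrite /= boxE EFinM.
Qed.

Lemma integral_box y r k : 0 < r -> `|y| + r <= 1 ->
  (\int[leb]_(x in I) (x ^+ k * box y r x)%:E = (box_moment y r k)%:E)%E.
Proof.
move=> r0 yr; have [y1 y2] : - 1 <= y - r /\ y + r <= 1.
  have := ler_norm y; have := ler_norm (- y); rewrite normrN; lra.
have r2 : 2 * r != 0 by rewrite mulf_neq0 // gt_eqF.
have k0 : k.+1%:R != 0 :> R by rewrite pnatr_eq0.
have -> : (box_moment y r k)%:E = (((y + r) ^+ k.+1 / (k.+1%:R * (2 * r)))%:E -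
    ((y - r) ^+ k.+1 / (k.+1%:R * (2 * r)))%:E)%E by rewrite -EFinB -mulrBl.
have d x : is_derive x 1 (fun x => x ^+ k.+1 / (k.+1%:R * (2 * r))) (x ^+ k / (2 * r)).
  have d : is_derive x 1 (fun x : R => x ^+ k.+1) (k.+1%:R * x ^+ k).
    apply: DeriveDef; first exact: exprn_derivable.
    by rewrite exp_derive /GRing.scale /= mulr1.
  have := is_deriveZ (k.+1%:R * (2 * r))^-1 d.
  have -> : (k.+1%:R * (2 * r))^-1 \*: (fun x : R => x ^+ k.+1) =
      (fun x => x ^+ k.+1 / (k.+1%:R * (2 * r))).
    by apply/funext => z; rewrite /= /GRing.scale /= mulrC.
  move=> /is_derive_eq; apply; rewrite /GRing.scale /=.
  by move: (k.+1%:R) k0 (x ^+ k) => K K0 a; field; rewrite K0 gt_eqF.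
have ab : y - r < y + r by lra.
have cf : {within `[y - r, y + r], continuous (fun x => x ^+ k / (2 * r))}.
  apply: continuous_subspaceT => x.
  apply: (@continuousM _ _ (fun x => x ^+ k) (fun=> (2 * r)^-1)); last exact: cst_continuous.
  exact: exprn_continuous.
have <- := FTC_is_derive ab cf (fun x _ => d x).
rewrite integral_mkcond [RHS]integral_mkcond; apply: eq_integral => x _.
rewrite !patchE /box !mem_setE !in_itv /=.
case: (boolP (y - r <= x <= y + r)) => [/andP[x1 x2]|_].
  by rewrite (le_trans y1 x1) (le_trans x2 y2) /= mul1r.
by rewrite mul0r mulr0; case: ifP.
Qed.

(** The moment is the mean of the products (y + r)^(k - i) (y - r)^i over
    i = 0, ..., k, each of which is within k r of y^k. *)
Lemma box_moment_near y r k : 0 < r -> `|y| + r <= 1 ->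
  `|box_moment y r k - y ^+ k| <= k%:R * r.
Proof.
move=> r0 yr; have [ya yb] : `|y + r| <= 1 /\ `|y - r| <= 1.
  split; [apply: le_trans (ler_normD _ _) _|apply: le_trans (ler_normB _ _) _];
  by rewrite [`|r|]gtr0_norm.
have y1 : `|y| <= 1 by lra.
have r2 : 2 * r != 0 by rewrite mulf_neq0 // gt_eqF.
have k0 : k.+1%:R != 0 :> R by rewrite pnatr_eq0.
have -> : box_moment y r k - y ^+ k =
    (\sum_(i < k.+1) ((y + r) ^+ (k - i) * (y - r) ^+ i - y ^+ k)) / k.+1%:R.
  rewrite /box_moment subrXX sumrB sumr_const card_ord -mulr_natr /=.
  have aux (a b c d : R) : b != 0 -> c != 0 -> d = b -> d * a / (c * b) - y ^+ k = (a - y ^+ k * c) / c.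
    by move=> b0 c0 ->; field; rewrite b0 c0.
  rewrite aux //; first by rewrite mul1r mulr_natr.
  by ring.
rewrite normrM normfV (ger0_norm (ler0n R k.+1)) ler_pdivrMr ?ltr0n //.
apply: le_trans (ler_norm_sum _ _ _) _.
apply: (@le_trans _ _ (\sum_(i < k.+1) (k%:R * r))); last first.
  by rewrite sumr_const card_ord mulr_natr.
apply: ler_sum => i _.
have -> : (y + r) ^+ (k - i) * (y - r) ^+ i - y ^+ k =
   ((y + r) ^+ (k - i) - y ^+ (k - i)) * (y - r) ^+ i + y ^+ (k - i) * ((y - r) ^+ i - y ^+ i).
  have {1}-> : y ^+ k = y ^+ (k - i) * y ^+ i by rewrite -exprD subnK // -ltnS.
  by ring.
apply: le_trans (ler_normD _ _) _.
rewrite !normrM !normrX.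
apply: (@le_trans _ _ ((k - i)%:R * r + i%:R * r)); last first.
  by rewrite -mulrDl -natrD subnK // -ltnS.
apply: lerD.
  rewrite -[leRHS]mulr1 ler_pM ?exprn_ge0 ?exprn_ile1 //.
  by apply: le_trans (exprn_lipschitz _ ya y1) _; rewrite addrC addKr gtr0_norm.
rewrite -[leRHS]mul1r ler_pM ?exprn_ge0 ?exprn_ile1 //.
apply: le_trans (exprn_lipschitz _ yb y1) _.
by rewrite addrAC subrr sub0r normrN gtr0_norm.
Qed.

Section Pairs.
Variables (m : nat) (x M : nat -> R) (r : R).
Hypothesis M_ge0 : forall j, (j < m)%N -> 0 <= M j.
Hypothesis r_gt0 : 0 < r.
Hypothesis x_far : forall j, (j < m)%N -> 2 * r <= x j /\ x j + 2 * r <= 1.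

Definition boxes t : R := \sum_(j < m) M j / 2 * (box (x j) r t + box (- x j) r t).

Lemma boxes_ge0 t : 0 <= boxes t.
Proof.
apply: sumr_ge0 => j _; rewrite mulr_ge0 ?addr_ge0 ?box_ge0 // divr_ge0 //.
exact: M_ge0.
Qed.

Lemma boxes_integrable : leb.-integrable setT (EFin \o boxes).
Proof.
rewrite (_ : EFin \o boxes = (fun t => \sum_(j < m) (M j / 2 * (box (x j) r t + box (- x j) r t))%:E)%E).
  apply: integrable_sum => // j _.
  under eq_fun do rewrite EFinM EFinD.
  by apply: integrableZl => //; apply: integrableD => //; exact: box_integrable.
by apply/funext => t /=; rewrite sumEFin.
Qed.

Lemma boxes_le t : boxes t <= (\sum_(j < m) M j) / (2 * r).
Proof.
rewrite mulr_suml; apply: ler_sum => j _.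
have := box_le (x j) t r_gt0; have := box_le (- x j) t r_gt0.
move: (box _ _ _) (box _ _ _) => u v hu hv.
rewrite -mulrA ler_wpM2l ?M_ge0 //.
move: (2 * r)^-1 hu hv => w; lra.
Qed.

Lemma boxes_gap t : boxes t != 0 -> r <= `|t| < 1.
Proof.
apply: contraR => H; apply/eqP; apply: big1 => j _.
have [h1 h2] := x_far (ltn_ord j).
rewrite /box.
have /negbTE -> : ~~ (x j - r <= t <= x j + r).
  apply: contra H => /andP[h3 h4]; rewrite ger0_norm; last by lra.
  by apply/andP; split; have := r_gt0; lra.
have /negbTE -> : ~~ (- x j - r <= t <= - x j + r).
  apply: contra H => /andP[h3 h4]; rewrite ler0_norm; last by lra.
  by apply/andP; split; have := r_gt0; lra.
by rewrite !mul0r addr0 mulr0.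
Qed.

Definition boxes_measure := weighted boxes_ge0 boxes_integrable.
Local Notation bm := (boxes_measure : {finite_measure set mT -> \bar R}).

Lemma boxes_moments k :
  moments bm k = \sum_(j < m) M j * ((box_moment (x j) r k + box_moment (- x j) r k) / 2).
Proof.
apply: EFin_inj; rewrite -{1}(momXn (moments bm)) moments_weighted.
transitivity (\int[leb]_(t in I) (\sum_(j < m) ((M j / 2)%:E * (t ^+ k * box (x j) r t)%:E
   + (M j / 2)%:E * (t ^+ k * box (- x j) r t)%:E)))%E.
  apply: eq_integral => t _; rewrite hornerXn mulr_sumr -sumEFin.
  by apply: eq_bigr => j _; rewrite -!EFinM -EFinD; congr EFin; ring.
have int y : leb.-integrable I (fun t => (t ^+ k * box y r t)%:E).
  have := box_integrable y r => ib.
  have mb : measurable_fun (setT : set mT) (fun t => t ^+ k * box y r t).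
    apply: measurable_funM; first exact: measurable_funX.
    by apply/measurable_EFinP; exact: (measurable_int _ ib).
  apply: (@le_integrable _ _ _ leb I _ _ (EFin \o box y r)) => //.
  - by apply/measurable_EFinP; apply: measurable_funTS.
  - move=> t; rewrite /= in_itv /= => t1.
    rewrite lee_fin normrM normrX ler_piMl // exprn_ile1 //.
    by rewrite ler_norml.
  - by apply: integrableS ib => //; exact: measurable_I.
have intc y j : leb.-integrable I (fun t => (M j / 2)%:E * (t ^+ k * box y r t)%:E)%E.
  by apply: integrableZl => //; exact: measurable_I.
rewrite (integral_sum measurable_I) => [|j]; last first.
  exact: (integrableD measurable_I (intc _ _) (intc _ _)).
rewrite -sumEFin; apply: eq_bigr => j _.
have [h1 h2] := x_far (ltn_ord j).
have hx : `|x j| + r <= 1 by rewrite ger0_norm; have := r_gt0; lra.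
rewrite (integralD measurable_I (intc _ _) (intc _ _)).
rewrite !integralZl //; try exact: measurable_I.
rewrite !integral_box ?normrN // -!EFinM -EFinD; congr EFin; ring.
Qed.

Lemma boxes_moments_even : moments_even (moments bm).
Proof.
move=> k ok; rewrite boxes_moments big1 // => j _.
suff -> : box_moment (- x j) r k = - box_moment (x j) r k by rewrite subrr mul0r mulr0.
have ev (z : R) : (- z) ^+ k.+1 = z ^+ k.+1.
  by rewrite exprNn -signr_odd /= ok expr0 mul1r.
rewrite /box_moment (_ : - x j + r = - (x j - r)); last by ring.
rewrite (_ : - x j - r = - (x j + r)); last by ring.
by rewrite !ev -mulNr opprB.
Qed.

Lemma boxes_moments_near k :
  `|moments bm k - pair_moments m x M k| <= k%:R * r * \sum_(j < m) M j.
Proof.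
rewrite boxes_moments /pair_moments -sumrB mulr_sumr.
apply: le_trans (ler_norm_sum _ _ _) _; apply: ler_sum => j _.
have [h1 h2] := x_far (ltn_ord j).
have hx : `|x j| + r <= 1 by rewrite ger0_norm; have := r_gt0; lra.
have n1 := box_moment_near k r_gt0 hx.
have n2 := box_moment_near k r_gt0 (y := - x j); rewrite normrN in n2.
have {}n2 := n2 hx.
rewrite -mulrBr normrM [`|M j|]ger0_norm ?M_ge0 // mulrC ler_wpM2r ?M_ge0 //.
rewrite -mulrBl opprD addrACA normrM [`|2^-1|]ger0_norm // ler_pdivrMr //.
apply: le_trans (ler_normD _ _) _; lra.
Qed.

Lemma boxes_measure_out : bm (~` I) = 0%E.
Proof.
rewrite /boxes_measure /= /weighted integral0_eq // => t /= tI.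
congr EFin; apply/eqP; apply/negPn/negP => /boxes_gap /andP[_].
by rewrite ltr_norml => /andP[t0 t1]; apply: tI; rewrite in_itv /= !ltW.
Qed.

End Pairs.

(** What a later step needs to know about the mass already placed: a density
    bounded by a multiple of the base density, and a gap around the origin. *)
Definition tame (b F : nat -> R) : Prop := [/\ psd F, moments_even F, support_in_unit F,
  exists2 H, 0 <= H & forall p : {poly R}, mom F (p ^+ 2) <= H * mom b (p ^+ 2) &
  exists2 eta, 0 < eta & forall p : {poly R}, eta ^+ 2 * mom F (p ^+ 2) <= mom F (('X * p) ^+ 2)].

Lemma radius_exists m (x : nat -> R) s : (forall j, (j < m)%N -> 0 < x j < 1) -> 0 < s ->
  exists2 r, 0 < r <= s & forall j, (j < m)%N -> 2 * r <= x j /\ x j + 2 * r <= 1.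
Proof.
elim: m => [|m IH] hx s0; first by exists s => //; rewrite s0 /=.
have [j jm|r /andP[r0 rs] Hr] := IH _ s0; first by apply: hx; rewrite ltnS ltnW.
have /andP[x0 x1] := hx m (ltnSn m).
pose t := Num.min r (Num.min (x m / 2) ((1 - x m) / 2)).
have [tr tx t1] : [/\ t <= r, t <= x m / 2 & t <= (1 - x m) / 2].
  by rewrite /t !ge_min !lexx !orbT.
exists t.
  by rewrite (le_trans tr rs) andbT !lt_min r0 !divr_gt0 // subr_gt0.
move=> j; rewrite ltnS leq_eqVlt => /orP[/eqP ->|/Hr [h1 h2]]; split; lra.
Qed.

(** Point masses are replaced by uniform densities on short intervals, which stay
    away from 0 and from the end points and change each moment by at most
    k r times the mass. *)
Lemma smooth_pairs (delta : R) (d0 : 0 < delta) m (x M : nat -> R) e N :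
  (forall j, (j < m)%N -> 0 < x j < 1 /\ 0 <= M j) -> 0 < e ->
  exists mu : {finite_measure set mT -> \bar R},
   [/\ mu `<< leb, mu (~` I) = 0%E, tame (moments (arcsine_measure d0)) (moments mu) &
      forall k, (k <= N)%N -> `|moments mu k - pair_moments m x M k| <= e].
Proof.
move=> hxM e0.
have hx j : (j < m)%N -> 0 < x j < 1 by move=> /hxM [].
have hM j : (j < m)%N -> 0 <= M j by move=> /hxM [].
pose S := \sum_(j < m) M j; have S0 : 0 <= S by apply: sumr_ge0 => j _; exact: hM.
have NS : 0 < N%:R * S + 1 by rewrite ltr_wpDl // mulr_ge0.
have [r /andP[r0 rs] Hr] := radius_exists hx (divr_gt0 e0 NS).
pose mu := (boxes_measure x hM r0 : {finite_measure set mT -> \bar R}).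
exists mu; split.
- exact: weighted_dominates.
- exact: boxes_measure_out Hr.
- split.
  + by apply: moments_psd; exact: weighted_fin_I.
  + exact: boxes_moments_even.
  + by apply: moments_support; exact: weighted_fin_I.
  + exists (S / (2 * r) / delta); first by rewrite !divr_ge0 // ?mulr_ge0 // ltW.
    move=> p; apply: weighted_le => t _; rewrite mulrCA ler_wpM2l ?sqr_ge0 //.
    have [->|/(boxes_gap r0 Hr)] := eqVneq (boxes m x M r t) 0.
      by rewrite mulr_ge0 ?arcsine_ge0 // !divr_ge0 // ?mulr_ge0 // ltW.
    move=> /andP[_]; rewrite ltr_norml => t1.
    apply: le_trans (boxes_le x hM r0 t) _.
    rewrite -/S -[leRHS]mulrA ler_peMr //.
      by rewrite divr_ge0 // mulr_ge0 // ltW.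
    by rewrite mulrC ler_pdivlMr // mul1r arcsine_ge.
  + exists r => // p; rewrite -ler_pdivlMl ?exprn_gt0 //; apply: weighted_le.
    move=> t _; have [->|/(boxes_gap r0 Hr) /andP[rt _]] := eqVneq (boxes m x M r t) 0.
      by rewrite !mulr0.
    rewrite mulrA ler_wpM2r ?boxes_ge0 // mulrC ler_pdivlMr ?exprn_gt0 //.
    rewrite hornerM hornerX exprMn mulrC ler_wpM2r ?sqr_ge0 //.
    by rewrite -[leRHS]real_normK ?num_real // ler_sqr ?nnegrE // ltW.
- move=> k kN; apply: le_trans (boxes_moments_near hM r0 Hr k) _.
  rewrite -/S; apply: (@le_trans _ _ ((N%:R * S + 1) * r)); last first.
    by rewrite mulrC -ler_pdivlMr.
  rewrite mulrAC ler_wpM2r ?(ltW r0) //.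
  apply: (@le_trans _ _ (N%:R * S)); last by rewrite lerDl.
  by rewrite ler_wpM2r // ler_nat.
Qed.

End Smoothing.

(** * Series of measures and the lower bound on the density *)

Section DensityBound.
Context {R : realType}.
Local Notation leb := (@lebesgue_measure R).
Local Notation mT := (measurableTypeR R).
Local Notation J := (`]-1, 1[%classic : set R).

(** On the set where the density is below delta, psi is at least delta times the
    length by hypothesis, and less than that by integration unless the set is
    null. *)
Lemma density_ge (delta : R) (psi : {finite_measure set mT -> \bar R}) :
  psi `<< leb ->
  (forall A : set mT, measurable A -> (delta%:E * leb (A `&` J) <= psi A)%E) ->
  {ae leb, forall x : R, x \in `[-1, 1] ->
    (delta%:E <= 'd (charge_of_finite_measure psi) '/d leb x)%E}.
Proof.
move=> psi_leb H.
set f := 'd _ '/d leb.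
have if_ : leb.-integrable setT f by exact: Radon_Nikodym_integrable.
have mf := measurable_int _ if_.
have ff x : f x \is a fin_num by exact: Radon_Nikodym_fin_num.
pose A : set mT := J `&` [set x | (f x < delta%:E)%E].
have mA : measurable A.
  apply: measurableI; first exact: measurable_itv.
  by rewrite -[X in measurable X]setTI; exact: emeasurable_fun_infty_o.
have lA : (leb A < +oo)%E.
  apply: (@le_lt_trans _ _ (leb J)).
    by apply: le_measure; rewrite ?inE //; first [exact: measurable_itv|exact: subIsetl].
  by rewrite lebesgue_measure_itv /= lte_fin gtrN // -EFinB ltry.
have iA : leb.-integrable A f by exact: integrableS if_.
have ic : leb.-integrable A (cst delta%:E).
  apply: measurable_bounded_integrable => //.
  exists `|delta|; split; first exact: num_real.
  by move=> z zd x _; exact: ltW.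
have iAE : (\int[leb]_(x in A) f x = psi A)%E.
  by have := @Radon_Nikodym_integral _ _ _ (charge_of_finite_measure psi) leb A psi_leb mA => <-.
clearbody f.
have AJ : A `&` J = A by apply/setIidPl; exact: subIsetl.
have z : (\int[leb]_(x in A) `|delta%:E - f x| = 0)%E.
  apply/eqP; rewrite eq_le; apply/andP; split; last first.
    by apply: integral_ge0 => x _; exact: abse_ge0.
  rewrite (eq_integral (fun x => delta%:E - f x)%E); last first.
    move=> x; rewrite inE => -[_ /= fx]; rewrite gee0_abs // sube_ge0 ?ltW //.
    by rewrite ff.
  rewrite integralB // iAE integral_cst // sube_le0.
  by have := H _ mA; rewrite AJ.
have mg : measurable_fun A (fun x => delta%:E - f x)%E.
  by apply: emeasurable_funB => //; exact: measurable_funTS.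
have [/(_ z) g0 _] := ae_eq_integral_abs leb mA mg.
have n1 (a : R) : {ae leb, forall x : R, x != a}.
  exists [set a]; split; [exact: measurable_set1|exact: lebesgue_measure_set1|].
  by move=> x /= /negP; rewrite negbK => /eqP.
apply: filterS3 g0 (n1 1) (n1 (- 1)) => x gx x1 x2.
rewrite in_itv /= => /andP[h1 h2].
have xJ : -1 < x < 1 by rewrite !lt_neqAle h1 h2 eq_sym x1 x2.
rewrite leNgt; apply/negP => fx.
have := gx (conj _ fx); rewrite /= in_itv /= => /(_ xJ) /eqP.
have := ff x; case: (f x) fx => // r; rewrite lte_fin => rd _.
by rewrite -EFinB eqe subr_eq0 => /eqP E; move: rd; rewrite E ltxx.
Qed.

End DensityBound.

Section Series.
Context {R : realType}.
Local Notation leb := (@lebesgue_measure R).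
Local Notation mT := (measurableTypeR R).
Local Notation I := (`[-1, 1]%classic : set R).
Variables (nu : nat -> {finite_measure set mT -> \bar R}) (e : nat -> R).
Hypothesis e_ge0 : forall i, 0 <= e i.
Hypothesis nu_le : forall i, (nu i setT <= (e i - e i.+1)%:E)%E.

Let nuT : {measure set mT -> \bar R}^nat := fun i => nu i.

Definition sum_measure : set mT -> \bar R := mseries nuT 0.
HB.instance Definition _ := Measure.on sum_measure.

(** The budgets e i telescope. *)
Lemma mseries_le N A : measurable A -> (mseries nuT N A <= (e N)%:E)%E.
Proof.
move=> mA; rewrite /mseries; apply: lime_le.
  by apply: is_cvg_nneseries => k _ _.
near=> n.
have Nn : (N <= n)%N by near: n; exact: nbhs_infty_ge.
apply: (@le_trans _ _ (e N - e n)%:E); last by rewrite lee_fin gerBl.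
rewrite -(subnK Nn) addnC; move: (n - N)%N => k {Nn}.
elim: k => [|k IH]; first by rewrite addn0 big_geq // subrr.
rewrite addnS big_nat_recr ?leq_addr //=.
have -> : e N - e (N + k).+1 = (e N - e (N + k)%N) + (e (N + k)%N - e (N + k).+1) by ring.
rewrite EFinD; apply: leeD => //; apply: le_trans (nu_le _).
by apply: le_measure; rewrite ?inE.
Unshelve. all: by end_near.
Qed.

Let sum_measure_fin : fin_num_fun sum_measure.
Proof.
move=> A mA; rewrite ge0_fin_numE ?measure_ge0 //.
exact: le_lt_trans (mseries_le 0 mA) (ltry _).
Qed.

HB.instance Definition _ := Measure_isFinite.Build _ _ _ sum_measure sum_measure_fin.

Local Notation tot := (sum_measure : {finite_measure set mT -> \bar R}).

Lemma mseries_fin_I N : (mseries nuT N I < +oo)%E.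
Proof. by apply: le_lt_trans (mseries_le N _) (ltry _); exact: measurable_I. Qed.

Lemma sum_measure_out A : (forall i, nu i A = 0%E) -> tot A = 0%E.
Proof. by move=> H; apply: eseries0 => i _ _; exact: H. Qed.

Lemma sum_measure_dominates : (forall i, nu i `<< leb) -> tot `<< leb.
Proof.
move=> H; apply/null_content_dominatesP => A mA A0; apply: sum_measure_out => i.
by have /null_content_dominatesP := H i; apply.
Qed.

Lemma sum_measure_ge A : measurable A -> (nu 0 A <= tot A)%E.
Proof.
move=> mA; rewrite /= /sum_measure /mseries nneseries_recl //.
by rewrite leeDl // nneseries_ge0.
Qed.

Lemma sum_measure_moments N k :
  moments tot k = \sum_(i < N) moments (nu i) k + moments (mseries nuT N) k.
Proof.
elim: N => [|N ->]; first by rewrite big_ord0 add0r.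
rewrite big_ord_recr /= -addrA; congr (_ + _).
rewrite -momentsD; last exact: mseries_fin_I.
  apply: eq_moments => A mA.
  transitivity (nu N A + mseries nuT N.+1 A)%E; last exact/esym/measure_addE.
  rewrite /mseries.
  have E := @nneseries_split R (fun k => nuT k A) N 1 (fun k _ => measure_ge0 _ _).
  rewrite addn1 big_nat1 in E.
  exact: E.
have := @fin_num_measure _ _ _ (nu N) I measurable_I.
by rewrite ge0_fin_numE.
Qed.

Lemma sum_measure_moments_near N k :
  `|moments tot k - \sum_(i < N) moments (nu i) k| <= e N.
Proof.
rewrite (sum_measure_moments N) addrAC subrr add0r -lee_fin.
apply: le_trans (moments_le _ _) (mseries_le N _); last exact: measurable_I.
exact: mseries_fin_I.
Qed.

Lemma sum_measure_moments_dominates : dominates (moments tot) (moments (nu 0)).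
Proof.
move=> p; have -> : mom (moments tot) (p ^+ 2) =
    mom (moments (nu 0)) (p ^+ 2) + mom (moments (mseries nuT 1)) (p ^+ 2).
  by rewrite -momD; congr mom; apply/funext => k; rewrite (sum_measure_moments 1) big_ord1.
by rewrite lerDl; apply: moments_psd; exact: mseries_fin_I.
Qed.

Lemma sum_measure_exists : exists psi : {finite_measure set mT -> \bar R},
  [/\ forall A, (forall i, nu i A = 0%E) -> psi A = 0%E,
      (forall i, nu i `<< leb) -> psi `<< leb,
      forall A, measurable A -> (nu 0 A <= psi A)%E,
      dominates (moments psi) (moments (nu 0)) &
      forall N k, `|moments psi k - \sum_(i < N) moments (nu i) k| <= e N].
Proof.
exists tot; split.
- exact: sum_measure_out.
- exact: sum_measure_dominates.
- exact: sum_measure_ge.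
- exact: sum_measure_moments_dominates.
- exact: sum_measure_moments_near.
Qed.

End Series.

(** * The gliding hump *)

Section Tame.
Context {R : realType}.
Implicit Types (a b F G : nat -> R).

Lemma tame0 b : psd b -> tame b (fun=> 0).
Proof.
move=> pb; have z p : mom (fun=> 0) p = 0 :> R.
  by rewrite /mom big1 // => i _; rewrite mulr0.
split.
- by move=> p; rewrite z.
- by [].
- by move=> p; rewrite !z.
- by exists 0 => // p; rewrite z mul0r.
- by exists 1 => // p; rewrite !z mulr0.
Qed.

Lemma tameD b F G : tame b F -> tame b G -> tame b (fun k => F k + G k).
Proof.
move=> [pF eF sF [H H0 HF] [h h0 hF]] [pG eG sG [K K0 KG] [g g0 gG]].
split.
- exact: psdD.
- by move=> k ok; rewrite eF // eG // addr0.
- by move=> p; rewrite !momD lerD.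
- by exists (H + K); [exact: addr_ge0|move=> p; rewrite momD mulrDl lerD].
- exists (Num.min h g); first by rewrite lt_min h0 g0.
  have m0 : 0 <= Num.min h g by rewrite le_min !ltW.
  move=> p; rewrite !momD mulrDr lerD //.
    apply: le_trans (hF p); apply: ler_wpM2r; first exact: pF.
    by rewrite ler_sqr ?nnegrE ?(ltW h0) // ge_min lexx.
  apply: le_trans (gG p); apply: ler_wpM2r; first exact: pG.
  by rewrite ler_sqr ?nnegrE ?(ltW g0) // ge_min lexx orbT.
Qed.

Lemma pair_moments_support m (x M : nat -> R) :
  (forall j, (j < m)%N -> 0 < x j < 1 /\ 0 <= M j) ->
  support_in_unit (pair_moments m x M).
Proof.
move=> hx p; rewrite !mom_pair; apply: ler_sum => j _.
have [/andP[x0 x1] M0] := hx j (ltn_ord j).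
rewrite ler_wpM2l // ler_wpM2r // !horner_exp !hornerM !hornerX !exprMn sqrrN.
have x2 : x j ^+ 2 <= 1 by rewrite exprn_ile1 // ltW.
by rewrite lerD // ler_piMl ?sqr_ge0.
Qed.

(** Normalizing the monic orthogonal polynomials turns the bound of large_at0
    into a bound for the value at 0 itself. *)
Lemma orthonormal_exists a : pd a -> exists P : nat -> {poly R},
  [/\ forall k, size (P k) = k.+1, forall k, 0 < lead_coef (P k),
      forall k m, mom a (P k * P m) = (k == m)%:R &
      forall k B, 0 <= B -> large_at0 a k (B ^+ 2) -> B <= `|(P k).[0]|].
Proof.
move=> pa; have [Q HQ] := choice (fun n => op_exists n pa).
have Q0 n : Q n != 0 by have [/monic_neq0] := HQ n.
pose h n := mom a (Q n ^+ 2); have h0 n : 0 < h n by exact: pa.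
pose s n := Num.sqrt (h n); have s0 n : 0 < s n by rewrite sqrtr_gt0.
have ss n : s n ^+ 2 = h n by rewrite sqr_sqrtr // ltW.
have orth k m : (k < m)%N -> mom a (Q k * Q m) = 0.
  move=> km; have [_ [_ H]] := HQ m; rewrite mulrC; apply: H.
  by have [_ [-> _]] := HQ k.
exists (fun n => (s n)^-1 *: Q n); split.
- move=> k; rewrite size_scale ?invr_neq0 ?gt_eqF //.
  by have [_ [-> _]] := HQ k.
- move=> k; rewrite lead_coefZ; have [/monicP -> _] := HQ k.
  by rewrite mulr1 invr_gt0.
- move=> k m; rewrite -scalerAl -scalerAr scalerA linearZ /=.
  case: (ltngtP k m) => km.
  + by rewrite orth // mulr0.
  + by rewrite mulrC [Q k * _]mulrC orth // mul0r.
  + rewrite -km -expr2 -/(h k) -ss; have := s0 k; move: (s k) => t t0.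
    by transitivity (1 : R) => //; field; rewrite gt_eqF.
- move=> k B B0 L; have := large_at0_op pa L (HQ k).
  rewrite -/(h k) -ss -exprMn => lt; rewrite hornerZ normrM normfV (gtr0_norm (s0 k)).
  rewrite mulrC ler_pdivlMr //.
  rewrite -(@ler_pXn2r _ 2) ?nnegrE ?mulr_ge0 ?(ltW (s0 k)) //.
  by rewrite real_normK ?num_real // ltW.
Qed.

End Tame.

Section Gliding.
Context {R : realType}.
Variables (delta : R) (delta_gt0 : 0 < delta).
Variable beta : nat -> R.
Hypothesis beta_gt0 : forall n, 0 < beta n.
Hypothesis beta_cvg0 : beta n @[n --> \oo] --> (0 : R).
Local Notation leb := (@lebesgue_measure R).
Local Notation mT := (measurableTypeR R).
Local Notation I := (`[-1, 1]%classic : set R).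
Local Notation am := (arcsine_measure delta_gt0 : {finite_measure set mT -> \bar R}).
Let b := moments am.

Let hb : arcsine_moments b. Proof. exact: arcsine_measure_moments. Qed.
Let b0 : 0 < b 0%N. Proof. exact: arcsine_measure0. Qed.
Let pb : pd b. Proof. exact: arcsine_pd. Qed.
Let eb : moments_even b. Proof. exact: arcsine_moments_even. Qed.
Let sb : support_in_unit b. Proof. apply: moments_support; exact: weighted_fin_I. Qed.

Let fin_I (mu : {finite_measure set mT -> \bar R}) : (mu I < +oo)%E.
Proof. by have := fin_num_measure mu I measurable_I; rewrite ge0_fin_numE. Qed.

Lemma measure_setT_I (mu : {finite_measure set mT -> \bar R}) :
  mu (~` I) = 0%E -> mu setT = mu I.
Proof.
move=> z; rewrite -(setUv I).
rewrite (measureU mu measurable_I (measurableC measurable_I) (setICr I)).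
by rewrite [X in (_ + X)%E = _]z adde0.
Qed.

Lemma beta_eventually (s : R) : 0 < s ->
  exists N, forall n, (N <= n)%N -> beta n ^+ 2 <= s.
Proof.
move=> s0; have q0 : 0 < Num.sqrt s by rewrite sqrtr_gt0.
have : \forall n \near \oo, `|beta n| <= Num.sqrt s.
  exact: (cvgr0_norm_le beta beta_cvg0).
move=> [N _ H]; exists N => n Nn; have /= := H n Nn.
rewrite gtr0_norm // => le; rewrite -[leRHS]sqr_sqrtr ?(ltW s0) //.
by rewrite ler_pXn2r // nnegrE ?(ltW (beta_gt0 _)) ?(ltW q0).
Qed.

(** One step of the construction. The constants c of the point masses and K of
    localization are known before the degree n = 2 m is chosen; since beta tends
    to 0, beta_n^2 n is below c m / K for all large m. The tolerance e' that is
    left for the smoothing and for all later humps is known only after n. *)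
Lemma next_hump F e n0 : tame b F -> 0 < e ->
  exists (n : nat) (mu : {finite_measure set mT -> \bar R}) (e' : R),
   [/\ (n0 < n)%N, 0 < e' , (mu setT <= (e - e')%:E)%E &
    [/\ mu `<< leb, mu (~` I) = 0%E, tame b (moments mu) &
    forall a, dominates a b ->
      (forall k, (k < n.*2.+1)%N -> `|a k - (b k + (F k + moments mu k))| <= e') ->
      large_at0 a n (beta n ^+ 2 * n%:R)]].
Proof.
move=> [pF eF sF [H H0 HF] [eta eta0 gF]] e0.
have e4 : 0 < e / 4 by rewrite divr_gt0.
have [c c0 hump] := hump_exists hb b0 e4.
pose K := (1 + Num.sqrt H / eta) ^+ 2 * (1 + H).
have K0 : 0 < K.
  rewrite mulr_gt0 ?exprn_gt0 // ?ltr_wpDr // divr_ge0 ?sqrtr_ge0 //.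
  exact: ltW.
have cK : 0 < c / (K * 2) by rewrite divr_gt0 // mulr_gt0.
have [N HN] := beta_eventually cK.
pose m := (maxn N n0).+1; pose n := m.*2.
have Nn : (N <= n)%N.
  apply: (leq_trans (leq_maxl N n0)); rewrite /n -addnn.
  by apply: leq_trans (leqnSn _) (leq_addr _ _).
have n0n : (n0 < n)%N.
  rewrite /n -addnn; apply: leq_trans (leq_addr _ _).
  by rewrite /m ltnS leq_maxr.
have [x [M [hx sM L]]] := hump m (ltn0Sn _).
set P := pair_moments m x M in L.
have pP : psd P by apply: pair_moments_psd => j /hx [].
have dom : dominates (fun k => b k + P k) b.
  by move=> p; rewrite momD lerDl; exact: pP.
have L1 : large_at0 (fun k => (b k + P k) + F k) n (c * m%:R / K).
  apply: large_at0_localize => //.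
  - exact: dominates_pd pb dom.
  - by move=> k ok; rewrite eb // /P pair_moments_even // addr0.
  - by move=> p; rewrite !momD; apply: lerD; [exact: sb|exact: pair_moments_support].
  - by rewrite mulr_ge0 // ltW.
  - by move=> p; apply: le_trans (HF p) _; rewrite ler_wpM2l.
  - by rewrite odd_double.

have dom1 : dominates (fun k => (b k + P k) + F k) b.
  by move=> p; rewrite !momD -addrA lerDl addr_ge0.
have L2 : large_at0 (fun k => (b k + P k) + F k) n (beta n ^+ 2 * n%:R).
  apply: large_at0_weaken L1; first by apply: pd_psd; exact: dominates_pd pb dom1.
  have nE : n%:R = m%:R * 2 :> R by rewrite /n -muln2 natrM.
  have le := HN n Nn; rewrite nE.
  have {le} : beta n ^+ 2 * (m%:R * 2) <= c / (K * 2) * (m%:R * 2) by rewrite ler_wpM2r // mulr_ge0.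
  rewrite (_ : c / (K * 2) * (m%:R * 2) = c * m%:R / K) //.
  by move: (m%:R) => t; field; rewrite gt_eqF.
have B0 : 0 <= beta n ^+ 2 * n%:R by rewrite mulr_ge0 ?sqr_ge0.
have [d d0 near] := large_at0_near pb dom1 B0 L2.
have d1 : 0 < Num.min (d / 2) (e / 4) by rewrite lt_min e4 divr_gt0.
have [mu [mu_leb mu_out mu_tame mu_near]] := smooth_pairs delta_gt0 n.*2 hx d1.
exists n, mu, (Num.min (d / 2) (e / 4)); split => //.
  rewrite measure_setT_I // (moments0 (fin_I mu)) lee_fin.
  have := mu_near 0%N (leq0n _); rewrite ler_norml => /andP[_].
  have -> : pair_moments m x M 0 = \sum_(j < m) M j.
    by apply: eq_bigr => j _; rewrite !expr0 -mulr2n divff ?mulr1.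
  have : Num.min (d / 2) (e / 4) <= e / 4 by rewrite ge_min lexx orbT.
  lra.
split => // a da ha; apply: near => // k kn.
have := ha k kn; have := mu_near k kn.
have : Num.min (d / 2) (e / 4) <= d / 2 by rewrite ge_min lexx.
rewrite -/P !ler_norml; lra.
Qed.

(** placed accumulates the moments of the humps up to the current one, and budget
    bounds the total mass that may still be added. *)
Record stage := Stage {
  placed : nat -> R;
  budget : R;
  degree : nat;
  hump : {finite_measure set mT -> \bar R} }.

Definition next_stage (S T : stage) :=
  [/\ placed T = (fun k => placed S k + moments (hump T) k),
      (degree S < degree T)%N,
      (hump T setT <= (budget S - budget T)%:E)%E,
      hump T `<< leb /\ hump T (~` I) = 0%E &
      forall a, dominates a b ->
        (forall k, (k < (degree T).*2.+1)%N ->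
           `|a k - (b k + placed T k)| <= budget T) ->
        large_at0 a (degree T) (beta (degree T) ^+ 2 * (degree T)%:R)].

Lemma stages_exist : exists S : nat -> stage,
  [/\ placed (S 0%N) = (fun=> 0), forall i, 0 < budget (S i) &
      forall i, next_stage (S i) (S i.+1)].
Proof.
pose valid S := tame b (placed S) /\ 0 < budget S.
pose S0 := @Stage (fun=> 0) 1 0 am.
have v0 : valid S0 by split => //; apply: tame0; exact: pd_psd.
have step (S : {S | valid S}) : {T : {S | valid S} | next_stage (sval S) (sval T)}.
  apply: cid; case: S => [S [vS eS]] /=.
  have [n [mu [e' [n0n e'0 mass [mu_leb mu_out mu_tame large]]]]] := next_hump (degree S) vS eS.
  have vT : valid (@Stage (fun k => placed S k + moments mu k) e' n mu).
    by split => //; exact: tameD.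
  by exists (exist _ _ vT).
have [f [f0 fS]] := dependent_choice step (exist _ _ v0).
exists (fun i => sval (f i)); split => //; first by rewrite f0.
by move=> i; have [] := svalP (f i).
Qed.

End Gliding.

Theorem theorem7p1 (R : realType) (delta : R) (delta_gt0 : 0 < delta)
    (beta : nat -> R) (beta_gt0 : forall n, 0 < beta n)
    (beta_cvg0 : beta n @[n --> \oo] --> (0 : R)) :
  exists psi : {finite_measure set (measurableTypeR R) -> \bar R},
    [/\ psi (~` `[-1, 1]) = 0%E,
        psi `<< (@lebesgue_measure R),
        {ae (@lebesgue_measure R), forall x : R, x \in `[-1, 1] ->
          (delta%:E <=
             'd (charge_of_finite_measure psi) '/d (@lebesgue_measure R) x)%E} &
        exists P : nat -> {poly R}, orthonormal_polynomials psi P /\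
        exists (c : R) (k : nat -> nat),
          [/\ 0 < c,
              {homo k : m n / (m < n)%N} &
              forall n, c * beta (k n) * Num.sqrt (k n)%:R
                          <= `|(P (k n)).[0]| ] ].
Proof.
have [S [S0 Sb Snext]] := stages_exist delta_gt0 beta_gt0 beta_cvg0.
pose am := arcsine_measure delta_gt0 : {finite_measure set (measurableTypeR R) -> \bar R}.
pose nu i := if i is j.+1 then hump (S j.+1) else am.
have am_fin := fin_num_measure am setT measurableT.
(* nu 0 is the arcsine measure, so the budgets are shifted by one and the
   first of them is enlarged by its mass. *)
pose e i := if i is j.+1 then budget (S j) else budget (S 0%N) + fine (am setT).
have e0 i : 0 <= e i.
  by case: i => [|j]; rewrite /e ?addr_ge0 ?(ltW (Sb _)) // fine_ge0.
have nu_le i : (nu i setT <= (e i - e i.+1)%:E)%E.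
  case: i => [|i] /=; first by rewrite addrAC subrr add0r fineK.
  by have [] := Snext i.
have [psi [psi_out psi_leb psi_ge psi_dom psi_near]] := sum_measure_exists e0 nu_le.
have nu_out i : nu i (~` `[-1, 1]%classic : set R) = 0%E.
  case: i => [|i]; first exact: arcsine_measure_out.
  by have [_ _ _ []] := Snext i.
have nu_leb i : nu i `<< (@lebesgue_measure R).
  case: i => [|i]; first exact: weighted_dominates.
  by have [_ _ _ []] := Snext i.
have psi_pd : pd (moments psi).
  apply: dominates_pd psi_dom; apply: arcsine_pd.
    exact: arcsine_measure_moments.
  exact: arcsine_measure0.
have placedE n k : placed (S n) k = \sum_(i < n) moments (nu i.+1) k.
  elim: n => [|n IH]; first by rewrite S0 big_ord0.
  by have [-> _ _ _ _] := Snext n; rewrite IH big_ord_recr.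
have large n : large_at0 (moments psi) (degree (S n.+1))
    (beta (degree (S n.+1)) ^+ 2 * (degree (S n.+1))%:R).
  have [_ _ _ _ H] := Snext n; apply: H => // k _.
  rewrite placedE.
  by have := psi_near n.+2 k; rewrite big_ord_recl.
exists psi; split.
- exact: psi_out.
- exact: psi_leb.
- apply: density_ge; first exact: psi_leb.
  by move=> A mA; apply: le_trans (psi_ge A mA); exact: arcsine_measure_ge.
have [P [sP lP oP BP]] := orthonormal_exists psi_pd.
exists P; split.
  split => // k m.
  have psiI : (psi `[(-1)%R, 1%R]%classic < +oo)%E.
    by have := fin_num_measure psi _ (@measurable_I R); rewrite ge0_fin_numE.
  rewrite -oP -(momentsE _ psiI).
  by apply: eq_integral => x _; rewrite hornerM.
(* No constant is lost: beta absorbed them all when the degrees were chosen. *)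
exists 1, (fun n => degree (S n.+1)); split => //.
  apply: homo_ltn => [|i]; first exact: ltn_trans.
  by have [] := Snext i.+1.
move=> n; rewrite mul1r; apply: BP.
  by rewrite mulr_ge0 ?sqrtr_ge0 ?(ltW (beta_gt0 _)).
by rewrite exprMn sqr_sqrtr // ; exact: large.
Qed.
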